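(* Let $\mathscr A$ be a complexified, primitive and essential toric arrangement in $(\mathbb C^* )^d$. Then the face category $\mathcal F(\mathscr A)$ of the polyhedral decomposition of the compact torus $(S^1)^d$ induced by $\mathscr A$ admits a perfect acyclic matching, i.e. an acyclic matching whose number of critical elements of rank $k$ equals the Betti number $\beta_k((S^1)^d)$ for every $k$.
   Context: **Toric arrangements.** A toric arrangement in $(\mathbb C^* )^d$ is a finite set $\mathscr A=\{(\alpha_1,a_1),\dots,(\alpha_n,a_n)\}\subset\mathbb Z^d\times\mathbb C^*$, where $\alpha\in\mathbb Z^d$ encodes the character $x\mapsto x^\alpha=x_1^{\alpha(1)}\cdots x_d^{\alpha(d)}$; put $K_i=\{x\in(\mathbb C^* )^d\mid x^{\alpha_i}=a_i\}$. It is complexified if all $a_i\in S^1=\{|z|=1\}$; primitive if each $\alpha_i$ is a primitive vector (i.e. $\alpha_i=k\psi$ with $\psi\in\mathbb Z^d$, $k\in\mathbb Z$ only for $k=\pm1$); essential if the $\alpha_i$ span a subgroup of rank $d$. **Face category.** Let $\mathscr A^{\upharpoonright}$ be the locally finite affine hyperplane arrangement in $\mathbb R^d$ consisting of all $\{x\in\mathbb R^d\mid\langle\alpha,x\rangle=t\}$ with $t\in\mathbb R$ and $(\alpha,e^{2\pi i t})\in\mathscr A$; it is the preimage of $\{K_i\cap (S^1)^d\}$ under the universal covering $\mathbb R^d\to (S^1)^d$, $(t_j)\mapsto(e^{2\pi i t_j})$. The chambers of $\mathscr A^{\upharpoonright}$ are the connected components of the complement of its union in $\mathbb R^d$, its faces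 are the (nonempty) relative interiors of intersections $\overline C\cap X$, with $C$ a chamber and $X$ an intersection of hyperplanes, and faces are ordered by $F\le G$ iff $F\subseteq\overline G$. This gives the face poset $\mathcal F(\mathscr A^{\upharpoonright})$, on which $\mathbb Z^d$ acts freely by translations. The face category $\mathcal F(\mathscr A)=\mathcal F(\mathscr A^{\upharpoonright})/\mathbb Z^d$ has as objects the $\mathbb Z^d$-orbits of faces (equivalently, the cells of the induced decomposition of $(S^1)^d$) and as morphisms the $\mathbb Z^d$-orbits of pairs $\tilde F\le\tilde G$ (going from the orbit of $\tilde F$ to the orbit of $\tilde G$), composed via compatible representatives. The rank of an object is the dimension of the face. **Matchings.** An acyclic category is a small category in which the only endomorphisms are identities and these are the only invertible morphisms. A morphism is indecomposable if it is not an identity and is not a composition of two nonidentity morphisms. A matching of an acyclic category $\mathcal C$ is a set $\mathfrak M$ of indecomposable morphisms such that for any two distinct $m,m'\in\mathfrak M$ the sources and targets of $m$ and $m'$ are four distinct objects. A cycle of $\mathfrak M$ is a sequence of morphisms $a_1b_1a_2b_2\cdots a_nb_n$ with $n\ge1$, $a_i\notin\mathfrak M$, $b_i\in\mathfrak M$, such that the targets of $a_i$ and $b_i$ coincide for all $i$, the sources of $a_{i+1}$ and $b_i$ coincide for $i<n$, and the sources of $a_1$ and $b_n$ coincide. $\mathfrak M$ is acyclic if it has no cycles. A critical element is an object that is neither source nor target of any $m\in\mathfrak M$. *)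

(* Defs.v *)
From HB Require Import structures.
From mathcomp Require Import all_boot all_order all_algebra finmap.
From mathcomp Require Import complex.
From mathcomp Require Import all_classical all_reals all_analysis.
From mathcomp.multinomials Require Import freeg.
From mathcomp Require Import lra.

Set Implicit Arguments.
Unset Strict Implicit.
Unset Printing Implicit Defensive.

Import Order.TTheory GRing.Theory Num.Theory numFieldNormedType.Exports.

Local Open Scope classical_set_scope.
Local Open Scope card_scope.
Local Open Scope ring_scope.
Local Open Scope complex_scope.

(* [comp f g h] : [f] followed by [g] equals [h] (diagrammatic order). *)
Record category := Category {
  ob : choiceType;
  mor : Type;
  src : mor -> ob;
  tgt : mor -> ob;
  idm : ob -> mor;
  comp : mor -> mor -> mor -> Prop;
  src_idm : forall x, src (idm x) = x;
  tgt_idm : forall x, tgt (idm x) = x;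
  comp_ex : forall f g, (exists h, comp f g h) <-> tgt f = src g;
  comp_uniq : forall f g h h', comp f g h -> comp f g h' -> h = h';
  src_comp : forall f g h, comp f g h -> src h = src f;
  tgt_comp : forall f g h, comp f g h -> tgt h = tgt g;
  comp_idl : forall f, comp (idm (src f)) f f;
  comp_idr : forall f, comp f (idm (tgt f)) f;
  compA : forall f g h fg gh k,
    comp f g fg -> comp g h gh -> comp fg h k -> comp f gh k }.

Section Matchings.
Context {C : category}.
Implicit Types (m : mor C) (M : set (mor C)) (x : ob C).

Definition is_identity m := exists x, m = idm x.

Definition indecomposable m :=
  ~ is_identity m /\
  ~ exists f g, [/\ ~ is_identity f, ~ is_identity g & comp f g m].

Definition matching M :=
  (forall m, M m -> indecomposable m) /\
  (forall m m', M m -> M m' -> m <> m' ->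
     uniq [:: src m; tgt m; src m'; tgt m']).

(* [ordS] is the cyclic successor of ['I_n], so the last equation covers both
   [src a_{i+1} = src b_i] for [i < n] and [src a_1 = src b_n]. *)
Definition matching_cycle M n (a b : 'I_n -> mor C) :=
  [/\ (0 < n)%N,
      forall i, ~ M (a i),
      forall i, M (b i),
      forall i, tgt (a i) = tgt (b i)
    & forall i, src (a (ordS i)) = src (b i)].

Definition acyclic_matching M :=
  matching M /\ forall n (a b : 'I_n -> mor C), ~ matching_cycle M a b.

Definition critical M x := forall m, M m -> src m <> x /\ tgt m <> x.

End Matchings.

Section Singular.
Variable R : realType.

Definition std_simplex k : set 'rV[R]_k.+1 :=
  [set x | (forall i, 0 <= x 0 i) /\ \sum_i x 0 i = 1].
Arguments std_simplex : clear implicits.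

Definition coface_row k (i : 'I_k.+2) (x : 'rV[R]_k.+1) : 'rV[R]_k.+2 :=
  \row_j (if unlift i j is Some l then x 0 l else 0).

Lemma coface_rowP k (i : 'I_k.+2) (x : std_simplex k) :
  coface_row i (\val x) \in std_simplex k.+1.
Proof.
have /set_mem [x0 x1] := valP x; apply/mem_set; split=> [j|].
  by rewrite mxE; case: unlift.
rewrite (bigD1_ord i) //= mxE unlift_none add0r -[RHS]x1.
by apply: eq_bigr => j _; rewrite mxE liftK.
Qed.

Definition coface k (i : 'I_k.+2) (x : std_simplex k) : std_simplex k.+1 :=
  SigSub (coface_rowP i x).

Lemma coface_row_continuous k (i : 'I_k.+2) : continuous (@coface_row k i).
Proof.
move=> x A [P xP PA].
exists (fun r l => P r (fintype.lift i l)) => [r l|y yP].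
  by have := xP r (fintype.lift i l); rewrite mxE liftK ord1.
apply: PA => r j; rewrite mxE ord1; case: unliftP => [l ->|->].
  by have := yP 0 l.
by have /nbhs_singleton := xP 0 i; rewrite mxE unlift_none.
Qed.

Lemma coface_continuous k (i : 'I_k.+2) : continuous (@coface k i : std_simplex k -> std_simplex k.+1).
Proof.
apply: continuous_comp_initial => x.
apply: (@continuous_comp _ _ _ (set_val : std_simplex k -> _) (coface_row i)).
  exact: initial_continuous.
exact: coface_row_continuous.
Qed.

HB.instance Definition _ k (i : 'I_k.+2) :=
  @isContinuous.Build _ _ (@coface k i) (@coface_continuous k i).

Variable X : topologicalType.

Definition singular_simplex k := continuousType (std_simplex k) X.

Definition singular_chain k := {freeg (singular_simplex k) / rat}.

Definition singular_face k (i : 'I_k.+2) (s : singular_simplex k.+1) :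
  singular_simplex k := s \o coface i.

Definition boundary k : singular_chain k.+1 -> singular_chain k :=
  fglift (fun s => \sum_(i < k.+2) (-1) ^+ i *: << singular_face i s >>).

Definition is_cycle k : singular_chain k -> Prop :=
  if k is k'.+1 then fun c => boundary c = 0 else fun=> True.

(* [dim H_k(X; rat) = b]: the classes of some cycles [z_1, .., z_b] form a
   basis of cycles modulo boundaries. *)
Definition is_betti_number k (b : nat) :=
  exists z : 'I_b -> singular_chain k,
  [/\ forall i, is_cycle (z i),
      forall q : 'I_b -> rat,
        (exists w, \sum_i q i *: z i = boundary w) -> forall i, q i = 0
    & forall c, is_cycle c -> exists (q : 'I_b -> rat) w,
        c = \sum_i q i *: z i + boundary w].

End Singular.

Arguments std_simplex R k : clear implicits.

Definition perfect_acyclic_matching (R : realType) (C : category)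
    (rk : ob C -> nat) (X : topologicalType) (M : set (mor C)) :=
  acyclic_matching M /\
  forall k, exists2 b, is_betti_number R X k b
                     & [set x | critical M x /\ rk x = k] #= `I_b.

Section ToricArrangement.
Variables (R : realType) (d : nat).

Record toric_arrangement := ToricArrangement {
  toric_fset :> {fset 'rV[int]_d * R[i]};
  toric_neq0 : forall p, p \in toric_fset -> p.2 != 0 }.

Implicit Types A : toric_arrangement.

Definition complexified A := forall p, p \in toric_fset A -> `|p.2| = 1.

Definition primitive_vector (a : 'rV[int]_d) :=
  forall (k : int) (psi : 'rV[int]_d), a = k *: psi -> k = 1 \/ k = -1.

Definition primitive A := forall p, p \in toric_fset A -> primitive_vector p.1.

(* The rank of a subgroup of [Z^d] is the dimension of its rational span. *)
Definition essential A :=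
  \rank (\sum_(p <- enum_fset A)
           <<map_mx (intr : int -> rat) p.1>>)%MS = d.

Definition compact_torus : set 'rV[(R[i])^o]_d :=
  [set x | forall j, `|x 0 j| = 1].

Definition pairing (a : 'rV[int]_d) (x : 'rV[R]_d) : R :=
  \sum_j (a 0 j)%:~R * x 0 j.

Definition exp2ipi (t : R) : R[i] :=
  cos (2 * pi * t) +i* sin (2 * pi * t).

Definition hyperplane (a : 'rV[int]_d) (t : R) : set 'rV[R]_d :=
  [set x | pairing a x = t].

Definition lift_arrangement A : set (set 'rV[R]_d) :=
  [set H | exists a t, (a, exp2ipi t) \in toric_fset A /\ H = hyperplane a t].

Definition chambers A : set (set 'rV[R]_d) :=
  [set connected_component (~` \bigcup_(H in lift_arrangement A) H) x
    | x in ~` \bigcup_(H in lift_arrangement A) H].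

(* The empty intersection is the whole space. *)
Definition flats A : set (set 'rV[R]_d) :=
  [set \bigcap_(H in S) H | S in [set S | S `<=` lift_arrangement A]].

Definition affine_hull (P : set 'rV[R]_d) : set 'rV[R]_d :=
  [set y | exists n (p : 'I_n -> 'rV[R]_d) (c : 'I_n -> R),
    [/\ forall i, P (p i), \sum_i c i = 1 & y = \sum_i c i *: p i]].

Definition relative_interior (P : set 'rV[R]_d) : set 'rV[R]_d :=
  [set x | P x /\ \forall y \near x, affine_hull P y -> P y].

Definition faces A : set (set 'rV[R]_d) :=
  [set F | F !=set0 /\
    exists K X, [/\ chambers A K, flats A X
                  & F = relative_interior (closure K `&` X)]].

Definition face_le (F G : set 'rV[R]_d) := F `<=` closure G.

(* Dimension of the affine hull: one less than the largest number of affinely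
   independent points [x, x + M_1, .., x + M_k] of [F]. *)
Definition face_dim (F : set 'rV[R]_d) : nat :=
  \max_(k < d.+1 | `[< exists (x : 'rV[R]_d) (M : 'M[R]_(k, d)),
      [/\ F x, forall i, F (x + row i M) & row_free M] >]) k.

Definition translate (v : 'rV[int]_d) (F : set 'rV[R]_d) : set 'rV[R]_d :=
  [set x + map_mx intr v | x in F].

Definition face_orbit (F : set 'rV[R]_d) : set (set 'rV[R]_d) :=
  [set translate v F | v in setT].

Definition pair_orbit (F G : set 'rV[R]_d) :
    set (set 'rV[R]_d * set 'rV[R]_d) :=
  [set (translate v F, translate v G) | v in setT].

Definition face_ob A : set (set (set 'rV[R]_d)) :=
  [set face_orbit F | F in faces A].

Definition face_mor A : set (set (set 'rV[R]_d * set 'rV[R]_d)) :=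
  [set m | exists F G, [/\ faces A F, faces A G, face_le F G
                         & m = pair_orbit F G]].

Local Notation "v %:V" := (map_mx intr v : 'rV[R]_d) (at level 2, format "v %:V").

Lemma translateE (v : 'rV[int]_d) (F : set 'rV[R]_d) : translate v F = [set x | F (x - v%:V)].
Proof.
apply/seteqP; split=> [_ [x Fx <-] /=|x /= Fx]; first by rewrite addrK.
by exists (x - v%:V) => //; rewrite subrK.
Qed.

Lemma translate0 (F : set 'rV[R]_d) : translate 0 F = F.
Proof. by rewrite translateE map_mx0; under eq_set do rewrite subr0. Qed.

Lemma translateD u v (F : set 'rV[R]_d) :
  translate (u + v) F = translate u (translate v F).
Proof.
rewrite !translateE; apply/funext => x /=.
by rewrite map_mxD opprD addrA.
Qed.

Lemma translateK v (F : set 'rV[R]_d) : translate (- v) (translate v F) = F.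
Proof. by rewrite -translateD addNr translate0. Qed.

Lemma translateKV v (F : set 'rV[R]_d) : translate v (translate (- v) F) = F.
Proof. by rewrite -translateD addrN translate0. Qed.

Lemma translateS v (F G : set 'rV[R]_d) :
  F `<=` G -> translate v F `<=` translate v G.
Proof. by move=> FG _ [x /FG Gx <-]; exists x. Qed.

Lemma sub_translate v (F G : set 'rV[R]_d) :
  translate (- v) F `<=` G -> F `<=` translate v G.
Proof. by move=> /(@translateS v); rewrite translateKV. Qed.

(* One inclusion suffices, since translations are invertible. *)
Lemma translate_comm (op : set 'rV[R]_d -> set 'rV[R]_d) :
  (forall v F, translate v (op F) `<=` op (translate v F)) ->
  forall v F, op (translate v F) = translate v (op F).
Proof.
move=> H v F; apply/seteqP; split; last exact: H.
apply: sub_translate.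
by rewrite -[X in _ `<=` op X](translateK v); exact: H.
Qed.

Lemma nbhs_shift (u x : 'rV[R]_d) (B : set 'rV[R]_d) :
  nbhs (x + u) B -> nbhs x [set y | B (y + u)].
Proof.
move=> /nbhs_ballP [e e0 eB]; apply/nbhs_ballP; exists e => // y [_ xy] /=.
apply: eB; split=> // i j; have := xy i j; rewrite !mxE -!ball_normE /=.
by rewrite opprD addrACA subrr addr0.
Qed.

Lemma shift_continuous (u : 'rV[R]_d) : continuous (fun y : 'rV[R]_d => y + u).
Proof. by move=> x B /= /nbhs_shift. Qed.

Lemma closure_translate v (F : set 'rV[R]_d) :
  closure (translate v F) = translate v (closure F).
Proof.
apply: translate_comm => {}v {}F _ [x Fx <-] B /nbhs_shift /Fx [y [Fy By]].
by exists (y + v%:V); split=> //; exists y.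
Qed.

Lemma affine_hull_translate v (F : set 'rV[R]_d) :
  affine_hull (translate v F) = translate v (affine_hull F).
Proof.
apply: translate_comm => {}v {}F _ [_ [n [p [c [Fp c1 ->]]]] <-].
exists n, (fun i => p i + v%:V), c; split=> // [i|]; first by exists (p i).
under [RHS]eq_bigr do rewrite scalerDr.
by rewrite big_split /= -scaler_suml c1 scale1r.
Qed.

Lemma relative_interior_translate v (F : set 'rV[R]_d) :
  relative_interior (translate v F) = translate v (relative_interior F).
Proof.
apply: translate_comm => {}v {}F _ [x [Fx nF] <-]; split; first by exists x.
have := @nbhs_shift (- v%:V) (x + v%:V) [set y | affine_hull F y -> F y].
rewrite addrK => /(_ nF) /=; apply: filterS => y /= Hy.
by rewrite affine_hull_translate !translateE.
Qed.

Lemma face_le_translate v (F G : set 'rV[R]_d) :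
  face_le F G -> face_le (translate v F) (translate v G).
Proof. by rewrite /face_le closure_translate; exact: translateS. Qed.

Lemma exp2ipi_int (t : R) (k : int) : exp2ipi (t + k%:~R) = exp2ipi t.
Proof.
suff H (n : nat) (s : R) : exp2ipi (s + n%:R) = exp2ipi s.
  case: k => n; first exact: H.
  by rewrite NegzE mulrNz -[in RHS](subrK (n.+1%:R : R) t) H.
rewrite /exp2ipi.
have -> : 2 * pi * (s + n%:R) = 2 * pi * s + pi *+ 2 *+ n :> R.
  by rewrite mulrDr mulr_natr [X in _ + X *+ n]mulrC mulr_natr.
by rewrite (periodicn (@cosD2pi R)) (periodicn (@sinD2pi R)).
Qed.

Definition zdot (a v : 'rV[int]_d) : int := \sum_j a 0 j * v 0 j.

Lemma pairingD a (x y : 'rV[R]_d) : pairing a (x + y) = pairing a x + pairing a y.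
Proof.
rewrite /pairing -big_split /=; apply: eq_bigr => j _.
by rewrite mxE mulrDr.
Qed.

Lemma pairing_int a (v : 'rV[int]_d) : pairing a v%:V = (zdot a v)%:~R.
Proof.
rewrite /pairing /zdot rmorph_sum /=; apply: eq_bigr => j _.
by rewrite mxE rmorphM.
Qed.

Lemma lift_arrangement_translate A v H :
  lift_arrangement A H -> lift_arrangement A (translate v H).
Proof.
move=> [a [t [At ->]]]; exists a, (t + (zdot a v)%:~R); split.
  by rewrite exp2ipi_int.
rewrite translateE; apply/funext => x; apply/propext; rewrite /hyperplane /=.
rewrite -{2}(subrK v%:V x). rewrite [pairing a (_ + v%:V)]pairingD pairing_int; split=> [->//|].
exact: addIr.
Qed.

Lemma complement_translate A v :
  translate v (~` \bigcup_(H in lift_arrangement A) H) =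
  ~` \bigcup_(H in lift_arrangement A) H.
Proof.
have sub u : translate u (~` \bigcup_(H in lift_arrangement A) H) `<=`
  ~` \bigcup_(H in lift_arrangement A) H.
  move=> _ [x nx <-] [H AH Hx]; apply: nx; exists (translate (- u) H).
    exact: lift_arrangement_translate.
  by rewrite translateE /= map_mxN opprK.
apply/seteqP; split; first exact: sub.
apply: sub_translate; exact: sub.
Qed.

Lemma connected_component_translate v U x :
  translate v (connected_component U x) =
  connected_component (translate v U) (x + v%:V).
Proof.
have sub u W y : translate u (connected_component W y) `<=`
    connected_component (translate u W) (y + u%:V).
  move=> _ [z [D [Dy DW cD] Dz] <-]; exists (translate u D); last by exists z.
  split; [by exists y | exact: translateS |].
  apply: connected_continuous_connected => //; exact/continuous_subspaceT/shift_continuous.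
apply/seteqP; split; first exact: sub.
apply: sub_translate.
have := sub (- v) (translate v U) (x + v%:V).
by rewrite translateK map_mxN addrK.
Qed.

Lemma chambers_translate A v K : chambers A K -> chambers A (translate v K).
Proof.
move=> [x Ux <-]; exists (x + v%:V).
  by rewrite -(complement_translate A v); exists x.
by rewrite connected_component_translate complement_translate.
Qed.

Lemma flats_translate A v X : flats A X -> flats A (translate v X).
Proof.
move=> [S SA <-]; exists (translate v @` S).
  by move=> _ [H /SA AH <-]; exact: lift_arrangement_translate.
rewrite translateE; apply/seteqP; split=> x.
  move=> xS H SH; have /= := xS _ (imageP (translate v) SH).
  by rewrite translateE.
by move=> xS _ [H SH <-]; rewrite translateE /=; exact: xS.
Qed.

Lemma translateI v (F G : set 'rV[R]_d) :
  translate v (F `&` G) = translate v F `&` translate v G.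
Proof. by rewrite !translateE. Qed.

Lemma faces_translate A v F : faces A F -> faces A (translate v F).
Proof.
move=> [[x Fx] [K [X [AK AX defF]]]]; split.
  by exists (x + v%:V); exists x.
exists (translate v K), (translate v X); split.
- exact: chambers_translate.
- exact: flats_translate.
by rewrite closure_translate -translateI relative_interior_translate -defF.
Qed.

Lemma exp2ipi_surj (z : R[i]) : `|z| = 1 -> exists t : R, exp2ipi t = z.
Proof.
case: z => x y; rewrite normc_def => -[] /(congr1 (fun u => u ^+ 2)).
rewrite sqr_sqrtr ?addr_ge0 ?sqr_ge0// expr1n => xy1.
have y2 : 1 - x ^+ 2 = y ^+ 2 by rewrite -xy1 addrAC subrr add0r.
have x1 : -1 <= x <= 1.
  by rewrite -ler_norml -(@expr_le1 _ 2) // real_normK ?num_real // -subr_ge0 y2 sqr_ge0.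
have pi0 : (2 * pi : R) != 0 by rewrite mulf_neq0 ?pnatr_eq0// gt_eqF ?pi_gt0.
have xK : cos (acos x) = x by rewrite acosK// in_itv.
have yK : sin (acos x) = `|y| by rewrite sin_acos // y2 sqrtr_sqr.
have [y0|y0] := leP 0 y.
  exists (acos x / (2 * pi)); rewrite /exp2ipi mulrC divfK //.
  by rewrite xK yK ger0_norm.
exists (- (acos x / (2 * pi))); rewrite /exp2ipi mulrN mulrC divfK //.
by rewrite cosN sinN xK yK ltr0_norm // opprK.
Qed.

Lemma pairing_continuous a : continuous (pairing a).
Proof.
apply: continuous_big => [|j _]; first exact: add_continuous.
move=> x; apply: (@continuousM R) => [|]; first exact: cst_continuous.
exact: coord_continuous.
Qed.

Lemma chamber_bounded A a z K : (a, z) \in toric_fset A -> `|z| = 1 ->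
  chambers A K -> exists m : R, forall x, closure K x -> m <= pairing a x <= m + 1.
Proof.
move=> Aaz z1 [x0 Ux0 defK]; have [t tz] := exp2ipi_surj z1.
pose m := t + (Num.floor (pairing a x0 - t))%:~R.
have Hm (k : int) : lift_arrangement A (hyperplane a (t + k%:~R)).
  by exists a, (t + k%:~R); rewrite exp2ipi_int tz.
have itvK : is_interval (pairing a @` K).
  apply/connected_intervalP; apply: connected_continuous_connected.
    by rewrite -defK; exact: component_connected.
  exact/continuous_subspaceT/pairing_continuous.
have Kx0 : K x0.
  by rewrite -defK; exact: connected_component_refl.
have nK (k : int) : ~ (pairing a @` K) (t + k%:~R).
  move=> [y Ky yk]; move: Ky; rewrite -defK => /connected_component_sub; apply.
  by exists (hyperplane a (t + k%:~R)).
have /andP[m0 m1] : m <= pairing a x0 <= m + 1.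
  have /andP[] := floor_itv (pairing a x0 - t); rewrite intrD /m => f0 f1.
  by apply/andP; split; lra.
have bK y : K y -> m <= pairing a y <= m + 1.
  move=> Ky; apply/andP; split.
    rewrite leNgt; apply/negP => ym.
    apply: (nK (Num.floor (pairing a x0 - t))).
    by apply: (itvK _ _ (imageP _ Ky) (imageP _ Kx0)); rewrite ltW.
  rewrite leNgt; apply/negP => ym.
  apply: (nK (Num.floor (pairing a x0 - t) + 1)); rewrite intrD addrA.
  by apply: (itvK _ _ (imageP _ Kx0) (imageP _ Ky)); rewrite m1 ltW.
exists m => x; have cl : closed [set y | m <= pairing a y <= m + 1].
  rewrite (_ : [set _ | _] = pairing a @^-1` `[m, m + 1]).
    apply: closed_comp; last exact: itv_closed.
    by move=> ? _; exact: pairing_continuous.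
  by apply/seteqP; split=> y /=; rewrite in_itv.
by move=> clx; have := closure_subset bK clx; rewrite -(closure_id _).1.
Qed.

Lemma face_bounded A a z F : (a, z) \in toric_fset A -> `|z| = 1 ->
  faces A F -> exists m : R, forall x, F x -> m <= pairing a x <= m + 1.
Proof.
move=> Aaz z1 [_ [K [X [AK _ ->]]]]; have [m Hm] := chamber_bounded Aaz z1 AK.
by exists m => x [[clx _] _]; exact: Hm.
Qed.

Lemma essential_eq0 A (v : 'rV[int]_d) : essential A ->
  (forall p, p \in toric_fset A -> zdot p.1 v = 0) -> v = 0.
Proof.
move=> Aess Av0; pose w : 'rV[rat]_d := map_mx intr v.
have w0 : (\sum_(p <- enum_fset A)
           <<map_mx (intr : int -> rat) p.1>>)%MS *m w^T = 0.
  apply/eqP; rewrite -sub_kermx big_seq; apply: (big_ind (fun M => (M <= kermx w^T)%MS)).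
  - exact: sub0mx.
  - by move=> M N kM kN; rewrite addsmx_sub kM kN.
  move=> p Ap; rewrite genmxE sub_kermx; apply/eqP/matrixP => i j.
  rewrite !mxE; have /(congr1 (intr : int -> rat)) := Av0 p Ap.
  rewrite rmorph0 rmorph_sum /= => E; rewrite -[RHS]E.
  by apply: eq_bigr => l _; rewrite !mxE rmorphM !ord1.
have Su : (\sum_(p <- enum_fset A)
            <<map_mx (intr : int -> rat) p.1>>)%MS \in unitmx.
  by rewrite -row_free_unit /row_free Aess.
have /matrixP wT0 : w^T = 0 by rewrite -[LHS](mulKmx Su) w0 mulmx0.
apply/matrixP => i j; have := wT0 j i; rewrite !mxE => /eqP.
by rewrite intr_eq0 => /eqP.
Qed.

Lemma translate_free A F v : complexified A -> essential A ->
  faces A F -> translate v F = F -> v = 0.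
Proof.
move=> Ac Ae AF vF; apply: (essential_eq0 Ae) => -[a z] Aaz /=.
have [m Hm] := face_bounded Aaz (Ac _ Aaz) AF.
have [[x Fx] _] := AF.
have Fn (n : nat) : F (x + (v *+ n)%:V).
  elim: n => [|n IHn]; first by rewrite mulr0n map_mx0 addr0.
  rewrite mulrSr map_mxD addrA -vF; exists (x + (v *+ n)%:V) => //.
have := Hm _ (Fn 2); have := Hm _ Fx.
rewrite pairingD pairing_int => /andP[x0 x1] /andP[]; move: x0 x1.
have -> : zdot a (v *+ 2) = zdot a v *+ 2.
  by rewrite /zdot -sumrMnl; apply: eq_bigr => j _; rewrite mulr2n mxE mulrDr.
rewrite mulr2n intrD; set z' := zdot a v => x0 x1 y0 y1.
apply/eqP; rewrite eq_le -!ltzD1 -(ltr_int R) -[X in _ && X](ltr_int R) !intrD.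
by apply/andP; split; lra.
Qed.

Implicit Types F G H : set 'rV[R]_d.

Lemma face_orbitP F G : face_orbit F = face_orbit G <-> exists v, G = translate v F.
Proof.
split=> [FG|[v ->]].
  have [v _ <-] : face_orbit F G by rewrite FG; exists 0 => //; exact: translate0.
  by exists v.
apply/seteqP; split=> _ [u _ <-].
  by exists (u - v) => //; rewrite -translateD subrK.
by exists (u + v) => //; rewrite translateD.
Qed.

Lemma pair_orbitP F G F' G' : pair_orbit F G = pair_orbit F' G' <->
  exists v, F' = translate v F /\ G' = translate v G.
Proof.
split=> [FG|[v [-> ->]]].
  have [v _ [<- <-]] : pair_orbit F G (F', G').
    by rewrite FG; exists 0 => //; rewrite !translate0.
  by exists v.
apply/seteqP; split=> _ [u _ <-].
  by exists (u - v) => //; rewrite -!translateD subrK.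
by exists (u + v) => //; rewrite !translateD.
Qed.

Lemma fst_pair_orbit F G : fst @` pair_orbit F G = face_orbit F.
Proof.
apply/seteqP; split=> [_ [_ [v _ <-] <-]|_ [v _ <-]]; first by exists v.
by exists (translate v F, translate v G) => //; exists v.
Qed.

Lemma snd_pair_orbit F G : snd @` pair_orbit F G = face_orbit G.
Proof.
apply/seteqP; split=> [_ [_ [v _ <-] <-]|_ [v _ <-]]; first by exists v.
by exists (translate v F, translate v G) => //; exists v.
Qed.

Lemma face_le_refl F : face_le F F.
Proof. exact: subset_closure. Qed.

Lemma face_le_trans F G H : face_le F G -> face_le G H -> face_le F H.
Proof.
move=> FG GH; apply: (subset_trans FG).
rewrite [X in _ `<=` X](closure_id _).1; last exact: closed_closure.
exact: closureS.
Qed.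

Section FaceCategory.
Variable A : toric_arrangement.

Lemma face_ob_src (m : face_mor A) : fst @` \val m \in face_ob A.
Proof.
have /set_mem [F [G [AF _ _ ->]]] := valP m; apply/mem_set.
by rewrite fst_pair_orbit; exists F.
Qed.

Lemma face_ob_tgt (m : face_mor A) : snd @` \val m \in face_ob A.
Proof.
have /set_mem [F [G [_ AG _ ->]]] := valP m; apply/mem_set.
by rewrite snd_pair_orbit; exists G.
Qed.

Lemma face_mor_id (x : face_ob A) : [set (F, F) | F in \val x] \in face_mor A.
Proof.
have /set_mem [F AF <-] := valP x; apply/mem_set; exists F, F.
split=> //; first exact: face_le_refl.
apply/seteqP; split=> [_ [_ [v _ <-] <-]|_ [v _ <-]]; first by exists v.
by exists (translate v F) => //; exists v.
Qed.

Definition face_src (m : face_mor A) : face_ob A := SigSub (face_ob_src m).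

Definition face_tgt (m : face_mor A) : face_ob A := SigSub (face_ob_tgt m).

Definition face_id (x : face_ob A) : face_mor A := SigSub (face_mor_id x).

Definition face_comp (f g h : face_mor A) :=
  exists F G H,
  [/\ faces A F, faces A G & faces A H] /\
  [/\ face_le F G, face_le G H, \val f = pair_orbit F G,
      \val g = pair_orbit G H & \val h = pair_orbit F H].

Lemma face_morW (m : face_mor A) : exists F G,
  [/\ faces A F, faces A G, face_le F G & \val m = pair_orbit F G].
Proof. exact: set_mem (valP m). Qed.

Lemma face_comp_repl f g h F G : face_comp f g h -> \val f = pair_orbit F G ->
  exists H, [/\ faces A H, face_le G H, \val g = pair_orbit G H
               & \val h = pair_orbit F H].
Proof.
move=> [F' [G' [H' [[AF' AG' AH'] [FG' GH' -> -> ->]]]]].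
move=> /pair_orbitP [v [-> ->]]; exists (translate v H'); split.
- exact: faces_translate.
- exact: face_le_translate.
- by apply/pair_orbitP; exists v.
- by apply/pair_orbitP; exists v.
Qed.

Lemma face_src_orbit (f : face_mor A) F G :
  \val f = pair_orbit F G -> \val (face_src f) = face_orbit F.
Proof. by move=> /= ->; exact: fst_pair_orbit. Qed.

Lemma face_tgt_orbit (f : face_mor A) F G :
  \val f = pair_orbit F G -> \val (face_tgt f) = face_orbit G.
Proof. by move=> /= ->; exact: snd_pair_orbit. Qed.

Lemma face_id_orbit (x : face_ob A) F :
  \val x = face_orbit F -> \val (face_id x) = pair_orbit F F.
Proof.
move=> /= ->; apply/seteqP; split=> [_ [_ [v _ <-] <-]|_ [v _ <-]].
  by exists v.
by exists (translate v F) => //; exists v.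
Qed.

Lemma face_src_id x : face_src (face_id x) = x.
Proof.
apply: val_inj; have /set_mem [F AF /esym xF] := valP x.
by rewrite (face_src_orbit (face_id_orbit xF)) xF.
Qed.

Lemma face_tgt_id x : face_tgt (face_id x) = x.
Proof.
apply: val_inj; have /set_mem [F AF /esym xF] := valP x.
by rewrite (face_tgt_orbit (face_id_orbit xF)) xF.
Qed.

Lemma face_comp_ex f g : (exists h, face_comp f g h) <-> face_tgt f = face_src g.
Proof.
split=> [[h [F [G [H [_ [_ _ fE gE _]]]]]]|].
  by apply: val_inj; rewrite (face_tgt_orbit fE) (face_src_orbit gE).
have [F [G [AF AG FG fE]]] := face_morW f.
have [G' [H [AG' AH GH gE]]] := face_morW g.
move=> /(congr1 \val); rewrite (face_tgt_orbit fE) (face_src_orbit gE).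
move=> /esym/face_orbitP [v Gv].
have AH' := faces_translate v AH; have := face_le_translate (v := v) GH.
rewrite -Gv => GH'.
have hP : pair_orbit F (translate v H) \in face_mor A.
  by apply/mem_set; exists F, (translate v H); split=> //; exact: face_le_trans GH'.
exists (SigSub hP), F, G, (translate v H); split=> //; split=> //=.
by rewrite gE; apply/pair_orbitP; exists v.
Qed.

Lemma face_src_comp f g h : face_comp f g h -> face_src h = face_src f.
Proof.
move=> [F [G [H [_ [_ _ fE _ hE]]]]]; apply: val_inj.
by rewrite (face_src_orbit fE) (face_src_orbit hE).
Qed.

Lemma face_tgt_comp f g h : face_comp f g h -> face_tgt h = face_tgt g.
Proof.
move=> [F [G [H [_ [_ _ _ gE hE]]]]]; apply: val_inj.
by rewrite (face_tgt_orbit gE) (face_tgt_orbit hE).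
Qed.

Lemma face_comp_idl f : face_comp (face_id (face_src f)) f f.
Proof.
have [F [G [AF AG FG fE]]] := face_morW f; exists F, F, G; split=> //.
split=> //; first exact: face_le_refl.
exact: face_id_orbit (face_src_orbit fE).
Qed.

Lemma face_comp_idr f : face_comp f (face_id (face_tgt f)) f.
Proof.
have [F [G [AF AG FG fE]]] := face_morW f; exists F, G, G; split=> //.
split=> //; first exact: face_le_refl.
exact: face_id_orbit (face_tgt_orbit fE).
Qed.

(* All representatives of an orbit have the same dimension. *)
Definition face_rank (x : face_ob A) : nat := face_dim (xget set0 (\val x)).

(* These hypotheses make the translation action on faces free ([translate_free]);
   freeness is what makes composition single-valued. *)
Hypotheses (Ac : complexified A) (Ae : essential A).

Lemma pair_orbit_inj F G G' :
  faces A F -> pair_orbit F G = pair_orbit F G' -> G = G'.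
Proof.
move=> AF /pair_orbitP [v [/esym vF ->]].
by rewrite (translate_free Ac Ae AF vF) translate0.
Qed.

Lemma face_comp_uniq f g h h' : face_comp f g h -> face_comp f g h' -> h = h'.
Proof.
move=> [F [G [H [[AF AG AH] [FG GH fE gE hE]]]]] fgh'.
have [H' [_ _ gE' hE']] := face_comp_repl fgh' fE.
apply: val_inj; rewrite hE hE'; congr (pair_orbit F).
by apply: (pair_orbit_inj AG); rewrite -gE -gE'.
Qed.

Lemma face_compA f g h fg gh k :
  face_comp f g fg -> face_comp g h gh -> face_comp fg h k -> face_comp f gh k.
Proof.
move=> [F [G [H [[AF AG AH] [FG GH fE gE fgE]]]]] cgh cfgh.
have [K [AK HK hE ghE]] := face_comp_repl cgh gE.
have [K' [_ _ hE' kE]] := face_comp_repl cfgh fgE.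
have KK' : K = K' by apply: (pair_orbit_inj AH); rewrite -hE -hE'.
rewrite -{}KK' in kE.
by exists F, G, K; split=> //; split=> //; exact: face_le_trans GH HK.
Qed.

Definition face_category : category :=
  Category face_src_id face_tgt_id face_comp_ex face_comp_uniq face_src_comp
    face_tgt_comp face_comp_idl face_comp_idr face_compA.

End FaceCategory.
End ToricArrangement.

Arguments compact_torus R d : clear implicits.
Arguments face_rank {R d} A x.

(* Main.v *)
Require Import Defs.
From HB Require Import structures.
From mathcomp Require Import all_boot all_order all_algebra finmap.
From mathcomp Require Import complex.
From mathcomp Require Import all_classical all_reals all_analysis.
From mathcomp.multinomials Require Import freeg.
From mathcomp Require Import ring lra zify.

(** Two facts meet in the theorem: the face category carries an acyclic matching
    with ['C(d, k)] critical objects of rank [k], and ['C(d, k)] is the [k]-th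
    rational Betti number of the torus.

    For the Betti numbers, a singular simplex of the torus lifts to the universal
    cover, uniquely up to a lattice translation ([simplex_lift], [covering_fibre]).
    Hence the chains of the torus are the coinvariants of the chains of the cover
    under the lattice, and one may divide by the coordinate translations one at a
    time.  If [t] is such a translation, then [t - 1] is injective on the chains
    already divided, because [t] moves every simplex along an infinite orbit
    ([tr_fixed0]), and it is homotopic to zero by a homotopy that commutes with all
    translations ([translation_homotopyS], [tr_homotopy]).  The long exact sequence
    then shows that the new Betti number in degree [k] is the sum of the old ones in
    degrees [k] and [k - 1] ([relative_bettiS]); since the cover is contractible,
    Pascal's rule gives the binomial coefficients ([torus_betti_number]).

    For the matching, the faces of the lifted arrangement are the cells on which, for
    each of the functions [<a, x> - t], either the integer value or the open unit
    interval containing the value is constant ([facesP]).  A matching of the cells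
    that is invariant under the lattice is built by adding one family of parallel
    hyperplanes [<a, x> = t + n] at a time, starting with the whole space as the
    only cell.  The new hyperplanes cut a cell into slabs separated by walls.  Some
    slices of each cell are kept, and the matching is carried over to them; all other
    walls are matched with a neighbouring slab ([refined_matching]).  Walls of one
    cell can only be traversed in one direction, so that acyclicity is preserved.

    If [a] depends on the forms already used, then it is bounded on each cell, one
    slab per cell is kept and the number of critical orbits does not change
    ([dependent_step]).  If [a] is independent, then every cell is cut into
    infinitely many slices, and modulo its stabilizer slabs and walls alternate
    around a circle; one orbit of slabs and one orbit of walls are kept
    ([independent_step]).  So the critical orbits of codimension [c] are counted by
    the binomial coefficient of [c] in the rank of the forms, and for an essential
    arrangement this rank is [d] ([perfect_cell_matching]).  Finally a cycle in the
    face category would unwind to an infinite gradient path in the universal cover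
    ([face_matching_acyclic]). *)

Set Implicit Arguments.
Unset Strict Implicit.
Unset Printing Implicit Defensive.
Import Order.TTheory GRing.Theory Num.Theory numFieldNormedType.Exports.
Local Open Scope classical_set_scope.
Local Open Scope ring_scope.

(** * Betti numbers of a quotient complex *)

Section Pascal.
Variables (V W W' : nat -> lmodType rat).
Variable d : forall k, {linear V k.+1 -> V k}.
Hypothesis dd : forall k (c : V k.+2), d k (d k.+1 c) = 0.

Definition relative_cycle (U : nat -> lmodType rat)
    (rho : forall k, {linear V k -> U k}) k : V k -> Prop :=
  if k is k'.+1 return V k -> Prop then fun c => rho k' (d k' c) = 0
  else fun=> True.

(** These are the Betti numbers of the quotient of [V] by the kernel of [rho];
    working with congruences modulo the kernel avoids building the quotient. *)
Definition relative_betti (U : nat -> lmodType rat)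
    (rho : forall k, {linear V k -> U k}) k b :=
  exists z : 'I_b -> V k,
  [/\ forall i, relative_cycle rho (z i),
      forall q : 'I_b -> rat,
        (exists w, rho k (\sum_i q i *: z i) = rho k (d k w)) ->
        forall i, q i = 0
    & forall c, relative_cycle rho c -> exists (q : 'I_b -> rat) w,
        rho k c = rho k (\sum_i q i *: z i + d k w)].

Variables (rho : forall k, {linear V k -> W k}) (rho' : forall k, {linear V k -> W' k}).
Variables (phi : forall k, {linear V k -> V k}) (h : forall k, {linear V k -> V k.+1}).
Arguments rho {k}. Arguments rho' {k}. Arguments phi {k}. Arguments h {k}.
Arguments d {k}.

Let hd k : V k -> V k :=
  if k is k'.+1 return V k -> V k then fun c => h (d c) else fun=> 0.

Hypothesis homotopy : forall k (c : V k), d (h c) + hd c = phi c.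
Hypothesis rho_d : forall k (c : V k.+1), rho c = 0 -> rho (d c) = 0.
Hypothesis rho_h : forall k (c : V k), rho c = 0 -> rho (h c) = 0.
Hypothesis rho_phi : forall k (c : V k), rho (phi c) = 0 -> rho c = 0.
Hypothesis rho'P : forall k (c : V k),
  rho' c = 0 <-> exists u, rho c = rho (phi u).

Let dh k (c : V k) : d (h c) = phi c - hd c.
Proof. by rewrite -homotopy addrK. Qed.

Let rho_hd k (c : V k) : relative_cycle (@rho) c -> rho (hd c) = 0.
Proof. by case: k c => [|k] c /=; [rewrite linear0 | exact: rho_h]. Qed.

Let d_phi k (c : V k.+1) : d (phi c) = phi (d c).
Proof.
rewrite -homotopy raddfD /= dd add0r dh.
by case: k c => [|k] c /=; rewrite ?subr0 // dd linear0 subr0.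
Qed.

Let rho'_phi k (c : V k) : rho' (phi c) = 0.
Proof. by apply/rho'P; exists c. Qed.

Let rho'_rho k (x y : V k) : rho x = rho y -> rho' x = rho' y.
Proof.
move=> /eqP; rewrite -subr_eq0 -raddfB => /eqP E; apply/eqP.
by rewrite -subr_eq0 -raddfB; apply/eqP/rho'P; exists 0; rewrite E !linear0.
Qed.

Let rho'_cycle k (c : V k) : relative_cycle (@rho) c -> relative_cycle (@rho') c.
Proof.
case: k c => [//|k] c /= E; rewrite -(linear0 (rho' (k:=k))).
by apply: rho'_rho; rewrite E linear0.
Qed.

Lemma relative_betti0 b : relative_betti (@rho) 0 b -> relative_betti (@rho') 0 b.
Proof.
move=> [z [_ zI zS]]; exists z; split=> //.
- move=> q [w E]; apply: zI.
  have /rho'P [u Eu] : rho' (\sum_i q i *: z i - d w) = 0.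
    by rewrite raddfB /= E subrr.
  exists (w + h u); rewrite raddfD /= dh subr0 raddfD /= -Eu raddfB /=.
  by rewrite addrC subrK.
- move=> c _; have [q [w E]] := zS c I; exists q, w; exact: rho'_rho.
Qed.

(** The hypotheses say that multiplication by [phi] is injective on the quotient
    by [rho] and has the quotient by [rho'] as its cokernel.  As [phi] is homotopic
    to zero through [h], the long exact sequence breaks into short ones: a basis
    of the new homology is given by the old cycles [z i] of the same degree and by
    the chains [h (y j)] for the old cycles [y j] one degree below, the latter
    being cycles modulo the image of [phi] because [d (h y) = phi y]. *)
Lemma relative_bettiS k b b' :
  relative_betti (@rho) k.+1 b -> relative_betti (@rho) k b' ->
  relative_betti (@rho') k.+1 (b + b').
Proof.
move=> [z [zC zI zS]] [y [yC yI yS]].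
pose x (i : 'I_(b + b')) : V k.+1 :=
  match fintype.split i with inl i => z i | inr j => h (y j) end.
have sumE (q : 'I_(b + b') -> rat) : \sum_i q i *: x i =
    \sum_i q (lshift b' i) *: z i + h (\sum_j q (rshift b j) *: y j).
  rewrite big_split_ord /= linear_sum; congr (_ + _).
    by apply: eq_bigr => i _; rewrite /x -[lshift _ _]/(unsplit (inl i)) unsplitK.
  apply: eq_bigr => i _; rewrite /x -[rshift _ _]/(unsplit (inr i)) unsplitK.
  by rewrite linearZ.
have hdy (q : 'I_b' -> rat) : rho (hd (\sum_j q j *: y j)) = 0.
  apply: rho_hd; case: k y yC {z zC zI zS yI yS x sumE} => [//|k] y yC /=.
  rewrite !linear_sum big1 // => j _; rewrite !linearZ /=.
  by rewrite yC scaler0.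
exists x; split.
- move=> i; rewrite /x; case: (fintype.split i) => j; first exact: (rho'_cycle (zC j)).
  rewrite /= dh raddfB /= rho'_phi sub0r.
  have E : rho (hd (y j)) = 0 by apply: rho_hd.
  have -> : rho' (hd (y j)) = 0; last by rewrite oppr0.
  by rewrite -(linear0 (rho' (k := k))); apply: rho'_rho; rewrite E linear0.
- move=> q [w]; rewrite sumE.
  set Z := \sum_i _; set Y := \sum_j _ => E.
  have /rho'P [u Eu] : rho' (Z + h Y - d w) = 0 by rewrite raddfB /= E subrr.
  have dZ : rho (d Z) = 0.
    rewrite /Z !linear_sum big1 // => i _; rewrite !linearZ /=.
    by have /= -> := zC i; rewrite scaler0.
  have YE : rho Y = rho (d u).
    apply/eqP; rewrite -subr_eq0 -raddfB; apply/eqP/rho_phi; rewrite raddfB /=.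
    have : rho (d (Z + h Y - d w - phi u)) = 0.
      by apply: rho_d; rewrite raddfB /= Eu subrr.
    rewrite !raddfB /= !raddfD /= dd dZ add0r raddf0 subr0 dh !raddfB /= hdy subr0.
    by rewrite d_phi.
  have q2 := yI (fun j => q (rshift b j)) (ex_intro _ u YE).
  have Y0 : Y = 0 by rewrite /Y big1 // => j _; rewrite q2 scale0r.
  have q1 := zI (fun i => q (lshift b' i)).
  have {}q1 : forall i, q (lshift b' i) = 0.
    apply: q1; exists (w + h u); rewrite -/Z.
    have du0 : rho (d u) = 0 by rewrite -YE Y0 linear0.
    rewrite raddfD /= dh raddfD /= [rho (_ - _)]raddfB /=.
    rewrite [rho (h (d u))]rho_h // subr0 -Eu Y0 linear0 addr0 raddfB /=.
    by rewrite addrC subrK.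
  by move=> i; rewrite -(splitK i); case: (fintype.split i) => j /=.
- move=> c /= /rho'P [Y EY].
  have YC : relative_cycle (@rho) Y.
    case: k Y c EY {z zC zI zS y yC yI yS x sumE hdy} => [//|k] Y c EY /=.
    apply: rho_phi; rewrite -d_phi.
    have -> : d (phi Y) = d (phi Y - d c) by rewrite raddfB /= dd subr0.
    apply: rho_d.
    by rewrite raddfB /= EY subrr.
  have [q2 [w2 E2]] := yS Y YC.
  have CC : relative_cycle (@rho) (c - h Y).
    by rewrite /= raddfB /= dh opprB addrC raddfD /= raddfB /= EY rho_hd // sub0r addNr.
  have [q1 [w1 E1]] := zS _ CC.
  pose q i := match fintype.split i with inl i => q1 i | inr j => q2 j end.
  exists q, (w1 - h w2); rewrite sumE.
  under eq_bigr do rewrite /q -[lshift _ _]/(unsplit (inl _)) unsplitK.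
  under [X in h X]eq_bigr do rewrite /q -[rshift _ _]/(unsplit (inr _)) unsplitK.
  set Z := \sum_i _; set Y' := \sum_j _.
  have E3 : rho (h Y) = rho (h (Y' + d w2)).
    apply/eqP; rewrite -subr_eq0 -raddfB -raddfB; apply/eqP/rho_h.
    by rewrite raddfB /= E2 subrr.
  have -> : rho' c = rho' (Z + d w1 + h (Y' + d w2)).
    apply: rho'_rho; rewrite raddfD /= -E3 -E1 raddfB /= subrK //.
  have -> : h (Y' + d w2) = h Y' + (phi w2 - d (h w2)).
    by rewrite raddfD /= -homotopy /= addrAC subrr add0r.
  rewrite [d (w1 - _)]raddfB /= !raddfD /= !raddfN /= rho'_phi add0r.
  by rewrite -!addrA; congr (_ + _); rewrite addrCA.
Qed.
End Pascal.

(** * Continuity and the retraction onto a simplex *)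

Section RealContinuity.
Context {R : realType} {T : topologicalType}.
Implicit Types f g : T -> R.

Lemma contD f g x : continuous_at x f -> continuous_at x g ->
  continuous_at x (fun y => f y + g y).
Proof. exact: continuousD. Qed.

Lemma contB f g x : continuous_at x f -> continuous_at x g ->
  continuous_at x (fun y => f y - g y).
Proof. exact: continuousB. Qed.

Lemma contM f g x : continuous_at x f -> continuous_at x g ->
  continuous_at x (fun y => f y * g y).
Proof. exact: continuousM. Qed.

Lemma contV f x : f x != 0 -> continuous_at x f ->
  continuous_at x (fun y => (f y)^-1).
Proof. exact: continuousV. Qed.

Lemma cont_max f g x : continuous_at x f -> continuous_at x g ->
  continuous_at x (fun y => Num.max (f y) (g y)).
Proof. exact: continuous_max. Qed.

Lemma cont_sum (I : Type) (r : seq I) (F : I -> T -> R) x :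
  (forall i, continuous_at x (F i)) ->
  continuous_at x (fun y => \sum_(i <- r) F i y).
Proof.
move=> Fc; elim: r => [|i r IHr].
  have -> : (fun y => \sum_(j <- [::]) F j y) = cst 0.
    by apply/funext => y; rewrite big_nil.
  exact: cst_continuous.
have -> : (fun y => \sum_(j <- i :: r) F j y) = fun y => F i y + \sum_(j <- r) F j y.
  by apply/funext => y; rewrite big_cons.
exact: contD.
Qed.

(** This is what makes a cone continuous at its apex, where the rescaled base
    point has no limit. *)
Lemma cont_vanishM f g x (B : R) : continuous_at x f -> f x = 0 ->
  (forall y, `|g y| <= B) -> continuous_at x (fun y => f y * g y).
Proof.
move=> fc fx gB; have B0 : 0 <= B by apply: le_trans (gB x).
apply/(@cvgrPdist_lt R R^o) => e e0.
have /(@cvgrPdist_lt R R^o)/(_ (e / (B + 1))) := fc.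
rewrite divr_gt0 ?ltr_wpDl // => /(_ isT).
apply: filterS => y; rewrite fx mul0r !sub0r !normrN normrM => ye.
apply: le_lt_trans (ler_wpM2l (normr_ge0 _) (gB _)) _.
have : `|f y| * (B + 1) < e by rewrite -ltr_pdivlMr // ltr_wpDl.
by apply: le_lt_trans; rewrite ler_wpM2l // lerDl.
Qed.

End RealContinuity.

Lemma cont_comp (T U V : topologicalType) (f : T -> U) (g : U -> V) x :
  continuous_at x f -> continuous_at (f x) g -> continuous_at x (fun y => g (f y)).
Proof. exact: continuous_comp. Qed.

Section MatrixContinuity.
Context {K : numFieldType} {T : topologicalType} {m n : nat}.

Lemma mx_continuous_at (f : T -> 'M[K]_(m, n)) x :
  (forall i j, continuous_at x (fun y => f y i j)) -> continuous_at x f.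
Proof.
move=> fc A [P xP PA].
have : \forall y \near x, forall ij : 'I_m * 'I_n, P ij.1 ij.2 (f y ij.1 ij.2).
  by apply: filter_forall => -[i j] /=; apply: fc; exact: xP.
by apply: filterS => y Py; apply: PA => i j; exact: (Py (i, j)).
Qed.

End MatrixContinuity.

Section SimplexRetraction.
Context {R : realType} {k : nat}.
Implicit Types x : 'rV[R]_k.+1.

(** Negative coordinates are cut off, the result is scaled down if its sum exceeds
    1, and the missing mass goes to coordinate 0.  Through this retraction a
    singular simplex extends to the whole space, so that cones and lifts can be
    given by formulas on vectors. *)
Definition retract_row x : 'rV[R]_k.+1 :=
  let y j := Num.max (x 0 j) 0 / Num.max 1 (\sum_i Num.max (x 0 i) 0) in
  \row_j (y j + (j == 0)%:R * (1 - \sum_i y i)).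

Lemma retract_rowP x : retract_row x \in std_simplex R k.
Proof.
rewrite /retract_row; set S := \sum_i Num.max _ _; set M := Num.max 1 S.
have M0 : 0 < M by rewrite lt_max ltr01.
have xp j : 0 <= Num.max (x 0 j) 0 by rewrite le_max lexx orbT.
apply/mem_set; split=> [j|].
  rewrite mxE; apply: addr_ge0; first by rewrite divr_ge0 // ltW.
  apply: mulr_ge0; rewrite ?ler0n // subr_ge0 -mulr_suml.
  by rewrite ler_pdivrMr // mul1r le_max lexx orbT.
under eq_bigr do rewrite mxE.
rewrite big_split /= -[X in _ + X]mulr_suml.
have -> : \sum_(i < k.+1) (i == 0)%:R = 1 :> R.
  by rewrite (bigD1 ord0) //= big1 ?addr0 // => i /negPf ->.
by rewrite mul1r addrC subrK.
Qed.

Definition retract x : std_simplex R k := SigSub (retract_rowP x).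

Lemma retractK (x : std_simplex R k) : retract (\val x) = x.
Proof.
apply: val_inj; apply/rowP => j; rewrite /= mxE.
have /set_mem [x0 x1] := valP x.
have E i : Num.max (\val x 0 i) 0 = \val x 0 i by apply/max_idPl.
under eq_bigr do rewrite E.
rewrite E x1 maxxx divr1; under eq_bigr do rewrite E divr1.
by rewrite x1 subrr mulr0 addr0.
Qed.

Lemma retract_continuous : continuous retract.
Proof.
apply: continuous_comp_initial => x; apply: mx_continuous_at => i j.
have mc l : continuous (fun y : 'rV[R]_k.+1 => Num.max (y 0 l) 0).
  move=> y; apply: cont_max; [exact: coord_continuous|exact: cst_continuous].
have Sc : continuous (fun y : 'rV[R]_k.+1 => Num.max 1 (\sum_l Num.max (y 0 l) 0)).
  move=> y; apply: cont_max; first exact: cst_continuous.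
  by apply: cont_sum => l; exact: mc.
have yc l : continuous (fun y : 'rV[R]_k.+1 =>
    Num.max (y 0 l) 0 / Num.max 1 (\sum_l Num.max (y 0 l) 0)).
  move=> y; apply: contM; first exact: mc.
  apply: contV; last exact: Sc.
  by rewrite gt_eqF // lt_max ltr01.
rewrite /=.
have -> : (fun y => retract_row y i j) = fun y =>
   let z j := Num.max (y 0 j) 0 / Num.max 1 (\sum_i Num.max (y 0 i) 0) in
   (z j + (j == 0)%:R * (1 - \sum_i z i)).
  by apply/funext => y; rewrite /retract_row mxE.
apply: contD; first exact: yc.
apply: contM; first exact: cst_continuous.
apply: contB; first exact: cst_continuous.
by apply: cont_sum => l; exact: yc.
Qed.

Lemma retract_in x : std_simplex R k x -> \val (retract x) = x.
Proof.
move=> xS; have xS' : x \in std_simplex R k by exact/mem_set.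
by rewrite -{1}[x]/(\val (SigSub xS' : std_simplex R k)) retractK.
Qed.

Lemma simplex_val_continuous : continuous (\val : std_simplex R k -> 'rV[R]_k.+1).
Proof. exact: initial_continuous. Qed.

Definition simplex_of (X : topologicalType) (g : 'rV[R]_k.+1 -> X)
    (gc : forall x, std_simplex R k x -> continuous_at x g) :
    continuous (fun x : std_simplex R k => g (\val x)).
Proof.
move=> x; apply: continuous_comp; first exact: simplex_val_continuous.
by apply: gc; exact: (set_mem (valP x)).
Qed.

Lemma simplex_le1 x i : std_simplex R k x -> x 0 i <= 1.
Proof.
move=> [x0 <-]; rewrite (bigD1 i) //= lerDl; exact: sumr_ge0.
Qed.

Lemma simplex_compact : compact [set: std_simplex R k].
Proof.
have C : compact [set v : 'rV[R]_k.+1 | forall i, `[0, 1]%classic (v ord0 i)].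
  by apply: (@rV_compact R k.+1 (fun=> `[0, 1]%classic)) => i; exact: segment_compact.
have -> : [set: std_simplex R k] =
    retract @` [set v : 'rV[R]_k.+1 | forall i, `[0, 1]%classic (v ord0 i)].
  apply/seteqP; split=> // x _; exists (\val x); last exact: retractK.
  move=> i /=; have S := set_mem (valP x).
  by rewrite in_itv /= simplex_le1 // andbT; case: S.
apply: continuous_compact => //; apply: continuous_subspaceT.
exact: retract_continuous.
Qed.

End SimplexRetraction.

(** * Singular chains *)

Section FreeLinear.
Context {K : choiceType} {M : lmodType rat}.

Lemma freegZ (c : rat) (x : K) : << c *g x >> = c *: << x >> :> {freeg K / rat}.
Proof.
by apply/eqP/freeg_eqP => y; rewrite coeffZ !coeffU mul1r.
Qed.

Lemma fglift_is_linear (f : K -> M) : linear (fglift f).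
Proof.
have fD : {morph fglift f : x y / x + y}.
  have fB := lift_is_additive f.
  have f0 : fglift f 0 = 0 by rewrite -[X in fglift f X](subrr 0) fB subrr.
  have fN y : fglift f (- y) = - fglift f y by rewrite -sub0r fB f0 sub0r.
  by move=> x y; rewrite -[X in x + X]opprK fB fN opprK.
have fS (I : Type) (r : seq I) (F : I -> {freeg K / rat}) :
    fglift f (\sum_(i <- r) F i) = \sum_(i <- r) fglift f (F i).
  apply: (big_morph (fglift f) fD).
  by rewrite -[X in fglift f X](subrr 0) (lift_is_additive f) subrr.
move=> a x y; rewrite fD; congr (_ + _).
have -> : a *: x = \sum_(z <- dom x) a *: << coeff z x *g z >>.
  by rewrite -scaler_sumr freeg_sumE.
rewrite fS -[in RHS](freeg_sumE x) fS [RHS]scaler_sumr.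
apply: eq_bigr => z _; by rewrite [in LHS]freegZ scalerA -freegZ !liftU scalerA.
Qed.

HB.instance Definition _ (f : K -> M) :=
  GRing.isLinear.Build rat {freeg K / rat} M *:%R (fglift f) (fglift_is_linear f).

Lemma fglift1 (f : K -> M) x : fglift f << x >> = f x.
Proof. by rewrite liftU scale1r. Qed.

Lemma freeg_ext (f g : {linear {freeg K / rat} -> M}) :
  (forall x, f << x >> = g << x >>) -> f =1 g.
Proof.
move=> fg D; rewrite -[D]freeg_sumE !linear_sum.
by apply: eq_bigr => z _; rewrite freegZ !linearZ fg.
Qed.

End FreeLinear.

(** The pairs [j < i] and [i <= j] cancel through the bijection sending [(i, j)] to
    [(j, i.-1)]. *)
Lemma alternating_sum0 (M : lmodType rat) n (g : nat -> nat -> M) :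
  (forall i j, (j < i <= n)%N -> g i j = g j i.-1) ->
  \sum_(i < n.+1) (-1) ^+ i *: (\sum_(j < n) (-1) ^+ j *: g i j) = 0 :> M.
Proof.
move=> gE; pose F i j : M := (-1) ^+ (i + j) *: g i j.
have -> : \sum_(i < n.+1) (-1) ^+ i *: (\sum_(j < n) (-1) ^+ j *: g i j) =
  \sum_(i < n.+1) \sum_(j < n | (j < i)%N) F i j +
  \sum_(i < n.+1) \sum_(j < n | ~~ (j < i)%N) F i j.
  rewrite -big_split /=; apply: eq_bigr => i _.
  rewrite scaler_sumr (bigID (fun j : 'I_n => (j < i)%N)) /=.
  by congr (_ + _); apply: eq_bigr => j _; rewrite scalerA -exprD.
rewrite big_ord_recl [X in X + _ + _]big1 ?add0r; last by move=> j /=; rewrite ltn0.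
rewrite [X in _ + X]big_ord_recr /= [X in _ + (_ + X)]big1 ?addr0; last first.
  by move=> j; rewrite ltn_ord.
under eq_bigr do rewrite big_mkcond.
under [X in _ + X]eq_bigr do rewrite big_mkcond.
rewrite exchange_big -big_split /= big1 // => i _; rewrite -big_split /= big1 // => j _.
rewrite /bump /= add1n ltnS -leqNgt; case: (leqP i j) => ij; last by rewrite addr0.
rewrite /F gE; last by rewrite ltnS ij ltn_ord.
by rewrite addSn addnC exprS mulN1r scaleNr addNr.
Qed.

Section Cofaces.
Context {R : realType}.

Lemma coface_rowE k (i : 'I_k.+2) (x : 'rV[R]_k.+1) (m : 'I_k.+2) :
  coface_row i x 0 m = if m == i then 0 else x 0 (inord (unbump i m)).
Proof.
rewrite mxE; case: unliftP => [l ->|->]; last by rewrite eqxx.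
rewrite eq_sym (negPf (neq_lift _ _)) -[RHS]/(x 0 (inord (unbump i (bump i l)))).
by rewrite bumpK inord_val.
Qed.

Lemma coface_rowC k (i : 'I_k.+3) (j : 'I_k.+2) (x : 'rV[R]_k.+1) : (j < i)%N ->
  coface_row i (coface_row j x) = coface_row (inord j) (coface_row (inord i.-1) x).
Proof.
move=> ji; apply/rowP => m; rewrite !coface_rowE -!val_eqE /= /unbump.
have lti := ltn_ord i; have ltj := ltn_ord j; have ltm := ltn_ord m.
have vi : nat_of_ord (inord i.-1 : 'I_k.+2) = i.-1 by rewrite inordK //; lia.
have vj : nat_of_ord (inord j : 'I_k.+3) = j by rewrite inordK //; lia.
rewrite !vi !vj; case: (eqVneq (m : nat) i) => [mi|mi].
  have -> : (m == j :> nat) = false by lia.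
  have vm : nat_of_ord (inord (m - (j < m)) : 'I_k.+2) = (m - (j < m))%N.
    by rewrite inordK //; lia.
  by rewrite !vm; have -> : (m - (j < m) == i.-1)%N by lia.
have vm : nat_of_ord (inord (m - (i < m)) : 'I_k.+2) = (m - (i < m))%N.
  by rewrite inordK //; lia.
rewrite !vm; case: (eqVneq (m : nat) j) => [mj|mj].
  by have -> : (m - (i < m) == j)%N by lia.
have vm' : nat_of_ord (inord (m - (j < m)) : 'I_k.+2) = (m - (j < m))%N.
  by rewrite inordK //; lia.
rewrite !vm'.
have -> : (m - (i < m) == j)%N = false by lia.
have -> : (m - (j < m) == i.-1)%N = false by lia.
by congr (x 0 (inord _)); lia.
Qed.

End Cofaces.

Section Chains.
Context {R : realType} {X : topologicalType}.
Local Notation S := (singular_simplex R X).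
Local Notation C := (singular_chain R X).

HB.instance Definition _ k := GRing.Linear.copy (@boundary R X k)
  (fglift (fun s => \sum_(i < k.+2) (-1) ^+ i *: << singular_face i s >> : C k)).

Lemma boundary1 k (s : S k.+1) :
  boundary << s >> = \sum_(i < k.+2) (-1) ^+ i *: << singular_face i s >>.
Proof. exact: fglift1. Qed.

Lemma singular_faceC k (s : S k.+2) (i : 'I_k.+3) (j : 'I_k.+2) : (j < i)%N ->
  singular_face j (singular_face i s) =
  singular_face (inord i.-1) (singular_face (inord j) s).
Proof.
move=> ji; apply/continuousEP => x /=; congr (s _).
by apply: val_inj; exact: coface_rowC.
Qed.

Lemma boundaryK k (c : C k.+2) : boundary (boundary c) = 0.
Proof.
pose f : {linear C k.+2 -> C k} := (@boundary R X k \o @boundary R X k.+1).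
pose g : {linear C k.+2 -> C k} := \0.
apply: (@freeg_ext _ _ f g) => s.
rewrite /f /g /= boundary1 linear_sum.
pose G i j : C k := << singular_face (inord j) (singular_face (inord i) s) >>.
rewrite -[RHS](@alternating_sum0 _ k.+2 G) => [|i j /andP[ji ik]]; last first.
  rewrite /G singular_faceC; last by rewrite !inordK; lia.
  by rewrite !inordK //; lia.
apply: eq_bigr => i _; rewrite linearZ /= boundary1; congr (_ *: _).
by apply: eq_bigr => j _; rewrite /G !inord_val.
Qed.

End Chains.

Section Pushforward.
Context {R : realType}.

Definition pushforward (X Y : topologicalType) (f : continuousType X Y) k :
    singular_chain R X k -> singular_chain R Y k :=
  fglift (fun s : singular_simplex R X k => << (f \o s : singular_simplex R Y k) >>).

HB.instance Definition _ (X Y : topologicalType) (f : continuousType X Y) k :=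
  GRing.Linear.copy (@pushforward X Y f k)
    (fglift (fun s : singular_simplex R X k => << (f \o s : singular_simplex R Y k) >>)).

Lemma pushforward1 (X Y : topologicalType) (f : continuousType X Y) k (s : singular_simplex R X k) :
  pushforward f << s >> = << (f \o s : singular_simplex R Y k) >>.
Proof. exact: fglift1. Qed.

Lemma pushforward_boundary (X Y : topologicalType) (f : continuousType X Y) k c :
  pushforward f (boundary c) = boundary (@pushforward X Y f k.+1 c).
Proof.
pose F : {linear singular_chain R X k.+1 -> singular_chain R Y k} :=
  (@pushforward X Y f k \o @boundary R X k).
pose G : {linear singular_chain R X k.+1 -> singular_chain R Y k} :=
  (@boundary R Y k \o @pushforward X Y f k.+1).
apply: (@freeg_ext _ _ F G _ c) => s; rewrite /F /G /= pushforward1 !boundary1.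
rewrite linear_sum; apply: eq_bigr => i _; rewrite linearZ /= pushforward1.
by congr (_ *: << _ >>); apply/continuousEP.
Qed.

End Pushforward.

(** * Cones in a vector space *)

Section Cones.
Context {R : realType} {d : nat}.
Local Notation E := 'rV[R]_d.
Local Notation S := (singular_simplex R E).
Local Notation C := (singular_chain R E).

Definition tail_row k (x : 'rV[R]_k.+2) : 'rV[R]_k.+1 :=
  \row_j x 0 (fintype.lift ord0 j).

(** At the apex the coefficient [1 - x 0 0] vanishes, so the value chosen for the
    inverse there is harmless. *)
Definition cone_map k (p : E) (s : S k) (x : 'rV[R]_k.+2) : E :=
  x 0 0 *: p + (1 - x 0 0) *: s (retract ((1 - x 0 0)^-1 *: tail_row x)).

Lemma simplex_coord_bounded k (s : S k) j :
  exists B : R, forall x, `|s x 0 j| <= B.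
Proof.
have sc : continuous (fun x => s x 0 j).
  by move=> x; exact: (cont_comp (@cts_fun _ _ s x) (@coord_continuous _ _ _ 0 j _)).
have : compact ((fun x => s x 0 j) @` [set: std_simplex R k]).
  apply: continuous_compact; last exact: simplex_compact.
  exact: continuous_subspaceT.
move=> /(@compact_bounded R R^o) [M [_ /(_ (M + 1))]].
rewrite ltrDl ltr01 => /(_ isT) H; exists (M + 1) => x; apply: H.
by exists x.
Qed.

Lemma cone_map_continuous k p (s : S k) (x : 'rV[R]_k.+2) :
  std_simplex R k.+1 x -> continuous_at x (cone_map p s).
Proof.
move=> xS; apply: mx_continuous_at => i j; rewrite {i}ord1.
have c0 y : continuous_at y (fun z : 'rV[R]_k.+2 => z 0 0).
  exact: coord_continuous.
have c1 y : continuous_at y (fun z : 'rV[R]_k.+2 => 1 - z 0 0).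
  by apply: contB => //; exact: cst_continuous.
pose t (y : 'rV[R]_k.+2) : R := s (retract ((1 - y 0 0)^-1 *: tail_row y)) 0 j.
have -> : (fun y => cone_map p s y 0 j) =
    fun y => y 0 0 * p 0 j + (1 - y 0 0) * t y.
  by apply/funext => y; rewrite !mxE.
apply: contD; first by apply: contM => //; exact: cst_continuous.
have [x1|x1] := eqVneq (x 0 0) 1; last first.
  apply: contM => //.
  have g1 : continuous_at x (fun y => (1 - y 0 0)^-1 *: tail_row y).
    apply: mx_continuous_at => i l; rewrite {i}ord1.
    have -> : (fun y : 'rV[R]_k.+2 => ((1 - y 0 0)^-1 *: tail_row y) 0 l) =
      fun y => (1 - y 0 0)^-1 * y 0 (fintype.lift ord0 l).
      by apply/funext => y; rewrite !mxE.
    apply: contM; last exact: coord_continuous.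
    by apply: contV => //; rewrite subr_eq0 eq_sym.
  have g2 := cont_comp g1 (@retract_continuous R k _).
  have g3 := cont_comp g2 (@cts_fun _ _ s _).
  exact: (cont_comp g3 (@coord_continuous _ _ _ 0 j _)).
have [B HB] := simplex_coord_bounded s j.
by apply: (cont_vanishM (c1 x)) => [|y]; [rewrite x1 subrr | exact: HB].
Qed.

Definition cone k (p : E) (s : S k) : S k.+1 :=
  mkcts (simplex_of (@cone_map_continuous k p s)).

Lemma cone_face0 k p (s : S k) : singular_face ord0 (cone p s) = s.
Proof.
apply/continuousEP => x; rewrite /= /mkcts /cone_map /=.
rewrite coface_rowE eqxx scale0r add0r subr0 invr1 !scale1r.
congr (s _); rewrite -[RHS]retractK; congr (retract _).
by apply/rowP => l; rewrite /coface_row !mxE liftK.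
Qed.

Lemma cone_faceS k p (s : S k.+1) (i : 'I_k.+2) :
  singular_face (fintype.lift ord0 i) (cone p s) = cone p (singular_face i s).
Proof.
apply/continuousEP => x; rewrite /= /mkcts /cone_map /=.
have -> : coface_row (fintype.lift ord0 i) (\val x) 0 0 = \val x 0 0.
  rewrite coface_rowE (negPf (neq_lift _ _)); congr (\val x 0 _).
  by apply: val_inj; rewrite /= inordK // /unbump.
have [x1|x1] := eqVneq (\val x 0 0) 1; first by rewrite x1 subrr !scale0r.
congr (_ + _ *: s _); apply: val_inj.
have xS := set_mem (valP x).
have tS : std_simplex R k ((1 - \val x 0 0)^-1 *: tail_row (\val x)).
  have x0 : 0 < 1 - \val x 0 0 by rewrite subr_gt0 lt_neqAle x1 simplex_le1.
  split=> [l|]; first by rewrite !mxE mulr_ge0 ?invr_ge0 ?(ltW x0) //; case: xS.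
  under eq_bigr do rewrite !mxE.
  rewrite -mulr_sumr; have [_] := xS; rewrite big_ord_recl => /esym/eqP.
  by rewrite addrC -subr_eq => /eqP <-; rewrite mulVf // gt_eqF.
rewrite -[RHS]/(coface_row i (\val (retract ((1 - \val x 0 0)^-1 *: tail_row (\val x))))).
rewrite (retract_in tS).
have E : (1 - \val x 0 0)^-1 *: tail_row (coface_row (fintype.lift ord0 i) (\val x)) =
    coface_row i ((1 - \val x 0 0)^-1 *: tail_row (\val x)).
  apply/rowP => l; rewrite !mxE.
  case: (unliftP i l) => [l' ->|->].
    have -> : fintype.lift ord0 (fintype.lift i l') = fintype.lift (fintype.lift ord0 i) (fintype.lift ord0 l').
      by apply: val_inj; rewrite /= /bump /=; lia.
    by rewrite liftK !mxE.
  by rewrite unlift_none mulr0.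
rewrite E; apply: retract_in.
by have := coface_rowP i (SigSub (mem_set tS) : std_simplex R k) => /set_mem.
Qed.

Definition point_simplex (p : E) : S 0 := cst p.

Lemma cone0_face1 p (s : S 0) :
  singular_face (fintype.lift ord0 ord0) (cone p s) = point_simplex p.
Proof.
apply/continuousEP => x; rewrite /= /mkcts /cone_map /=.
have [_] := set_mem (valP x); rewrite big_ord1 => x1.
have -> : coface_row (fintype.lift ord0 ord0) (\val x) 0 0 = 1.
  by rewrite coface_rowE (negPf (neq_lift _ _)) ord1 -x1; congr (\val x 0 _); rewrite ord1.
by rewrite subrr scale1r scale0r addr0.
Qed.

Definition cone_chain k (p : E) : C k -> C k.+1 :=
  fglift (fun s : S k => << cone p s >>).

HB.instance Definition _ k p := GRing.Linear.copy (@cone_chain k p)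
  (fglift (fun s : S k => << cone p s >>)).

(** With [boundary_cone0] this says that the cone contracts the chains of a vector
    space. *)
Lemma boundary_cone k p (c : C k.+1) :
  boundary (cone_chain p c) = c - cone_chain p (boundary c).
Proof.
pose f : {linear C k.+1 -> C k.+1} := (@boundary R E k.+1 \o @cone_chain k.+1 p).
pose g : {linear C k.+1 -> C k.+1} := (idfun \- (@cone_chain k p \o @boundary R E k)).
apply: (@freeg_ext _ _ f g _ c) => s; rewrite /f /g /= /cone_chain fglift1.
rewrite !boundary1 big_ord_recl expr0 scale1r cone_face0; congr (_ + _).
rewrite linear_sum -sumrN; apply: eq_bigr => i _.
by rewrite linearZ /= fglift1 exprS mulN1r scaleNr cone_faceS.
Qed.

Definition augmentation : C 0 -> rat^o := fglift (fun _ : S 0 => 1 : rat^o).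

HB.instance Definition _ := GRing.Linear.copy augmentation
  (fglift (fun _ : S 0 => 1 : rat^o)).

Lemma augmentation_boundary c : augmentation (boundary c) = 0.
Proof.
pose f : {linear C 1 -> rat^o} := (augmentation \o @boundary R E 0).
apply: (@freeg_ext _ _ f \0 _ c) => s; rewrite /f /= boundary1 linear_sum.
rewrite !big_ord_recl big_ord0 !linearZ /= /augmentation !fglift1.
by rewrite addr0 expr0 expr1 scale1r scaleN1r subrr.
Qed.

Lemma boundary_cone0 p (c : C 0) :
  boundary (cone_chain p c) = c - augmentation c *: << point_simplex p >>.
Proof.
pose f : {linear C 0 -> C 0} := (@boundary R E 0 \o @cone_chain 0 p).
pose g : {linear C 0 -> C 0} := (idfun \- (fglift (fun _ : S 0 => << point_simplex p >> : C 0))).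
have -> : augmentation c *: << point_simplex p >> =
    fglift (fun _ : S 0 => << point_simplex p >> : C 0) c.
  rewrite -[c]freeg_sumE !linear_sum scaler_suml; apply: eq_bigr => s _.
  rewrite freegZ !linearZ /= /augmentation !fglift1; congr (_ *: _).
  exact: mulr1.
apply: (@freeg_ext _ _ f g _ c) => s; rewrite /f /g /= /cone_chain !fglift1.
rewrite boundary1 !big_ord_recl big_ord0 addr0 cone_face0 cone0_face1.
by rewrite expr0 expr1 scale1r scaleN1r.
Qed.
End Cones.

(** * Translations and normalized simplices *)

Section Translations.
Context {R : realType} {d : nat}.
Local Notation E := 'rV[R]_d.
Local Notation S := (singular_simplex R E).
Local Notation C := (singular_chain R E).

Definition shift_map (u : E) : continuousType E E := mkcts (@shift_continuous R d u).

Local Notation sh u s := (shift_map u \o s : S _).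
Local Notation tr u := (pushforward (shift_map u)).

Lemma shiftD k u v (s : S k) : sh u (sh v s) = sh (v + u) s.
Proof. by apply/continuousEP => x; rewrite /= /mkcts addrA. Qed.

Lemma shift0 k (s : S k) : sh 0 s = s.
Proof. by apply/continuousEP => x; rewrite /= /mkcts addr0. Qed.

Lemma trD k u v (c : C k) : tr u (tr v c) = tr (v + u) c.
Proof.
pose f : {linear C k -> C k} := (@pushforward R _ _ (shift_map u) k \o @pushforward R _ _ (shift_map v) k).
apply: (@freeg_ext _ _ f (@pushforward R _ _ (shift_map (v + u)) k) _ c) => s.
by rewrite /f /= !pushforward1 shiftD.
Qed.

Lemma cone_chain1 k p (s : S k) : cone_chain p << s >> = << cone p s >>.
Proof. exact: fglift1. Qed.

Lemma tr_cone k u p (c : C k) : tr u (cone_chain p c) = cone_chain (p + u) (tr u c).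
Proof.
pose f : {linear C k -> C k.+1} := (@pushforward R _ _ (shift_map u) k.+1 \o @cone_chain R d k p).
pose g : {linear C k -> C k.+1} := (@cone_chain R d k (p + u) \o @pushforward R _ _ (shift_map u) k).
apply: (@freeg_ext _ _ f g _ c) => s.
rewrite /f /g /= !(cone_chain1, pushforward1); congr (<< _ >>).
apply/continuousEP => x; rewrite /= /mkcts /cone_map /= /mkcts.
by rewrite !scalerDr addrACA -scalerDl [X in X *: u]addrC subrK scale1r.
Qed.

Definition base_vertex k (s : S k) : E := s (retract 0).

Definition displacement u k : C k -> C k :=
  @pushforward R _ _ (shift_map u) k \- idfun.

HB.instance Definition _ u k := GRing.Linear.copy (@displacement u k)
  (@pushforward R _ _ (shift_map u) k \- idfun).

Lemma displacementE u k (c : C k) : displacement u c = tr u c - c.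
Proof. by []. Qed.

(** The homotopy on [s] must fill the cycle formed by the displacement of [s] and
    the homotopy on its boundary.  Filling it by the cone with apex the base vertex
    of [s], rather than a fixed point, makes the construction commute with all
    translations. *)
Fixpoint homotopy_simplex (u : E) k : S k -> C k.+1 :=
  match k return S k -> C k.+1 with
  | 0 => fun s => cone_chain (base_vertex s) (displacement u << s >>)
  | k'.+1 => fun s => cone_chain (base_vertex s)
      (displacement u << s >> - fglift (homotopy_simplex u (k := k')) (boundary << s >>))
  end.

Definition translation_homotopy u k : C k -> C k.+1 :=
  fglift (homotopy_simplex u (k := k)).

HB.instance Definition _ u k := GRing.Linear.copy (@translation_homotopy u k)
  (fglift (homotopy_simplex u (k := k))).

Lemma translation_homotopy1 u k (s : S k.+1) :
  translation_homotopy u << s >> = cone_chain (base_vertex s)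
    (displacement u << s >> - translation_homotopy u (boundary << s >>)).
Proof. exact: fglift1. Qed.

Lemma tr_boundary u k (c : C k.+1) : boundary (tr u c) = tr u (boundary c).
Proof. by rewrite pushforward_boundary. Qed.

Lemma displacement_boundary u k (c : C k.+1) :
  boundary (displacement u c) = displacement u (boundary c).
Proof. by rewrite !displacementE linearB /= tr_boundary. Qed.

Lemma translation_homotopy0 u (c : C 0) :
  boundary (translation_homotopy u c) = displacement u c.
Proof.
pose f : {linear C 0 -> C 0} := (@boundary R E 0 \o @translation_homotopy u 0).
apply: (@freeg_ext _ _ f (@displacement u 0) _ c) => s.
rewrite /f /= /translation_homotopy fglift1 /= boundary_cone0.
rewrite displacementE linearB /= pushforward1 /augmentation !fglift1.
by rewrite subrr scale0r subr0.
Qed.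

(** By induction the chain that is coned off is a cycle, so the correction term of
    [boundary_cone] vanishes. *)
Lemma translation_homotopyS u k (c : C k.+1) :
  boundary (translation_homotopy u c) + translation_homotopy u (boundary c) =
  displacement u c.
Proof.
elim: k c => [|k IHk] c.
  pose f : {linear C 1 -> C 1} := (@boundary R E 1 \o @translation_homotopy u 1)
    \+ (@translation_homotopy u 0 \o @boundary R E 0).
  apply: (@freeg_ext _ _ f (@displacement u 1) _ c) => s.
  rewrite /f /= translation_homotopy1 boundary_cone [boundary (_ - _)]linearB /=.
  by rewrite displacement_boundary translation_homotopy0 subrr linear0 subr0 subrK.
pose f : {linear C k.+2 -> C k.+2} := (@boundary R E k.+2 \o @translation_homotopy u k.+2)
  \+ (@translation_homotopy u k.+1 \o @boundary R E k.+1).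
apply: (@freeg_ext _ _ f (@displacement u k.+2) _ c) => s.
rewrite /f /= translation_homotopy1 boundary_cone [boundary (_ - _)]linearB /=.
rewrite displacement_boundary.
have := IHk (boundary << s >>); rewrite boundaryK linear0 addr0 => ->.
by rewrite subrr linear0 subr0 subrK.
Qed.

Lemma tr_homotopy u v k (c : C k) :
  translation_homotopy u (tr v c) = tr v (translation_homotopy u c).
Proof.
have trd l (e : C l) : tr v (displacement u e) = displacement u (tr v e).
  by rewrite !displacementE linearB /= !trD [u + v]addrC.
elim: k c => [|k IHk] c.
  pose f : {linear C 0 -> C 1} :=
    (@translation_homotopy u 0 \o @pushforward R _ _ (shift_map v) 0).
  pose g : {linear C 0 -> C 1} :=
    (@pushforward R _ _ (shift_map v) 1 \o @translation_homotopy u 0).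
  apply: (@freeg_ext _ _ f g _ c) => s.
  rewrite /f /g /= pushforward1 /translation_homotopy !fglift1 /= tr_cone.
  by rewrite trd pushforward1.
pose f : {linear C k.+1 -> C k.+2} :=
  (@translation_homotopy u k.+1 \o @pushforward R _ _ (shift_map v) k.+1).
pose g : {linear C k.+1 -> C k.+2} :=
  (@pushforward R _ _ (shift_map v) k.+2 \o @translation_homotopy u k.+1).
apply: (@freeg_ext _ _ f g _ c) => s.
rewrite /f /g /= pushforward1 !translation_homotopy1 tr_cone [tr v (_ - _)]linearB /= -IHk trd.
by rewrite -tr_boundary pushforward1.
Qed.

Definition truncated_floor (j : nat) (p : E) : 'rV[int]_d :=
  \row_i (if (i < j)%N then Num.floor (p 0 i) else 0).

Local Notation "v %:V" := (map_mx intr v : E) (at level 2, format "v %:V").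

(** Translates the base vertex into the unit cube as far as the first [j]
    coordinates are concerned: a canonical representative of the orbit of [s] under
    the lattice of the first [j] coordinates. *)
Definition normalize (j : nat) k (s : S k) : S k :=
  sh (- (truncated_floor j (base_vertex s))%:V) s.

Definition supported_below (j : nat) (v : 'rV[int]_d) :=
  forall i : 'I_d, (j <= i)%N -> v 0 i = 0.

Lemma base_vertex_shift k u (s : S k) : base_vertex (sh u s) = base_vertex s + u.
Proof. by []. Qed.

Lemma normalize_shift j k v (s : S k) : supported_below j v ->
  normalize j (sh v%:V s) = normalize j s.
Proof.
move=> vj; rewrite /normalize shiftD; congr (_ \o _ : S _); congr shift_map.
rewrite base_vertex_shift; apply/rowP => i; rewrite !mxE.
case: ltnP => ij; last by rewrite vj // oppr0 addr0.
by rewrite floorDrz ?intr_int // intrKfloor intrD opprD addrCA subrr addr0.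
Qed.

Lemma normalize_shift_coord j k (i0 : 'I_d) (s : S k) : (j <= i0)%N ->
  normalize j (sh (delta_mx 0 i0)%:V s) = sh (delta_mx 0 i0)%:V (normalize j s).
Proof.
move=> ji; rewrite /normalize !shiftD addrC; congr (_ \o _ : S _); congr shift_map.
rewrite base_vertex_shift; congr (_ + _); apply/rowP => i; rewrite !mxE.
case: ltnP => // ij; have -> : (i == i0) = false by apply/eqP => ii; move: ij; rewrite ii ltnNge ji.
by rewrite andbF addr0.
Qed.

Lemma normalizeP j k (s : S k) :
  exists2 v, supported_below j v & normalize j s = sh v%:V s.
Proof.
exists (- truncated_floor j (base_vertex s)).
  by move=> i ji; rewrite !mxE ltnNge ji oppr0.
by rewrite /normalize map_mxN.
Qed.

(** Two chains have the same image exactly when they agree in the quotient of the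
    chains by the translations along the first [j] coordinates. *)
Definition coinvariants (j : nat) k : C k -> C k :=
  fglift (fun s : S k => << normalize j s >>).

HB.instance Definition _ j k := GRing.Linear.copy (@coinvariants j k)
  (fglift (fun s : S k => << normalize j s >>)).

Lemma coinvariants1 j k (s : S k) : coinvariants j << s >> = << normalize j s >>.
Proof. exact: fglift1. Qed.

Lemma coinvariants_tr j k v (c : C k) : supported_below j v ->
  coinvariants j (tr v%:V c) = coinvariants j c.
Proof.
move=> vj; pose f : {linear C k -> C k} :=
  (@coinvariants j k \o @pushforward R _ _ (shift_map v%:V) k).
apply: (@freeg_ext _ _ f (@coinvariants j k) _ c) => s.
by rewrite /f /= pushforward1 !coinvariants1 normalize_shift.
Qed.

Lemma coinvariants_equivariant j k l (L : {linear C k -> C l}) (c : C k) :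
  (forall v e, L (tr v e) = tr v (L e)) ->
  coinvariants j (L (coinvariants j c)) = coinvariants j (L c).
Proof.
move=> Lv.
pose f : {linear C k -> C l} := (@coinvariants j l \o (L \o @coinvariants j k)).
pose g : {linear C k -> C l} := (@coinvariants j l \o L).
apply: (@freeg_ext _ _ f g _ c) => s.
rewrite /f /g /= coinvariants1; have [v vj ->] := normalizeP j s.
by rewrite -pushforward1 Lv coinvariants_tr.
Qed.

(** The functional counting the simplices in the half-orbit [s0 + u, s0 + 2u, ...]
    jumps only at [s0] under translation by [u], so it reads off the coefficient of
    [s0]. *)
Lemma tr_fixed0 k u (c : C k) : u != 0 -> tr u c = c -> c = 0.
Proof.
move=> u0 cu; apply/eqP/freeg_eqP => s0; rewrite coeff0.
pose orbit (s : S k) := `[< exists n, s = sh (u *+ n) (sh u s0) >].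
pose g : {linear C k -> rat^o} := fglift (fun s : S k => (orbit s)%:R : rat^o).
pose f : {linear C k -> rat^o} :=
  (g \o @pushforward R _ _ (shift_map u) k) \- g.
have : f c = 0 by rewrite /f /= cu subrr.
suff -> : f c = coeff s0 c by [].
pose e : {linear C k -> rat^o} := fglift (fun y : S k => (y == s0)%:R : rat^o).
rewrite -[RHS]/(e c); apply: (@freeg_ext _ _ f e) => s.
rewrite /f /g /e /= pushforward1 !fglift1.
have orbit0 : orbit s0 = false.
  apply/asboolP => -[n] /(congr1 (@base_vertex k)); rewrite !base_vertex_shift.
  move=> /eqP; rewrite -addrA eq_sym -subr_eq0 addrAC subrr add0r -mulrS.
  by rewrite -scaler_nat scaler_eq0 pnatr_eq0 (negPf u0).
suff -> : orbit (sh u s) = orbit s (+) (s == s0).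
  have [->|] := eqVneq s s0; first by rewrite orbit0 subr0.
  by rewrite addbF subrr.
have shI (s1 s2 : S k) : sh u s1 = sh u s2 -> s1 = s2.
  by move=> /(congr1 (fun s : S k => sh (- u) s)); rewrite !shiftD subrr !shift0.
have [->|ss] := eqVneq s s0.
  by rewrite orbit0; apply/asboolP; exists 0%N; rewrite mulr0n shift0.
rewrite addbF; apply/asboolP/asboolP => -[].
  move=> [|n]; first by rewrite mulr0n shift0 => /shI /eqP; rewrite (negPf ss).
  by rewrite mulrSr -shiftD => /shI ->; exists n.
by move=> n ->; exists n.+1; rewrite mulrSr -shiftD.
Qed.

End Translations.

(** * Homology of the partial quotients of the universal cover *)

Section UniversalCoverHomology.
Context {R : realType} {d : nat}.
Local Notation E := 'rV[R]_d.
Local Notation S := (singular_simplex R E).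
Local Notation C := (singular_chain R E).
Local Notation tr u := (pushforward (shift_map u)).
Local Notation sh u s := (shift_map u \o s : S _).
Local Notation "v %:V" := (map_mx intr v : E) (at level 2, format "v %:V").

Definition chain_module (X : topologicalType) k : lmodType rat := singular_chain R X k.

Definition chain_boundary (X : topologicalType) k :
  {linear chain_module X k.+1 -> chain_module X k} := @boundary R X k.

Definition coinvariants_map j k : {linear chain_module E k -> chain_module E k} := @coinvariants R d j k.

Local Notation betti j := (@relative_betti (chain_module E) (@chain_boundary E) (chain_module E) (coinvariants_map j)).

Lemma coinvariants0 k (c : C k) : coinvariants 0 c = c.
Proof.
apply: (@freeg_ext _ _ (@coinvariants R d 0 k) idfun _ c) => s.
rewrite /= coinvariants1 /normalize; congr (<< _ >>); rewrite -[RHS]shift0.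
congr (_ \o _ : S k); congr shift_map.
by apply/rowP => i; rewrite !mxE /= oppr0.
Qed.

(** The space is contractible, by the cone with apex the origin. *)
Lemma betti_coinvariants0 k : betti 0 k (k == 0)%N.
Proof.
case: k => [|k] /=.
  exists (fun=> << point_simplex 0 >>); split=> //.
  - move=> q [w]; rewrite /= !coinvariants0 big_ord1.
    move=> /(congr1 (@augmentation R d)); rewrite /chain_boundary augmentation_boundary.
    rewrite linearZ /= /augmentation fglift1 => q0 i; rewrite ord1 -[LHS]mulr1; exact: q0.
  - move=> c _; exists (fun=> augmentation c), (cone_chain 0 c).
    by rewrite /= !coinvariants0 big_ord1 boundary_cone0 addrC subrK.
exists (fun=> 0); split=> [[]//|q _ []//|c].
rewrite /= !coinvariants0 => c0; exists (fun=> 0), (cone_chain 0 c).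
rewrite /= !coinvariants0 big_ord0 add0r boundary_cone.
by rewrite /chain_boundary in c0; rewrite c0 linear0 subr0.
Qed.

(** Normalizing one more coordinate changes a simplex by a multiple [n] of the unit
    translation [e], and the difference is a displacement by telescoping over the
    [n] steps. *)
Lemma coinvariants_homotopy (i : 'I_d) k (c : C k) :
  coinvariants i.+1 c = 0 <->
  exists u, coinvariants i c = coinvariants i (displacement (delta_mx 0 i)%:V u).
Proof.
set e := (delta_mx 0 i)%:V.
have nn l (s : S l) : normalize i.+1 (normalize i s) = normalize i.+1 s.
  have [v vi ->] := normalizeP i s; apply: normalize_shift.
  by move=> l' /ltnW; exact: vi.
have cc l (x : C l) : coinvariants i.+1 (coinvariants i x) = coinvariants i.+1 x.
  pose f : {linear C l -> C l} := (@coinvariants R d i.+1 l \o @coinvariants R d i l).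
  apply: (@freeg_ext _ _ f (@coinvariants R d i.+1 l) _ x) => s.
  by rewrite /f /= !coinvariants1 nn.
split=> [c0|[u uE]]; last first.
  rewrite -cc uE cc displacementE linearB /= coinvariants_tr ?subrr //.
  move=> l il; rewrite mxE; have [li|] := eqVneq l i; last by rewrite andbF.
  by move: il; rewrite li ltnn.
pose n (s : S k) : int := Num.floor (base_vertex s 0 i).
pose s' (s : S k) : S k := sh (- ((n s) *: delta_mx 0 i)%:V) s.
have G s : exists g, << s >> - << s' s >> = displacement e g :> C k.
  have H (m : nat) (t : S k) : exists g, << sh (e *+ m) t >> - << t >> = displacement e g :> C k.
    elim: m => [|m [g gE]]; first by exists 0; rewrite mulr0n shift0 subrr linear0.
    exists (g + << sh (e *+ m) t >>); rewrite linearD /= -gE displacementE pushforward1.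
    by rewrite shiftD -mulrSr [RHS]addrC addrA subrK.
  have eM (m : nat) : (m%:Z *: delta_mx 0 i)%:V = e *+ m.
    by rewrite -[m%:Z]natz scaler_nat raddfMn.
  rewrite /s'; case: (n s) => m.
    have [g gE] := H m (sh (- (e *+ m)) s); exists g; rewrite -gE eM.
    by rewrite shiftD addNr shift0.
  have [g gE] := H m.+1 s; exists (- g); rewrite linearN /= -gE opprB.
  by rewrite NegzE scaleNr map_mxN opprK eM.
have [g gE] := choice G.
exists (fglift g c); rewrite -[LHS]subr0 -c0.
pose f1 : {linear C k -> C k} := @coinvariants R d i k \- @coinvariants R d i.+1 k.
pose f2 : {linear C k -> C k} := @coinvariants R d i k \o (@displacement R d e k \o fglift g).
apply: (@freeg_ext _ _ f1 f2 _ c) => s; rewrite /f1 /f2 /= fglift1 -gE linearB /=.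
congr (_ - _); rewrite !coinvariants1; congr (<< _ >>).
rewrite /normalize /s' shiftD; congr (_ \o _ : S k); congr shift_map.
rewrite base_vertex_shift; apply/rowP => l; rewrite !mxE eqxx /= /n.
rewrite ltnS leq_eqVlt; have [li|li] := eqVneq (l : nat) i.
  have {li} -> : l = i by apply: val_inj.
  by rewrite eqxx ltnn mulr1 oppr0 addr0.
have -> : (l == i) = false by apply/eqP => E; rewrite E eqxx in li.
by rewrite mulr0 oppr0 add0r addr0.
Qed.

(** Pascal's rule: each new coordinate direction contributes one short exact
    sequence, with [phi] the displacement by the unit vector of that direction. *)
Lemma betti_coinvariants j k : (j <= d)%N -> betti j k 'C(j, k).
Proof.
elim: j k => [|j IHj] k jd; first by have := betti_coinvariants0 k; rewrite bin0n.
pose i := Ordinal jd; pose e := (delta_mx 0 i)%:V.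
have e0 : e != 0.
  apply/eqP => /rowP/(_ i); rewrite !mxE !eqxx => /eqP.
  by rewrite intr_eq0 oner_eq0.
pose phi l : {linear C l -> C l} := @displacement R d e l.
pose h l : {linear C l -> C l.+1} := @translation_homotopy R d e l.
have dd l (c : C l.+2) : boundary (boundary c) = 0 by exact: boundaryK.
have htp l (c : C l) : boundary (h l c) + (match l return C l -> C l with
    | 0 => fun=> 0 | l'.+1 => fun c => h l' (boundary c) end) c = phi l c.
  case: l c => [|l] c; first by rewrite addr0 translation_homotopy0.
  exact: translation_homotopyS.
have rd l (c : C l.+1) : coinvariants j c = 0 -> coinvariants j (boundary c) = 0.
  move=> c0; rewrite -(@coinvariants_equivariant _ _ _ _ _ (chain_boundary E l)).
    by rewrite c0 !linear0.
  by move=> v x; exact: tr_boundary.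
have rh l (c : C l) : coinvariants j c = 0 -> coinvariants j (h l c) = 0.
  move=> c0; rewrite -(@coinvariants_equivariant _ _ _ _ _ (h l)).
    by rewrite c0 !linear0.
  by move=> v x; exact: tr_homotopy.
have rp l (c : C l) : coinvariants j (phi l c) = 0 -> coinvariants j c = 0.
  rewrite /= displacementE linearB /= => /eqP; rewrite subr_eq0 => /eqP cE.
  apply: (tr_fixed0 e0); rewrite -[RHS]cE.
  pose f : {linear C l -> C l} := @pushforward R _ _ (shift_map e) l \o @coinvariants R d j l.
  pose g : {linear C l -> C l} := @coinvariants R d j l \o @pushforward R _ _ (shift_map e) l.
  apply: (@freeg_ext _ _ f g _ c) => s.
  rewrite /f /g /= !(coinvariants1, pushforward1) normalize_shift_coord //.
have rk l (c : C l) := coinvariants_homotopy i c.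
case: k => [|k].
  have := IHj 0%N (ltnW jd); rewrite !bin0.
  exact: (@relative_betti0 (chain_module E) (chain_module E) (chain_module E)
    (chain_boundary E) (coinvariants_map j) (coinvariants_map j.+1) phi h htp rk).
rewrite binS.
exact: (@relative_bettiS (chain_module E) (chain_module E) (chain_module E)
  (chain_boundary E) dd (coinvariants_map j) (coinvariants_map j.+1) phi h
  htp rd rh rp rk _ _ _ (IHj k.+1 (ltnW jd)) (IHj k (ltnW jd))).
Qed.

End UniversalCoverHomology.

(** * Lifting angles *)

Section ComplexContinuity.
Context {R : realType} {T : topologicalType}.
Local Notation Ro := (R[i])^o.

Lemma cont_complex (a b : T -> R) x : continuous_at x a -> continuous_at x b ->
  continuous_at x (fun y => (a y +i* b y)%C : Ro).
Proof.
move=> ac bc; apply/(@cvgrPdist_lt _ Ro) => e.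
rewrite ltcE /= => /andP[/eqP Ie Re0].
have e2 : 0 < complex.Re e / 2 by rewrite divr_gt0.
have /(@cvgrPdist_lt R R^o)/(_ _ e2) := ac.
have /(@cvgrPdist_lt R R^o)/(_ _ e2) := bc.
apply: filterS2 => y; rewrite !ltr_norml => B A.
rewrite normc_def ltcE /= Ie eqxx /= -[X in _ < X](gtr0_norm Re0) -sqrtr_sqr.
rewrite ltr_sqrt ?exprn_gt0 //.
have {}A := andP A; have {}B := andP B.
by case: A => A1 A2; case: B => B1 B2; nra.
Qed.

Lemma cont_Re (f : T -> Ro) x : continuous_at x f ->
  continuous_at x (fun y => complex.Re (f y : R[i])).
Proof.
move=> fc; apply/(@cvgrPdist_lt R R^o) => e e0.
have e0' : 0 < e%:C%C :> R[i] by rewrite ltcE /= eqxx.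
have /(@cvgrPdist_lt _ Ro)/(_ _ e0') := fc.
apply: filterS => y; rewrite normc_def ltcE /= => /andP[_].
apply: le_lt_trans; rewrite -sqrtr_sqr ler_sqrt ?addr_ge0 ?sqr_ge0 //.
by case: (f x) (f y) => [a b] [a' b'] /=; rewrite lerDl sqr_ge0.
Qed.

Lemma cont_Im (f : T -> Ro) x : continuous_at x f ->
  continuous_at x (fun y => complex.Im (f y : R[i])).
Proof.
move=> fc; apply/(@cvgrPdist_lt R R^o) => e e0.
have e0' : 0 < e%:C%C :> R[i] by rewrite ltcE /= eqxx.
have /(@cvgrPdist_lt _ Ro)/(_ _ e0') := fc.
apply: filterS => y; rewrite normc_def ltcE /= => /andP[_].
apply: le_lt_trans; rewrite -sqrtr_sqr ler_sqrt ?addr_ge0 ?sqr_ge0 //.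
by case: (f x) (f y) => [a b] [a' b'] /=; rewrite lerDr sqr_ge0.
Qed.

End ComplexContinuity.

Section AngleLift.
Context {R : realType} {n : nat}.
Local Notation V := 'rV[R]_n.
Variables (u w : V -> R).
Hypotheses (uc : continuous u) (wc : continuous w).
Hypothesis unit_uw : forall x, u x ^+ 2 + w x ^+ 2 = 1.

Let ball1 : set V := [set x | `|x| <= 1].

(** Uniform continuity on the unit ball: nearby points have directions [(u, w)] that
    are less than a quarter turn apart. *)
Lemma angle_step : exists N : nat, forall x, ball1 x -> forall y,
  `|x - y| < N.+1%:R^-1 -> 0 < u x * u y + w x * w y.
Proof.
have K : compact ball1.
  apply: bounded_closed_compact.
    by exists 1; split; [exact: num_real | move=> M M1 x /le_trans; apply; exact: ltW].
  rewrite (_ : ball1 = (fun x : V => `|x|) @^-1` [set r : R | r <= 1]) //.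
  by apply: closed_comp; [move=> x _; exact: norm_continuous | exact: closed_le].
have /compact_near_coveringP/(_ nat \oo (fun N x => forall y,
  `|x - y| < N.+1%:R^-1 -> 0 < u x * u y + w x * w y)) := K.
case=> [|N _ HN]; last by exists N => x /(HN N (leqnn N)).
move=> x _.
have q0 : 0 < 4^-1 :> R by rewrite invr_gt0.
have /(@cvgrPdist_lt R R^o)/(_ _ q0) U := @uc x.
have /(@cvgrPdist_lt R R^o)/(_ _ q0) W := @wc x.
have : nbhs x [set y | `|u x - u y| < 4^-1 /\ `|w x - w y| < 4^-1].
  exact: filterI U W.
move=> /nbhs_ballP[e /= e0 He].
have e2 : 0 < e / 2 by rewrite divr_gt0.
exists (ball x (e / 2), [set N | N.+1%:R^-1 < e / 2]) => /=.
  split; first exact: nbhsx_ballx.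
  exact: (near_infty_natSinv_lt (PosNum e2)).
case=> z N /= [zx Ne] y zy.
have By v : `|x - v| < e -> ball x e v by rewrite -ball_normE.
have xz : `|x - z| < e / 2 by move: zx; rewrite -ball_normE.
have /By/He [/= U1 W1] : `|x - z| < e.
  by apply: lt_trans xz _; rewrite ltr_pdivrMr // ltr_pMr // ltr1n.
have /By/He [/= U2 W2] : `|x - y| < e.
  rewrite -(subrK z x) -addrA [e]splitr; apply: le_lt_trans (ler_normD _ _) _.
  by rewrite ltrD // (lt_trans zy).
have := unit_uw z; have := unit_uw y; move: U1 W1 U2 W2; rewrite !ltr_norml.
set a := u x; set b := w x.
move: (u z) (w z) (u y) (w y) => p q r s /andP[? ?] /andP[? ?] /andP[? ?] /andP[? ?] E1 E2.
have H1 : (p - r) ^+ 2 < 2^-1 by nra.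
have H2 : (q - s) ^+ 2 < 2^-1 by nra.
by nra.
Qed.

Lemma sin_cos_asin (c s : R) : c ^+ 2 + s ^+ 2 = 1 -> 0 < c ->
  cos (asin s) = c /\ sin (asin s) = s.
Proof.
move=> cs c0; have s1 : -1 <= s <= 1.
  by rewrite -ler_norml -(@expr_le1 _ 2) // real_normK ?num_real // -cs lerDr sqr_ge0.
split; last by rewrite asinK.
rewrite cos_asin // -cs addrK sqrtr_sqr gtr0_norm //.
Qed.

(** The ball is star-shaped, so the angle at [x] is the angle at the origin plus the
    small turns met along the segment to [x]; by [angle_step] each of the finitely
    many turns has a positive cosine and is given by the arc sine of its sine. *)
Lemma angle_lift : exists g : V -> R, forall x, ball1 x ->
  [/\ continuous_at x g, cos (2 * pi * g x) = u x & sin (2 * pi * g x) = w x].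
Proof.
have [N HN] := angle_step; pose M := N.+2.
pose pt m (x : V) : V := (m%:R / M%:R) *: x.
have ptc m : continuous (pt m) by move=> x; exact: scaler_continuous.
pose cr m x := u (pt m x) * u (pt m.+1 x) + w (pt m x) * w (pt m.+1 x).
pose sr m x := u (pt m x) * w (pt m.+1 x) - w (pt m x) * u (pt m.+1 x).
have M0 : 0 < M%:R :> R by rewrite ltr0n.
have cr0 m x : ball1 x -> (m < M)%N -> 0 < cr m x.
  move=> x1 mM; apply: HN.
    rewrite /ball1 /= normrZ ger0_norm ?divr_ge0 // mulr_ile1 ?divr_ge0 //.
    by rewrite ler_pdivrMr // mul1r ler_nat ltnW.
  rewrite -scalerBl -mulrBl -natr1 opprD addNKr mulN1r normrZ normrN.
  rewrite gtr0_norm ?invr_gt0 // (@le_lt_trans _ _ M%:R^-1) //.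
    by rewrite ler_piMr // invr_ge0 ltW.
  by rewrite ltf_pV2 ?posrE // ltr_nat.
have csr m x : cr m x ^+ 2 + sr m x ^+ 2 = 1.
  have := unit_uw (pt m x); have := unit_uw (pt m.+1 x); rewrite /cr /sr.
  by move: (u _) (w _) (u _) (w _) => a b c e E1 E2; rewrite -[RHS]mul1r -{1}E1 -E2; ring.
have pi2 : (2 * pi : R) != 0 by rewrite mulf_neq0 ?pnatr_eq0// gt_eqF ?pi_gt0.
have [t0 Ht0] : exists t0, exp2ipi t0 = (u 0 +i* w 0)%C.
  by apply: exp2ipi_surj; rewrite normc_def /= unit_uw sqrtr1.
case: Ht0 => ct0 st0.
pose g l x := t0 + \sum_(m < l) asin (sr m x) / (2 * pi).
have gE l x : ball1 x -> (l <= M)%N ->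
    cos (2 * pi * g l x) = u (pt l x) /\ sin (2 * pi * g l x) = w (pt l x).
  move=> x1; elim: l => [|l IHl] lM.
    by rewrite /g big_ord0 addr0 /pt mul0r scale0r.
  have [c1 s1] := IHl (ltnW lM).
  have [c2 s2] := sin_cos_asin (csr l x) (cr0 _ _ x1 lM).
  have -> : 2 * pi * g l.+1 x = 2 * pi * g l x + asin (sr l x).
    by rewrite /g big_ord_recr /= addrA [2 * pi * (_ + _)]mulrDr [2 * pi * (_ / _)]mulrC divfK.
  rewrite cosD sinD c1 s1 c2 s2 /cr /sr.
  have := unit_uw (pt l x); move: (u (pt l x)) (w (pt l x)) (u _) (w _) => a b c e E.
  split; last first.
    by rewrite -[RHS]mul1r -E; ring.
  by rewrite -[RHS]mul1r -E; ring.
exists (g M) => x x1; have [c s] := gE M x x1 (leqnn M).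
have ptM : pt M x = x by rewrite /pt divff ?scale1r // gt_eqF.
split; [|by rewrite c ptM|by rewrite s ptM].
apply: contD; first exact: cst_continuous.
apply: cont_sum => m; apply: contM; last exact: cst_continuous.
have cu k : continuous_at x (fun y => u (pt k y)) := cont_comp (@ptc k x) (@uc _).
have cw k : continuous_at x (fun y => w (pt k y)) := cont_comp (@ptc k x) (@wc _).
have srm : continuous_at x (sr m) by apply: contB; apply: contM.
apply: (cont_comp srm); apply: continuous_asin.
have := cr0 m x x1 (ltn_ord m); have := csr m x.
rewrite -ltr_norml -(@expr_lt1 _ 2) // real_normK ?num_real // => <- c0.
by rewrite ltrDr exprn_gt0.
Qed.

End AngleLift.

(** * Betti numbers of the torus *)

Lemma exp2ipi_eq_int (R : realType) (a b : R) :
  exp2ipi a = exp2ipi b -> exists k : int, a - b = k%:~R.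
Proof.
move=> E; exists (Num.floor (a - b)).
have {E} : exp2ipi (a - b - (Num.floor (a - b))%:~R) = 1.
  rewrite -[- _%:~R]mulrNz exp2ipi_int; case: E; rewrite /exp2ipi mulrBr cosB sinB.
  move=> -> ->; rewrite -[cos _ * cos _]expr2 -[sin _ * sin _ in X in (X +i* _)%C]expr2.
  by rewrite cos2Dsin2 mulrC subrr.
have := floor_itv (a - b); move: (a - b) (Num.floor _) => c f; rewrite intrD.
set r := c - f%:~R => /andP[f1 f2].
have r0 : 0 <= r by rewrite subr_ge0.
have r1 : r < 1 by rewrite /r ltrBlDl.
case; have -> : 2 * pi * r = (pi * r) *+ 2 by rewrite -[RHS]mulr_natl mulrA.
rewrite cos_mulr2n cos2sin2 => sE _.
have s0 : sin (pi * r) = 0.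
  by apply/eqP; rewrite -sqrf_eq0; apply/eqP; move: sE; rewrite mulr2n; lra.
have : ~~ (0 < pi * r < pi).
  by apply/negP => /sin_gt0_pi; rewrite s0 ltxx.
rewrite [X in _ && X]gtr_pMr ?pi_gt0 // r1 andbT pmulr_rgt0 ?pi_gt0 // -leNgt => r0'.
by apply/eqP; rewrite -subr_eq0 eq_le r0 r0'.
Qed.

Section SimplexConstant.
Context {R : realType} {k : nat}.

Lemma integer_valued_constant (f : std_simplex R k -> R) :
  continuous f -> (forall x, exists m : int, f x = m%:~R) ->
  forall x y, f x = f y.
Proof.
move=> fc fZ x y; apply/eqP; apply: contraT => fxy; exfalso.
pose p (t : R) : std_simplex R k := retract (\val x + t *: (\val y - \val x)).
have p0 : p 0 = x by rewrite /p scale0r addr0 retractK.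
have p1 : p 1 = y by rewrite /p scale1r addrC subrK retractK.
have pc : continuous (fun t => f (p t)).
  move=> t; have c1 : continuous_at t (fun t : R => \val x + t *: (\val y - \val x)).
    apply: mx_continuous_at => i j.
    have -> : (fun t : R => (\val x + t *: (\val y - \val x)) i j) =
      (fun t : R => \val x i j + t * (\val y - \val x) i j).
      by apply/funext => z; rewrite !mxE.
    apply: contD; first exact: cst_continuous.
    by apply: contM; [move=> ?; apply | exact: cst_continuous].
  exact: (cont_comp (cont_comp c1 (@retract_continuous R k _)) (@fc _)).
have noIVT (F : R -> R) : continuous F -> (forall t, exists m : int, F t = m%:~R) ->
    F 0 < F 1 -> False.
  move=> Fc FZ lt01; have [m F0] := FZ 0; have [m' F1] := FZ 1.
  have mm : m%:~R + 1 <= m'%:~R :> R.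
    by move: lt01; rewrite F0 F1 ltr_int -intrD1 ler_int lezD1.
  have [|c _] := @IVT R F 0 1 (F 0 + 2^-1) ler01 (continuous_subspaceT Fc).
    rewrite min_l ?max_r ?(ltW lt01) // lerDl invr_ge0 ler0n /= F0 F1.
    by apply: le_trans mm; rewrite lerD2l invf_le1 ?ler1n.
  have [l ->] := FZ c; rewrite F0 => E.
  have : m%:~R < (l%:~R : R) < m%:~R + 1.
    by rewrite E ltrDl invr_gt0 ltr0n ltrD2l invf_lt1 ?ltr1n // ltr0n.
  rewrite -intrD1 !ltr_int ltzD1 => /andP[a b].
  by move: (lt_le_trans a b); rewrite ltxx.
move: fxy; rewrite neq_lt => /orP[lt_xy|lt_yx].
  by apply: (noIVT _ pc) => [t|]; [exact: fZ | rewrite p0 p1].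
apply: (noIVT (fun t => 0 - f (p t))) => [t|t|].
- by apply: contB; [exact: cst_continuous | exact: pc].
- by have [m ->] := fZ (p t); exists (- m); rewrite sub0r mulrNz.
- by rewrite p0 p1 !sub0r ltrN2.
Qed.

End SimplexConstant.

Section TorusCovering.
Context {R : realType} {d : nat}.
Local Notation E := 'rV[R]_d.
Local Notation T := (compact_torus R d).
Local Notation "v %:V" := (map_mx intr v : E) (at level 2, format "v %:V").

Definition exp_row (x : E) : 'rV[(R[i])^o]_d := \row_j exp2ipi (x 0 j).

Lemma exp_rowP x : exp_row x \in T.
Proof.
apply/mem_set => j; rewrite mxE normc_def /= cos2Dsin2 sqrtr1 //.
Qed.

Definition covering (x : E) : T := SigSub (exp_rowP x).

Lemma covering_continuous : continuous (covering : E -> T).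
Proof.
apply: continuous_comp_initial => x; apply: mx_continuous_at => i j.
have -> : (fun y => (set_val \o (covering : E -> T)) y i j) =
    (fun y : E => exp2ipi (y 0 j) : (R[i])^o).
  by apply/funext => y; rewrite /= mxE.
have c : continuous_at x (fun y : E => 2 * pi * y 0 j).
  by apply: contM; [exact: cst_continuous | exact: coord_continuous].
apply: cont_complex.
  exact: (cont_comp c (@continuous_cos R _)).
exact: (cont_comp c (@continuous_sin R _)).
Qed.

Definition covering_map : continuousType E T := mkcts covering_continuous.

Local Notation SE := (singular_simplex R E).
Local Notation ST := (singular_simplex R T).
Local Notation CE := (singular_chain R E).
Local Notation CT := (singular_chain R T).
Local Notation sh u s := (shift_map u \o s : SE _).

Lemma simplex_lift k (t : ST k) : exists s : SE k, (covering_map \o s : ST k) = t.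
Proof.
have tc j : continuous (fun x : 'rV[R]_k.+1 => \val (t (retract x)) 0 j : (R[i])^o).
  move=> x; have c1 := cont_comp (@retract_continuous R k x) (@cts_fun _ _ t _).
  have c2 := cont_comp c1 (@initial_continuous _ _ (set_val : T -> _) _).
  exact: (cont_comp c2 (@coord_continuous _ _ _ 0 j _)).
have lift_j j : exists g : 'rV[R]_k.+1 -> R, forall x : std_simplex R k,
    continuous_at (\val x) g /\ exp2ipi (g (\val x)) = \val (t x) 0 j.
  have uw x : complex.Re (\val (t (retract x)) 0 j : R[i]) ^+ 2 +
      complex.Im (\val (t (retract x)) 0 j : R[i]) ^+ 2 = 1.
    have /set_mem/(_ j) := valP (t (retract x)).
    rewrite normc_def => -[] /(congr1 (fun u => u ^+ 2)).
    by rewrite sqr_sqrtr ?addr_ge0 ?sqr_ge0// expr1n.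
  have [g Hg] := angle_lift (fun x => cont_Re (@tc j x)) (fun x => cont_Im (@tc j x)) uw.
  exists g => x; have xS := set_mem (valP x).
  have [|gc gr gi] := Hg (\val x).
    rewrite /= /Num.norm /= mx_normrE; apply: bigmax_le => // -[i l] _ /=; rewrite {i}ord1.
    by rewrite ger0_norm ?simplex_le1 //; case: xS.
  split=> //; rewrite /exp2ipi gr gi retractK; by case: (\val (t x) 0 j).
have [g Hg] := choice lift_j.
pose G (x : 'rV[R]_k.+1) : E := \row_j g j x.
have Gc x : std_simplex R k x -> continuous_at x G.
  move=> xS; apply: mx_continuous_at => i j.
  have -> : (fun y => G y i j) = g j by apply/funext => y; rewrite mxE.
  by have [+ _] := Hg j (SigSub (mem_set xS)).
exists (mkcts (simplex_of Gc)); apply/continuousEP => x; apply: val_inj.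
apply/rowP => j; rewrite /= /mkcts /covering /= !mxE.
by have [_ ->] := Hg j x.
Qed.

Lemma covering_fibre k (s s' : SE k) :
  (covering_map \o s : ST k) = (covering_map \o s' : ST k) ->
  exists v : 'rV[int]_d, s = sh v%:V s'.
Proof.
move=> E0; have dZ j x : exists m : int, s x 0 j - s' x 0 j = m%:~R.
  apply: exp2ipi_eq_int; have := congr1 (fun t : ST k => \val (t x) 0 j) E0.
  by rewrite /= /mkcts /= !mxE.
have c0 (r : SE k) j : continuous (fun x => r x 0 j).
  by move=> x; exact: (cont_comp (@cts_fun _ _ r x) (@coord_continuous _ _ _ 0 j _)).
have dc j : continuous (fun x => s x 0 j - s' x 0 j).
  by move=> x; apply: contB; exact: c0.
have [v Hv] := choice (fun j => dZ j (retract 0)).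
exists (\row_j v j); apply/continuousEP => x; apply/rowP => j.
rewrite /= /mkcts !mxE -Hv (integer_valued_constant (dc j) (dZ j) _ x).
by rewrite addrC subrK.
Qed.

Lemma covering_shift k (v : 'rV[int]_d) (s : SE k) :
  (covering_map \o sh v%:V s : ST k) = (covering_map \o s : ST k).
Proof.
apply/continuousEP => x; apply: val_inj; apply/rowP => j.
by rewrite /= /mkcts /= !mxE exp2ipi_int.
Qed.

(** Two simplices have the same projection to the torus exactly when their
    normalizations agree, since lifts are unique up to the lattice. *)
Lemma kernel_pushforward_covering k (c : CE k) :
  pushforward covering_map c = 0 <-> coinvariants d c = 0.
Proof.
have [lift liftP] := choice (@simplex_lift k).
have below (v : 'rV[int]_d) : supported_below d v by move=> i; rewrite leqNgt ltn_ord.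
split=> c0; last first.
  pose f : {linear CE k -> CT k} := @pushforward R _ _ covering_map k \o @coinvariants R d d k.
  have -> : pushforward covering_map c = f c.
    apply: (@freeg_ext _ _ (@pushforward R _ _ covering_map k) f _ c) => s.
    rewrite /f /= coinvariants1; have [v _ ->] := normalizeP d s.
    by rewrite !pushforward1 covering_shift.
  by rewrite /f /= c0 linear0.
pose r : {linear CT k -> CE k} := fglift (fun t => << normalize d (lift t) >>).
pose f : {linear CE k -> CE k} := r \o @pushforward R _ _ covering_map k.
have -> : coinvariants d c = f c.
  apply: (@freeg_ext _ _ (@coinvariants R d d k) f _ c) => s.
  rewrite /f /r /= coinvariants1 pushforward1 fglift1; congr (<< _ >>).
  have [v vE] := covering_fibre (esym (liftP (covering_map \o s : ST k))).
  by rewrite {1}vE normalize_shift.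
by rewrite /f /= c0 linear0.
Qed.

Lemma pushforward_covering_surj k (c : CT k) : exists e, pushforward covering_map e = c.
Proof.
have [lift liftP] := choice (@simplex_lift k).
exists (fglift (fun t => << lift t >>) c).
pose f : {linear CT k -> CT k} := @pushforward R _ _ covering_map k \o fglift (fun t => << lift t >>).
apply: (@freeg_ext _ _ f idfun _ c) => t.
by rewrite /f /= fglift1 pushforward1 liftP.
Qed.

Theorem torus_betti_number k : is_betti_number R T k 'C(d, k).
Proof.
have [z [zC zI zS]] := @betti_coinvariants R d d k (leqnn d).
have pE l (x y : CE l) : coinvariants d x = coinvariants d y <->
    pushforward covering_map x = pushforward covering_map y.
  by split=> /eqP; rewrite -subr_eq0 -linearB => /eqP /kernel_pushforward_covering /eqP;
    rewrite linearB subr_eq0 => /eqP.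
have pC l (x : CE l) : relative_cycle (@chain_boundary R E) (coinvariants_map d) x <->
    is_cycle (pushforward covering_map x).
  case: l x => [//|l] x /=; rewrite -pushforward_boundary.
  by split=> /kernel_pushforward_covering.
exists (fun i => pushforward covering_map (z i)); split.
- by move=> i; apply/pC.
- move=> q [w]; have [w' <-] := pushforward_covering_surj w.
  rewrite -pushforward_boundary => E1; apply: zI; exists w'; apply/pE.
  by rewrite linear_sum -E1; apply: eq_bigr => i _; rewrite linearZ.
- move=> c; have [c' <-] := pushforward_covering_surj c => /pC /zS [q [w /pE ->]].
  exists q, (pushforward covering_map w).
  rewrite linearD /= linear_sum -pushforward_boundary; congr (_ + _).
  by apply: eq_bigr => i _; rewrite linearZ.
Qed.

End TorusCovering.

(** * Codes of real numbers and rational spans *)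

Section Codes.
Context {R : realType}.
Implicit Types (r s : R) (n c : int).

(** The code is [2n] at the integer [n] and [2n + 1] on the open interval from [n] to
    [n + 1], hence it numbers the cells of the line subdivided at the integers. *)
Definition code r : int := Num.floor r + Num.ceil r.

Lemma code_int n : code n%:~R = n * 2.
Proof. by rewrite /code intrKfloor intrKceil; lia. Qed.

Lemma code_itv n r : n%:~R < r < n%:~R + 1 -> code r = n * 2 + 1.
Proof.
move=> /andP[nr rn]; rewrite /code.
have -> : Num.floor r = n by apply: floor_def; rewrite (ltW nr) intrD1.
have -> : Num.ceil r = n + 1; last by lia.
by apply: ceil_def; rewrite addrK nr intrD1 ltW.
Qed.

Variant code_spec r : int -> Prop :=
| CodeEven n of r = n%:~R : code_spec r (n * 2)
| CodeOdd n of n%:~R < r < n%:~R + 1 : code_spec r (n * 2 + 1).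

Lemma codeP r : code_spec r (code r).
Proof.
have /andP[] := floor_itv r; rewrite intrD1 le_eqVlt => /orP[/eqP <-|r1 r2].
  by rewrite code_int; constructor.
have H : (Num.floor r)%:~R < r < (Num.floor r)%:~R + 1 by rewrite r1 r2.
by rewrite (code_itv H); constructor.
Qed.

Lemma code_even r n : code r = n * 2 -> r = n%:~R.
Proof. by case: codeP => m H E; [have -> : n = m by lia | lia]. Qed.

Lemma code_odd r n : code r = n * 2 + 1 -> n%:~R < r < n%:~R + 1.
Proof. by case: codeP => m H E; [lia | have -> : n = m by lia]. Qed.

Lemma code_mono r s : r <= s -> code r <= code s.
Proof.
by move=> rs; apply: lerD; [apply: le_floor | apply: le_ceil].
Qed.

Lemma codeDz r n : code (r + n%:~R) = code r + n * 2.
Proof.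
case: (codeP r) => m; first by move=> ->; rewrite -intrD code_int; lia.
move=> /andP[a b]; rewrite (@code_itv (m + n)) ?intrD; first by lia.
by rewrite ltrD2r a /= addrAC ltrD2r.
Qed.

Lemma code_half c : code (c%:~R / 2) = c.
Proof.
pose n := (c %/ 2)%Z; have cE : c = n * 2 \/ c = n * 2 + 1 by rewrite /n; lia.
have t0 : (2 : R) != 0 by rewrite pnatr_eq0.
case: cE => ->; first by rewrite intrM mulfK // code_int.
apply: code_itv; rewrite intrD intrM mulrDl mulfK //.
by rewrite ltrDl ltrD2l divr_gt0 ?ltr0n //= ltr_pdivrMr ?ltr0n // mul1r ltr1n.
Qed.

(** The face order on the cells of the subdivided line. *)
Definition code_le c c' := c = c' \/ exists n : int, c' = n * 2 + 1 /\ (c = n * 2 \/ c = n * 2 + 2).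

Lemma code_le_refl c : code_le c c. Proof. by left. Qed.

Lemma code_le_even c n : code_le c (n * 2) -> c = n * 2.
Proof. by case=> // -[m [E _]]; lia. Qed.

Lemma code_le_odd c n : code_le (c * 2 + 1) n -> n = c * 2 + 1.
Proof. by case=> [<-//|[m [-> [E|E]]]]; lia. Qed.

Lemma code_near r : exists2 e : R, 0 < e &
  forall s, `|r - s| < e -> code_le (code r) (code s).
Proof.
case: (codeP r) => n.
  move=> ->; exists 1 => // s; rewrite ltr_norml => /andP[a b].
  have [sn|ns|->] := ltgtP s n%:~R; last by left; rewrite code_int.
    right; exists (n - 1); split; last by right; lia.
    by apply: code_itv; rewrite intrB subrK sn andbT; lra.
  right; exists n; split; last by left.
  by apply: code_itv; rewrite ns /=; lra.
move=> /andP[a b]; exists (Num.min (r - n%:~R) (n%:~R + 1 - r)).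
  by rewrite lt_min !subr_gt0 a.
move=> s; rewrite lt_min !ltr_norml => /andP[/andP[h1 h2] /andP[h3 h4]].
by left; apply/esym/code_itv; apply/andP; split; lra.
Qed.

Lemma code_segment r s t : code_le (code r) (code s) -> 0 < t <= 1 ->
  code (r + t * (s - r)) = code s.
Proof.
move=> rs /andP[t0 t1].
case: (codeP s) rs => n => [sE /code_le_even/code_even rE|sI].
  by rewrite rE sE subrr mulr0 addr0 code_int.
have {}t1' : 0 <= 1 - t by rewrite subr_ge0.
move=> rs; have H : n%:~R <= r <= n%:~R + 1.
  case: rs => [/code_odd/andP[a b]|[m [E [Er|Er]]]].
  - by rewrite !ltW.
  - have nm : n = m by lia.
    rewrite (code_even Er) nm.
    by rewrite lexx lerDl ler01.
  have Er' : code r = (m + 1) * 2 by lia.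
  have nm : n = m by lia.
  by rewrite (code_even Er') nm intrD lexx lerDl ler01.
case/andP: H => h1 h2; case/andP: sI => s1 s2.
by apply: code_itv; apply/andP; split; nra.
Qed.

End Codes.

Section RationalSpan.
Context {d : nat}.
Implicit Types (a u v w : 'rV[int]_d) (s : seq 'rV[int]_d).

Definition rat_row a : 'rV[rat]_d := map_mx intr a.

Definition rat_span s : 'M[rat]_d := (\sum_(a <- s) <<rat_row a>>)%MS.

Lemma rat_span_cons a s : (rat_span (a :: s) :=: rat_span s + rat_row a)%MS.
Proof.
rewrite /rat_span big_cons; apply/eqmxP; rewrite addsmxC.
by rewrite !(adds_eqmx (eqmx_refl _) (genmxE _)) submx_refl.
Qed.

Lemma mem_rat_span a s : a \in s -> (rat_row a <= rat_span s)%MS.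
Proof.
elim: s => // b s IHs; rewrite inE rat_span_cons => /orP[/eqP ->|/IHs H].
  exact: addsmxSr.
exact: submx_trans H (addsmxSl _ _).
Qed.

Lemma sub_rat_span s s' : {subset s <= s'} -> (rat_span s <= rat_span s')%MS.
Proof.
elim: s => [|a s IHs] ss; first by rewrite /rat_span big_nil sub0mx.
rewrite rat_span_cons addsmx_sub IHs ?mem_rat_span ?ss ?mem_head // => b bs.
by apply: ss; rewrite inE bs orbT.
Qed.

Lemma zdotD (a u v : 'rV[int]_d) : zdot a (u + v) = zdot a u + zdot a v.
Proof. by rewrite /zdot -big_split; apply: eq_bigr => j _; rewrite mxE mulrDr. Qed.

Lemma zdotN (a v : 'rV[int]_d) : zdot a (- v) = - zdot a v.
Proof. by rewrite /zdot -sumrN; apply: eq_bigr => j _; rewrite mxE mulrN. Qed.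

Lemma zdotZ (a v : 'rV[int]_d) k : zdot a (k *: v) = k * zdot a v.
Proof. by rewrite /zdot mulr_sumr; apply: eq_bigr => j _; rewrite mxE mulrCA. Qed.

Lemma zdot_rat a v : (rat_row a *m (rat_row v)^T) 0 0 = (zdot a v)%:~R.
Proof.
rewrite mxE /zdot rmorph_sum /=; apply: eq_bigr => j _.
by rewrite !mxE rmorphM.
Qed.

Lemma clear_denominators (u : 'rV[rat]_d) : exists (N : int) v,
  N != 0 /\ N%:~R *: u = rat_row v.
Proof.
pose N : int := \prod_j denq (u 0 j).
have N0 : N != 0 by apply/prodf_neq0 => j _; exact: denq_neq0.
exists N, (\row_j (numq (u 0 j) * \prod_(i | i != j) denq (u 0 i))).
split=> //; apply/rowP => j; rewrite !mxE /N (bigD1 j) //= !rmorphM /=.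
by rewrite numqE; ring.
Qed.

(** A vector outside a subspace is detected by a linear form vanishing on the
    subspace; clearing denominators makes it integral, which is what yields a
    lattice direction. *)
Lemma rat_span_complement a s : ~~ (rat_row a <= rat_span s)%MS ->
  exists v, (forall b, b \in s -> zdot b v = 0) /\ zdot a v != 0.
Proof.
rewrite submxE => /eqP/matrixP H.
have [j aj] : exists j, (rat_row a *m cokermx (rat_span s)) 0 j != 0.
  apply/existsP; rewrite -negb_forall; apply/negP => /forallP E; apply: H => i j.
  by rewrite ord1 [RHS]mxE; exact/eqP/E.
have [N [v [N0 vE]]] := clear_denominators (col j (cokermx (rat_span s)))^T.
have zE b : (zdot b v)%:~R = N%:~R * (rat_row b *m cokermx (rat_span s)) 0 j.
  rewrite -zdot_rat -vE linearZ /= trmxK -scalemxAr !mxE; congr (_ * _).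
  by apply: eq_bigr => i _; rewrite !mxE.
exists v; split=> [b bs|].
  apply/eqP; rewrite -(intr_eq0 rat) zE.
  have := mem_rat_span bs; rewrite submxE => /eqP ->.
  by rewrite mxE mulr0.
by rewrite -(intr_eq0 rat) zE mulf_neq0 ?intr_eq0.
Qed.

Lemma rank_rat_span_cons a s :
  \rank (rat_span (a :: s)) = (~~ (rat_row a <= rat_span s)%MS + \rank (rat_span s))%N.
Proof.
rewrite rat_span_cons; case: (boolP (rat_row a <= rat_span s)%MS) => /= sa.
  by rewrite (addsmx_idPl sa).
apply/eqP; rewrite eqn_leq addnC; apply/andP; split.
  by apply: leq_trans (mxrank_adds_leqif _ _) _; rewrite leq_add2l rank_leq_row.
rewrite addn1; apply: rank_ltmx; rewrite ltmxE addsmxSl /=.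
by apply: contra sa => H; apply: submx_trans (addsmxSr _ _) H.
Qed.

End RationalSpan.

(** * Cells of a periodic arrangement *)

Section Pairing.
Context {R : realType} {d : nat}.
Local Notation V := 'rV[R]_d.
Local Notation "v %:V" := (map_mx intr v : V) (at level 2, format "v %:V").

Lemma pairingZ a (t : R) (x : V) : pairing a (t *: x) = t * pairing a x.
Proof.
rewrite /pairing mulr_sumr; apply: eq_bigr => j _.
by rewrite mxE mulrCA.
Qed.

Lemma pairingB a (x y : V) : pairing a (x - y) = pairing a x - pairing a y.
Proof. by rewrite pairingD -scaleN1r pairingZ mulN1r. Qed.

Definition rat_pairing (r : 'rV[rat]_d) (x : V) : R := \sum_j ratr (r 0 j) * x 0 j.

Lemma rat_pairingE a x : rat_pairing (rat_row a) x = pairing a x.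
Proof.
by rewrite /rat_pairing /pairing; apply: eq_bigr => j _; rewrite mxE ratr_int.
Qed.

Lemma rat_pairingD r r' x : rat_pairing (r + r') x = rat_pairing r x + rat_pairing r' x.
Proof.
rewrite /rat_pairing -big_split; apply: eq_bigr => j _ /=.
by rewrite mxE rmorphD mulrDl.
Qed.

Lemma rat_pairingZ c r x : rat_pairing (c *: r) x = ratr c * rat_pairing r x.
Proof.
rewrite /rat_pairing mulr_sumr; apply: eq_bigr => j _ /=.
by rewrite mxE rmorphM mulrA.
Qed.

Lemma rat_span_ind (K : 'rV[rat]_d -> Prop) s :
  K 0 -> (forall r r', K r -> K r' -> K (r + r')) -> (forall c r, K r -> K (c *: r)) ->
  (forall a, a \in s -> K (rat_row a)) -> forall r : 'rV_d, (r <= rat_span s)%MS -> K r.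
Proof.
move=> K0 KD KZ; elim: s => [|a s IHs] Ks r.
  by rewrite /rat_span big_nil submx0 => /eqP ->.
rewrite rat_span_cons => /sub_addsmxP [u ->]; apply: KD.
  by apply: IHs (submxMl _ _) => b bs; apply: Ks; rewrite inE bs orbT.
have -> : u.2 *m rat_row a = u.2 0 0 *: rat_row a.
  by rewrite {1}[u.2]mx11_scalar mul_scalar_mx.
by apply: KZ; apply: Ks; rewrite mem_head.
Qed.

Lemma rat_span_kill_row s (r : 'rV_d) (w : V) :
  (forall b, b \in s -> pairing b w = 0) -> (r <= rat_span s)%MS -> rat_pairing r w = 0.
Proof.
move=> sw rs; apply: (@rat_span_ind (fun r => rat_pairing r w = 0) s _ _ _ _ _ rs).
- by rewrite /rat_pairing big1 // => j _; rewrite mxE rmorph0 mul0r.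
- by move=> r1 r' r0 r0'; rewrite rat_pairingD r0 r0' addr0.
- by move=> c r1 r0; rewrite rat_pairingZ r0 mulr0.
- by move=> b /sw bw; rewrite rat_pairingE.
Qed.

Lemma rat_span_kill s a (w : V) : (forall b, b \in s -> pairing b w = 0) ->
  (rat_row a <= rat_span s)%MS -> pairing a w = 0.
Proof. by move=> sw asp; rewrite -rat_pairingE; exact: rat_span_kill_row asp. Qed.

(** A combination of bounded linear forms is bounded. *)
Lemma rat_span_bounded s a (F : set V) :
  (forall b, b \in s -> exists B : R, forall y, F y -> `|pairing b y| <= B) ->
  (rat_row a <= rat_span s)%MS -> exists B : R, forall y, F y -> `|pairing a y| <= B.
Proof.
move=> sB asp; have [||||B HB] := @rat_span_ind
  (fun r => exists B : R, forall y, F y -> `|rat_pairing r y| <= B) s _ _ _ _ _ asp.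
- by exists 0 => y _; rewrite /rat_pairing big1 ?normr0 // => j _; rewrite mxE rmorph0 mul0r.
- move=> r r' [B HB] [B' HB']; exists (B + B') => y Fy.
  by rewrite rat_pairingD (le_trans (ler_normD _ _)) // lerD ?HB ?HB'.
- move=> c r [B HB]; exists (`|ratr c| * B) => y Fy.
  by rewrite rat_pairingZ normrM ler_wpM2l ?HB.
- by move=> b /sB [B HB]; exists B => y Fy; rewrite rat_pairingE HB.
- by exists B => y Fy; rewrite -rat_pairingE HB.
Qed.

End Pairing.

Section Cells.
Context {R : realType} {d : nat}.
Local Notation V := 'rV[R]_d.
Local Notation "v %:V" := (map_mx intr v : V) (at level 2, format "v %:V").
Implicit Types (p q : 'rV[int]_d * R) (P : seq ('rV[int]_d * R)) (x y z : V) (F G : set V).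

Definition pcode p x : int := code (pairing p.1 x - p.2).

Definition cell P x : set V := [set y | forall p, p \in P -> pcode p y = pcode p x].

Definition is_cell P F := exists x, F = cell P x.

Definition even_at P x : seq 'rV[int]_d := [seq p.1 | p <- P & (2 %| pcode p x)%Z].

(** The codimension of the cell of [x]: its affine hull is cut out by the equations
    whose code at [x] is even. *)
Definition crk P x : nat := \rank (rat_span (even_at P x)).

Definition codim P F : nat := crk P (xget 0 F).

Definition cell_le P x y := forall p, p \in P -> code_le (pcode p x) (pcode p y).

Lemma pcode_shift p x v : pcode p (x + v%:V) = pcode p x + zdot p.1 v * 2.
Proof. by rewrite /pcode pairingD pairing_int addrAC codeDz. Qed.

Lemma cell_refl P x : cell P x x. Proof. by []. Qed.

Lemma cell_eq P x y : cell P x y -> cell P y = cell P x.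
Proof.
move=> xy; apply/seteqP; split=> z Hz p pP; first by rewrite Hz // xy.
by rewrite Hz // xy.
Qed.

Lemma is_cellE P F x : is_cell P F -> F x -> F = cell P x.
Proof. by move=> [y ->] /cell_eq. Qed.

Lemma cell_is_cell P x : is_cell P (cell P x). Proof. by exists x. Qed.

Lemma is_cell_ex P F : is_cell P F -> exists x, F x.
Proof. by move=> [x ->]; exists x. Qed.

Lemma even_at_cell P x y : cell P x y -> even_at P y = even_at P x.
Proof.
by move=> xy; rewrite /even_at; congr map; apply: eq_in_filter => p pP; rewrite xy.
Qed.

Lemma codimE P F x : is_cell P F -> F x -> codim P F = crk P x.
Proof.
move=> cF Fx; rewrite /codim /crk.
have Fy : F (xget 0 F) by exact: xgetI Fx.
by rewrite (@even_at_cell P x) // -(is_cellE cF Fx).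
Qed.

Lemma translate_cell P v x : translate v (cell P x) = cell P (x + v%:V).
Proof.
rewrite translateE; apply/seteqP; split=> y /= H p pP.
  by rewrite -(subrK v%:V y) !pcode_shift H.
have := H p pP; rewrite pcode_shift -{1}(subrK v%:V y) pcode_shift.
exact: addIr.
Qed.

Lemma is_cell_translate P v F : is_cell P F -> is_cell P (translate v F).
Proof. by move=> [x ->]; exists (x + v%:V); rewrite translate_cell. Qed.

Lemma even_at_shift P v x : even_at P (x + v%:V) = even_at P x.
Proof.
by rewrite /even_at; congr map; apply: eq_filter => p; rewrite pcode_shift; lia.
Qed.

Lemma crk_shift P v x : crk P (x + v%:V) = crk P x.
Proof. by rewrite /crk even_at_shift. Qed.

Lemma codim_translate P v F : is_cell P F -> codim P (translate v F) = codim P F.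
Proof.
move=> cF; have [x Fx] := is_cell_ex cF.
rewrite (codimE cF Fx) (@codimE _ _ (x + v%:V)) ?crk_shift //.
  exact: is_cell_translate.
by exists x.
Qed.

Lemma pcode_near p x : \forall z \near x, code_le (pcode p x) (pcode p z).
Proof.
have [e e0 He] := code_near (pairing p.1 x - p.2).
have /(@cvgrPdist_lt R R^o)/(_ _ e0) := @pairing_continuous R d p.1 x.
apply: filterS => z; rewrite distrC => xz; apply: He.
by rewrite opprB addrA subrK distrC.
Qed.

Lemma cell_le_near P x : \forall z \near x, cell_le P x z.
Proof.
elim: P => [|p P IHP]; first by apply: filterS (filterT) => z _ q.
apply: filterS2 (pcode_near p x) IHP => z pz Pz q.
by rewrite inE => /orP[/eqP ->|/Pz].
Qed.

Lemma cell_le_segment P x y (t : R) : cell_le P x y -> 0 < t <= 1 ->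
  cell P y (x + t *: (y - x)).
Proof.
move=> xy t01 p pP; have := code_segment (xy p pP) t01; rewrite /pcode => <-.
by congr code; rewrite pairingD pairingZ pairingB; ring.
Qed.

Lemma line_near x w (B : set V) : nbhs x B ->
  exists2 e : R, 0 < e & forall t, `|t| < e -> B (x + t *: w).
Proof.
move=> nB; have c : continuous_at (0 : R) (fun t : R => x + t *: w).
  apply: mx_continuous_at => i j.
  have -> : (fun t : R => (x + t *: w) i j) = (fun t : R => x i j + t * w i j).
    by apply/funext => z; rewrite !mxE.
  apply: contD; first exact: cst_continuous.
  by apply: contM; [move=> ?; apply | exact: cst_continuous].
have : nbhs (0 : R) [set t : R | B (x + t *: w)].
  by apply: (c B); rewrite /= scale0r addr0.
move=> /nbhs_ballP[e /= e0 He]; exists e => // t te; apply: He.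
by rewrite -ball_normE /= sub0r normrN.
Qed.

(** A point of the closure has neighbours in the cell, and [code_near] compares the
    codes; conversely the segment from [x] to [y] runs inside the cell of [y] as soon
    as it leaves [x]. *)
Lemma face_le_cellP P x y : face_le (cell P x) (cell P y) <-> cell_le P x y.
Proof.
split=> [/(_ x (cell_refl x)) xc|xy z xz B zB].
  have [z [yz xz]] := xc _ (cell_le_near P x).
  by move=> p pP; rewrite -(yz p pP); exact: xz.
have zy : cell_le P z y by move=> p pP; rewrite xz //; exact: xy.
have [e e0 He] := line_near (y - z) zB.
pose t := Num.min 1 (e / 2).
have t0 : 0 < t by rewrite lt_min ltr01 divr_gt0.
exists (z + t *: (y - z)); split.
  by apply: cell_le_segment => //; rewrite t0 /= ge_min lexx.
apply: He; rewrite gtr0_norm // gt_min; apply/orP; right.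
by rewrite ltr_pdivrMr // ltr_pMr // ltr1n.
Qed.

Lemma even_atP P x a : a \in even_at P x ->
  exists p n, [/\ p \in P, a = p.1 & pcode p x = n * 2].
Proof.
move=> /mapP [p]; rewrite mem_filter => /andP[/dvdzP [n pn] pP] ->.
by exists p, n; rewrite pn.
Qed.

Lemma mem_even_at P x p n : p \in P -> pcode p x = n * 2 -> p.1 \in even_at P x.
Proof.
by move=> pP pn; apply: map_f; rewrite mem_filter pP andbT pn dvdz_mull.
Qed.

Lemma pcode_even p x n : pcode p x = n * 2 -> pairing p.1 x = n%:~R + p.2.
Proof. by move=> /code_even /eqP; rewrite subr_eq => /eqP. Qed.

Lemma int_parity (c : int) :
  (exists n : int, c = n * 2) \/ (exists n : int, c = n * 2 + 1).
Proof.
have : c = (c %/ 2)%Z * 2 \/ c = (c %/ 2)%Z * 2 + 1 by lia.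
by case=> E; [left|right]; exists (c %/ 2)%Z.
Qed.

(** A displacement along the affine hull leaves the even codes unchanged, and odd
    codes are locally constant. *)
Lemma cell_line P x w : (forall a, a \in even_at P x -> pairing a w = 0) ->
  exists2 e : R, 0 < e & forall t, `|t| < e -> cell P x (x + t *: w).
Proof.
move=> xw; have [e e0 He] := line_near w (cell_le_near P x).
exists e => // t /He le p pP; have := le p pP.
have [[n pn]|[n pn]] := int_parity (pcode p x); last by rewrite pn => /code_le_odd.
move=> _; rewrite /pcode pairingD pairingZ xw ?mulr0 ?addr0 //.
exact: mem_even_at pn.
Qed.

Lemma cell_le_kill P x y : cell_le P x y ->
  forall a, a \in even_at P y -> pairing a (y - x) = 0.
Proof.
move=> xy a /even_atP [p [n [pP -> py]]]; have := xy p pP; rewrite py.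
by move=> /code_le_even px; rewrite pairingB (pcode_even px) (pcode_even py) subrr.
Qed.

Lemma cell_le_even P x y : cell_le P x y -> {subset even_at P y <= even_at P x}.
Proof.
move=> xy a /even_atP [p [n [pP -> py]]]; have := xy p pP; rewrite py.
by move=> /code_le_even px; exact: mem_even_at pP px.
Qed.

Lemma cell_le_kill_cell P x y : cell_le P x y ->
  (forall a, a \in even_at P x -> pairing a (y - x) = 0) -> cell P x y.
Proof.
move=> xy kill p pP; have := xy p pP.
have [[n pn]|[n pn]] := int_parity (pcode p x); last by rewrite pn => /code_le_odd.
move=> _; have := kill _ (mem_even_at pP pn); rewrite pairingB => /eqP.
by rewrite subr_eq0 /pcode => /eqP ->.
Qed.

(** If the two affine hulls have the same dimension they coincide, and then no
    equation satisfied at [x] can fail at [y]. *)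
Lemma cell_le_crk_eq P x y : cell_le P x y -> (crk P x <= crk P y)%N -> cell P x y.
Proof.
move=> xy rxy; apply: cell_le_kill_cell => // a ax.
apply: (rat_span_kill (cell_le_kill xy)).
have S := sub_rat_span (cell_le_even xy).
have := (mxrank_leqif_sup S).2; rewrite eqn_leq (mxrankS S) rxy => /esym H.
exact: submx_trans (mem_rat_span ax) H.
Qed.

Definition constant_on P q x := (rat_row q.1 <= rat_span (even_at P x))%MS.

Lemma constant_onP P q x y : constant_on P q x -> cell P x y ->
  pairing q.1 y = pairing q.1 x.
Proof.
move=> qx xy; apply/eqP; rewrite -subr_eq0 -pairingB; apply/eqP.
apply: (rat_span_kill _ qx) => a; rewrite -(even_at_cell xy).
by apply: cell_le_kill => p pP; rewrite xy //; left.
Qed.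

Lemma even_at_cons P q x : even_at (q :: P) x =
  if (2 %| pcode q x)%Z then q.1 :: even_at P x else even_at P x.
Proof. by rewrite /even_at /=; case: ifP. Qed.

Lemma crk_cons_odd P q x : ~~ (2 %| pcode q x)%Z -> crk (q :: P) x = crk P x.
Proof. by rewrite /crk even_at_cons => /negPf ->. Qed.

Lemma crk_cons_constant P q x : constant_on P q x -> crk (q :: P) x = crk P x.
Proof.
rewrite /crk even_at_cons; case: ifP => // _ qx.
by rewrite rank_rat_span_cons; move: qx; rewrite /constant_on => ->.
Qed.

Lemma crk_cons_drop P q x : (2 %| pcode q x)%Z -> ~~ constant_on P q x ->
  crk (q :: P) x = (crk P x).+1.
Proof. by rewrite /crk even_at_cons => -> /negPf H; rewrite rank_rat_span_cons -[X in ~~ X]/(constant_on P q x) H. Qed.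

(** If [z] were on the hyperplane of [q] through the facet [x], it would satisfy all
    equations of the affine hull of the facet: by the rank hypothesis these are
    spanned by the equations of [y] together with [q]. *)
Lemma facet_not_crossed P q x y z : cell_le P x y -> crk P x = (crk P y).+1 ->
  constant_on P q x -> ~~ constant_on P q y -> cell P y z ->
  pairing q.1 z <> pairing q.1 x.
Proof.
move=> xy rxy qx qy yz qzx; have ez := even_at_cell yz.
have xz : cell_le P x z by move=> p pP; rewrite yz //; exact: xy.
have S : (rat_span (q.1 :: even_at P y) <= rat_span (even_at P x))%MS.
  rewrite rat_span_cons addsmx_sub; apply/andP; split; last exact: qx.
  by apply: sub_rat_span; exact: cell_le_even.
have rS : \rank (rat_span (q.1 :: even_at P y)) = crk P x.
  by rewrite rank_rat_span_cons rxy -[X in ~~ X]/(constant_on P q y) qy.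
have /esym xS := (mxrank_leqif_sup S).2; rewrite rS eqxx in xS.
have : cell P x z.
  apply: cell_le_kill_cell => // a ax.
  apply: (@rat_span_kill _ _ (q.1 :: even_at P y)); last first.
    by apply: submx_trans (mem_rat_span ax) _; rewrite xS.
  move=> b; rewrite inE => /orP[/eqP ->|]; first by rewrite pairingB qzx subrr.
  by rewrite -ez; apply: cell_le_kill.
move=> /even_at_cell E; move: rxy; rewrite /crk -E ez => /eqP.
by rewrite -addn1 -{1}[\rank _]addn0 eqn_add2l.
Qed.

End Cells.

(** * Slicing cells by one more family of hyperplanes *)

Section Slices.
Context {R : realType} {d : nat}.
Local Notation V := 'rV[R]_d.
Local Notation "v %:V" := (map_mx intr v : V) (at level 2, format "v %:V").
Variables (P : seq ('rV[int]_d * R)) (q : 'rV[int]_d * R).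
Implicit Types (x y z : V) (F G : set V) (c e : int).

Definition attains F c := exists y, F y /\ pcode q y = c.

Definition slice c F : set V := [set y | F y /\ pcode q y = c].

Definition constant F : bool := constant_on P q (xget 0 F).

(** Holds when slicing at code [c] does not lower the dimension of [F]. *)
Definition flat F c := ~~ (2 %| c)%Z || constant F.

Lemma constantE F x : is_cell P F -> F x -> constant F = constant_on P q x.
Proof.
move=> cF Fx; rewrite /constant /constant_on.
have Fy : F (xget 0 F) by exact: xgetI Fx.
by rewrite (@even_at_cell _ _ P x) // -(is_cellE cF Fx).
Qed.

Lemma attains_ex F : is_cell P F -> exists c, attains F c.
Proof. by move=> /is_cell_ex [x Fx]; exists (pcode q x), x. Qed.

Lemma cell_cons x : cell (q :: P) x = slice (pcode q x) (cell P x).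
Proof.
apply/seteqP; split=> y.
  by move=> H; split=> [p pP|]; apply: H; rewrite inE ?pP ?orbT ?eqxx.
by move=> [H qy] p; rewrite inE => /orP[/eqP ->|/H].
Qed.

Lemma sliceE F x : is_cell P F -> F x -> slice (pcode q x) F = cell (q :: P) x.
Proof. by move=> cF Fx; rewrite cell_cons -(is_cellE cF Fx). Qed.

Lemma slice_cell F c : is_cell P F -> attains F c -> is_cell (q :: P) (slice c F).
Proof. by move=> cF [x [Fx <-]]; exists x; rewrite sliceE. Qed.

Lemma cell_slice A : is_cell (q :: P) A -> exists F c,
  [/\ is_cell P F, attains F c & A = slice c F].
Proof.
move=> [x ->]; exists (cell P x), (pcode q x); split; last exact: cell_cons.
  by exists x.
by exists x.
Qed.

Lemma slice_inj F F' c c' : is_cell P F -> is_cell P F' -> attains F c ->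
  slice c F = slice c' F' -> F = F' /\ c = c'.
Proof.
move=> cF cF' [x [Fx xc]] E.
have [F'x xc'] : slice c' F' x by rewrite -E.
by rewrite (is_cellE cF Fx) (is_cellE cF' F'x) -xc -xc'.
Qed.

Lemma slice_le F G c c' : is_cell P F -> is_cell P G -> attains F c -> attains G c' ->
  face_le (slice c F) (slice c' G) <-> face_le F G /\ code_le c c'.
Proof.
move=> cF cG [x [Fx <-]] [y [Gy <-]]; rewrite !sliceE //.
rewrite (is_cellE cF Fx) (is_cellE cG Gy); split.
  move=> /face_le_cellP H; split; last by apply: H; rewrite mem_head.
  by apply/face_le_cellP => p pP; apply: H; rewrite inE pP orbT.
move=> [/face_le_cellP H qxy]; apply/face_le_cellP => p.
by rewrite inE => /orP[/eqP ->|/H].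
Qed.

Lemma attains_le F G c : is_cell P F -> is_cell P G -> face_le F G -> attains F c ->
  exists c', attains G c' /\ code_le c c'.
Proof.
move=> cF cG FG [x [Fx <-]]; have [y [Gy xy]] := FG x Fx _ (pcode_near q x).
by exists (pcode q y); split=> //; exists y.
Qed.

Lemma codim_slice F c : is_cell P F -> attains F c ->
  codim (q :: P) (slice c F) = (codim P F + ~~ flat F c)%N.
Proof.
move=> cF [x [Fx xc]]; rewrite (@codimE _ _ _ _ x); last by split.
  rewrite (codimE cF Fx) /flat -xc (constantE cF Fx).
  case: (boolP (constant_on P q x)) => qx.
    by rewrite crk_cons_constant // orbT addn0.
  rewrite orbF negbK; case: (boolP (2 %| _)%Z) => qe.
    by rewrite crk_cons_drop // addn1.
  by rewrite crk_cons_odd // addn0.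
by apply: slice_cell => //; exists x.
Qed.

Lemma attains_translate F c v : attains F c ->
  attains (translate v F) (c + zdot q.1 v * 2).
Proof.
move=> [y [Fy <-]]; exists (y + v%:V); split; first by exists y.
exact: pcode_shift.
Qed.

Lemma translate_slice F c v :
  translate v (slice c F) = slice (c + zdot q.1 v * 2) (translate v F).
Proof.
apply/seteqP; split=> [_ [y [Fy <-] <-]|_ [[y Fy <-] yc]].
  by split; [exists y | exact: pcode_shift].
exists y => //; split=> //; move: yc; rewrite pcode_shift; exact: addIr.
Qed.

Lemma constant_translate F v : is_cell P F -> constant (translate v F) = constant F.
Proof.
move=> cF; have [x Fx] := is_cell_ex cF.
rewrite (constantE cF Fx) (@constantE _ (x + v%:V)); last by exists x.
  by rewrite /constant_on even_at_shift.
exact: is_cell_translate.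
Qed.

Lemma flat_translate F v c : is_cell P F ->
  flat (translate v F) (c + zdot q.1 v * 2) = flat F c.
Proof. by move=> cF; rewrite /flat constant_translate //; congr (~~ _ || _); lia. Qed.

Lemma constant_attains F c c' : is_cell P F -> constant F ->
  attains F c -> attains F c' -> c = c'.
Proof.
move=> cF qF [x [Fx <-]] [y [Fy <-]]; move: qF; rewrite (constantE cF Fx) => qF.
rewrite /pcode (@constant_onP _ _ _ _ _ y qF) //.
by rewrite -(is_cellE cF Fx).
Qed.

Lemma cell_convex F x y (t : R) : is_cell P F -> F x -> F y -> 0 <= t <= 1 ->
  F (x + t *: (y - x)).
Proof.
move=> cF Fx Fy /andP[]; rewrite le_eqVlt => /orP[/eqP <- _|t0 t1].
  by rewrite scale0r addr0.
rewrite (is_cellE cF Fy); apply: cell_le_segment; last by rewrite t0.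
move: Fy; rewrite (is_cellE cF Fx) => Fy p pP; rewrite Fy //; exact: code_le_refl.
Qed.

Lemma attains_between F c c' e : is_cell P F -> attains F c -> attains F c' ->
  c <= e <= c' -> attains F e.
Proof.
move=> cF [x [Fx xc]] [y [Fy yc]] /andP[ce ec'].
have [E|ce'] := eqVneq c e; first by exists x; rewrite -E.
have [E|ec''] := eqVneq e c'; first by exists y; rewrite E.
pose r : R := e%:~R / 2; have er : code r = e by exact: code_half.
have xr : pairing q.1 x - q.2 < r.
  rewrite ltNge; apply/negP => /code_mono; rewrite er -/(pcode q x) xc => H.
  by move/eqP: ce'; apply; apply/eqP; rewrite eq_le ce.
have ry : r < pairing q.1 y - q.2.
  rewrite ltNge; apply/negP => /code_mono; rewrite er -/(pcode q y) yc => H.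
  by move/eqP: ec''; apply; apply/eqP; rewrite eq_le ec'.
pose a := pairing q.1 x - q.2; pose b := pairing q.1 y - q.2.
have ab : 0 < b - a by rewrite subr_gt0 (lt_trans xr).
exists (x + ((r - a) / (b - a)) *: (y - x)); split.
  apply: cell_convex => //; apply/andP; split.
    by rewrite divr_ge0 // ltW // subr_gt0.
  by rewrite ler_pdivrMr // mul1r lerD2r ltW.
rewrite -er /pcode pairingD pairingZ pairingB; congr code.
have -> : pairing q.1 y - pairing q.1 x = b - a by rewrite /a /b; ring.
by rewrite divfK ?gt_eqF // /a; ring.
Qed.

(** On a cell where [q] varies one can cross the hyperplane in both directions while
    staying in the cell. *)
Lemma attains_neighbours F n : is_cell P F -> ~~ constant F -> attains F (n * 2) ->
  attains F (n * 2 + 1) /\ attains F (n * 2 - 1).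
Proof.
move=> cF + [x [Fx xn]]; rewrite (constantE cF Fx) => /rat_span_complement [v [vP qv]].
have [|e e0 He] := @cell_line _ _ P x v%:V.
  by move=> a /vP; rewrite pairing_int => ->.
pose k := zdot q.1 v; have k0 : (k%:~R : R) != 0 by rewrite intr_eq0.
pose t := Num.min (e / 2) (2^-1 / `|k%:~R|).
have t0 : 0 < t by rewrite lt_min !divr_gt0 ?normr_gt0 // invr_gt0.
have te : `|t| < e.
  by rewrite gtr0_norm // gt_min ltr_pdivrMr // ltr_pMr // ltr1n.
have tk : `|t * k%:~R| <= 2^-1.
  by rewrite normrM gtr0_norm // -ler_pdivlMr ?normr_gt0 // ge_min lexx orbT.
have F1 s : `|s| < e -> F (x + s *: v%:V) by rewrite (is_cellE cF Fx); exact: He.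
have C s : pcode q (x + s *: v%:V) = code (n%:~R + s * k%:~R : R).
  rewrite /pcode pairingD pairingZ pairing_int (pcode_even xn); congr code.
  by rewrite addrAC addrK.
have up (s : R) : `|s| < e -> 0 < s * k%:~R <= 2^-1 -> attains F (n * 2 + 1).
  move=> se /andP[s0 s1]; exists (x + s *: v%:V); split; first exact: F1.
  by rewrite C; apply: code_itv; rewrite ltrDl s0 ltrD2l (le_lt_trans s1) // invf_lt1 ?ltr1n.
have dn (s : R) : `|s| < e -> - 2^-1 <= s * k%:~R < 0 -> attains F (n * 2 - 1).
  move=> se /andP[s0 s1]; exists (x + s *: v%:V); split; first exact: F1.
  have -> : n * 2 - 1 = (n - 1) * 2 + 1 by lia.
  rewrite C; apply: code_itv; rewrite intrB subrK gtrDl s1 ltrD2l andbT.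
  by apply: lt_le_trans s0; rewrite ltrN2 invf_lt1 ?ltr1n.
move: tk; rewrite ler_norml => /andP[tk1 tk2].
have [kp|kn|k00] := ltgtP (0 : R) k%:~R.
- have tk0 : 0 < t * k%:~R by rewrite mulr_gt0.
  split; first by apply: (up t); rewrite ?tk0.
  by apply: (dn (- t)); rewrite ?normrN // mulNr lerN2 tk2 oppr_lt0.
- have tk0 : t * k%:~R < 0 by rewrite pmulr_rlt0.
  split; last by apply: (dn t); rewrite ?tk0 ?tk1.
  by apply: (up (- t)); rewrite ?normrN // mulNr oppr_gt0 tk0 lerNl.
- by move: k0; rewrite -k00 eqxx.
Qed.

Lemma facet_attains F G n : is_cell P F -> is_cell P G -> face_le F G ->
  codim P F = (codim P G).+1 -> constant F -> ~~ constant G ->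
  attains F (n * 2) -> ~ attains G (n * 2).
Proof.
move=> cF cG FG rFG qF qG [x [Fx xn]] [z [Gz zn]].
move: FG; rewrite (is_cellE cF Fx) (is_cellE cG Gz) => /face_le_cellP xz.
apply: (@facet_not_crossed _ _ P q x z z) => //.
- by rewrite -(codimE cF Fx) -(codimE cG Gz).
- by rewrite -(constantE cF Fx).
- by rewrite -(constantE cG Gz).
by rewrite (pcode_even xn) (pcode_even zn).
Qed.

End Slices.

(** * Refining a matching *)

#[local] Opaque codim.

Section Matchings.
Context {R : realType} {d : nat}.
Local Notation V := 'rV[R]_d.
Implicit Types (P : seq ('rV[int]_d * R)) (F G : set V) (M : set V -> set V -> Prop).

Definition matched_up M F := exists G, M F G.
Definition matched_down M G := exists F, M F G.

(** One step of a gradient path: up along the matching and down to another matched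
    cell of the original dimension.  Infinite paths in the universal cover project
    to cycles of the quotient, whence the well-foundedness required of a matching. *)
Definition gradient_step P M F' F := exists G,
  [/\ M F G, matched_up M F', face_le F' G, F' <> F & codim P F' = codim P F].

Record cell_matching P M : Prop := CellMatching {
  matching_cellL : forall F G, M F G -> is_cell P F;
  matching_cellR : forall F G, M F G -> is_cell P G;
  matching_le : forall F G, M F G -> face_le F G;
  matching_codim : forall F G, M F G -> codim P F = (codim P G).+1;
  matching_funL : forall F G G', M F G -> M F G' -> G = G';
  matching_funR : forall F F' G, M F G -> M F' G -> F = F';
  matching_disjoint : forall F G H, M F G -> ~ M G H;
  matching_translate : forall F G v, M F G -> M (translate v F) (translate v G);
  matching_acyclic : well_founded (gradient_step P M) }.

Definition critical_cell P M F :=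
  [/\ is_cell P F, ~ matched_up M F & ~ matched_down M F].

Lemma face_le_codim_eq P F G : is_cell P F -> is_cell P G -> face_le F G ->
  (codim P F <= codim P G)%N -> F = G.
Proof.
move=> cF cG; have [x Fx] := is_cell_ex cF; have [y Gy] := is_cell_ex cG.
rewrite (codimE cF Fx) (codimE cG Gy) (is_cellE cF Fx) (is_cellE cG Gy).
by move=> /face_le_cellP xy r; rewrite (cell_eq (cell_le_crk_eq xy r)).
Qed.

Section Refinement.
Variables (P : seq ('rV[int]_d * R)) (q : 'rV[int]_d * R).
Variables (M : set V -> set V -> Prop) (Mm : cell_matching P M).
Variables (X : set V -> int -> Prop) (W : set V -> int -> int -> Prop).

Definition linked F c G c' := code_le c c' /\ (flat P q F c = flat P q G c').

Definition wall_step G e2 e := exists e' e2',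
  [/\ W G e e', W G e2 e2', code_le e2 e' & e2 <> e].

(** [X F c] selects the slices of [F] that are kept to represent [F] after the family
    of hyperplanes of [q] is added, and [W G e e'] matches the wall of [G] at the
    even code [e] with the neighbouring slab at the odd code [e'].  The conditions
    say that the kept slices of two matched cells correspond to each other, that
    all other slices are matched within their cell, that a slab facing the partner
    of [G] is kept, and that running through the walls of one cell always ends. *)
Record refinement_data : Prop := RefinementData {
  kept_cell : forall F c, X F c -> is_cell P F;
  kept_attains : forall F c, X F c -> attains q F c;
  kept_constant : forall F c, is_cell P F -> constant P q F -> attains q F c -> X F c;
  kept_up : forall F G c, M F G -> X F c -> exists c', X G c' /\ linked F c G c';
  kept_down : forall F G c', M F G -> X G c' -> exists c, X F c /\ linked F c G c';
  kept_up_uniq : forall F G c c1 c2, M F G -> X F c -> X G c1 -> X G c2 ->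
    linked F c G c1 -> linked F c G c2 -> c1 = c2;
  kept_down_uniq : forall F G c c1 c2, M F G -> X G c -> X F c1 -> X F c2 ->
    linked F c1 G c -> linked F c2 G c -> c1 = c2;
  kept_facet : forall F G c e, M F G -> X F c -> flat P q F c -> attains q G e ->
    ~~ (2 %| e)%Z -> code_le c e -> X G e;
  kept_flat_odd : forall F c, X F c -> ~~ flat P q F c ->
    forall F' c', X F' c' -> flat P q F' c' -> ~~ (2 %| c')%Z;
  kept_translate : forall F c v, X F c -> X (translate v F) (c + zdot q.1 v * 2);
  wall_spec : forall G e e', W G e e' -> [/\ is_cell P G, ~~ constant P q G,
    (2 %| e)%Z, ~~ (2 %| e')%Z & code_le e e'];
  wall_attains : forall G e e', W G e e' -> attains q G e /\ attains q G e';
  wall_not_kept : forall G e e', W G e e' -> ~ X G e /\ ~ X G e';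
  wall_funL : forall G e e1 e2, W G e e1 -> W G e e2 -> e1 = e2;
  wall_funR : forall G e e1 e2, W G e1 e -> W G e2 e -> e1 = e2;
  wall_total : forall G c, is_cell P G -> ~~ constant P q G -> attains q G c ->
    ~ X G c -> exists e, W G c e \/ W G e c;
  wall_translate : forall G e e' v, W G e e' ->
    W (translate v G) (e + zdot q.1 v * 2) (e' + zdot q.1 v * 2);
  wall_acyclic : forall G, well_founded (wall_step G) }.

Hypothesis D : refinement_data.

Definition refined (A B : set V) : Prop :=
  (exists F G c c', [/\ M F G, X F c, X G c', linked F c G c' &
     A = slice q c F /\ B = slice q c' G]) \/
  (exists G e e', [/\ W G e e', A = slice q e G & B = slice q e' G]).

Let Q := q :: P.

Let cell_kept F c : X F c -> is_cell Q (slice q c F).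
Proof. by move=> Xc; apply: slice_cell; [exact: (kept_cell D Xc) | exact: (kept_attains D Xc)]. Qed.

Let wall_flat G e e' : W G e e' -> flat P q G e = false /\ flat P q G e' = true.
Proof.
move=> /(wall_spec D)[_ /negPf qG e2 e2' _]; split; first by rewrite /flat qG e2.
by rewrite /flat e2'.
Qed.

Let wall_codim G e e' : W G e e' ->
  codim Q (slice q e G) = (codim P G).+1 /\ codim Q (slice q e' G) = codim P G.
Proof.
move=> w; have [cG _ _ _ _] := wall_spec D w; have [ae ae'] := wall_attains D w.
have [fe fe'] := wall_flat w.
by rewrite /Q !codim_slice // fe fe' addn1 addn0.
Qed.

Let kept_inj F c F' c' : X F c -> is_cell P F' -> slice q c F = slice q c' F' ->
  F = F' /\ c = c'.
Proof.
by move=> Xc cF' E; exact: (slice_inj (kept_cell D Xc) cF' (kept_attains D Xc) E).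
Qed.

Let wall_inj G e e' F' c' : W G e e' -> is_cell P F' -> slice q e G = slice q c' F' ->
  G = F' /\ e = c'.
Proof.
move=> w cF'; have [cG _ _ _ _] := wall_spec D w; have [ae _] := wall_attains D w.
by move=> E; exact: (slice_inj cG cF' ae E).
Qed.

Let wall_inj' G e e' F' c' : W G e e' -> is_cell P F' -> slice q e' G = slice q c' F' ->
  G = F' /\ e' = c'.
Proof.
move=> w cF'; have [cG _ _ _ _] := wall_spec D w; have [_ ae] := wall_attains D w.
by move=> E; exact: (slice_inj cG cF' ae E).
Qed.

Let wall_cell G e e' : W G e e' -> is_cell P G.
Proof. by move=> /(wall_spec D)[]. Qed.

Let refined_kept F c B : X F c -> refined (slice q c F) B ->
  exists G c', [/\ M F G, X G c', linked F c G c' & B = slice q c' G].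
Proof.
move=> Xc [[F1 [G [c1 [c' [MFG X1 X' L [E ->]]]]]]|[G [e [e' [w E _]]]]].
  have [FE cE] := kept_inj Xc (kept_cell D X1) E; subst F1 c1.
  by exists G, c'.
have [FE cE] := kept_inj Xc (wall_cell w) E; subst G e.
by case: (wall_not_kept D w).
Qed.

Let refined_kept' G c' A : X G c' -> refined A (slice q c' G) ->
  exists F c, [/\ M F G, X F c, linked F c G c' & A = slice q c F].
Proof.
move=> Xc [[F [G1 [c [c1 [MFG X1 X' L [-> E]]]]]]|[G1 [e [e' [w _ E]]]]].
  have [FE cE] := kept_inj Xc (kept_cell D X') E; subst G1 c1.
  by exists F, c.
have [FE cE] := kept_inj Xc (wall_cell w) E; subst G1 e'.
by case: (wall_not_kept D w).
Qed.

Let refined_wall G e e' B : W G e e' -> refined (slice q e G) B -> B = slice q e' G.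
Proof.
move=> w [[F [G1 [c [c1 [MFG X1 X' L [E _]]]]]]|[G1 [e1 [e1' [w1 E ->]]]]].
  have [FE cE] := wall_inj w (kept_cell D X1) E; subst F c.
  by case: (wall_not_kept D w).
have [FE cE] := wall_inj w (wall_cell w1) E; subst G1 e1.
by rewrite (wall_funL D w w1).
Qed.

Let refined_wall' G e e' A : W G e e' -> refined A (slice q e' G) -> A = slice q e G.
Proof.
move=> w [[F [G1 [c [c1 [MFG X1 X' L [_ E]]]]]]|[G1 [e1 [e1' [w1 -> E]]]]].
  have [FE cE] := wall_inj' w (kept_cell D X') E; subst G1 c1.
  by case: (wall_not_kept D w).
have [FE cE] := wall_inj' w (wall_cell w1) E; subst G1 e1'.
by rewrite (wall_funR D w w1).
Qed.

Let codim_kept F c : X F c -> codim Q (slice q c F) = (codim P F + ~~ flat P q F c)%N.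
Proof. by move=> Xc; apply: codim_slice; [exact: (kept_cell D Xc) | exact: (kept_attains D Xc)]. Qed.

(** A gradient path can stay among the walls of one cell only for finitely many
    steps, and it leaves them through kept slices, which follow the gradient paths
    of [M].  Flat kept slices are treated first: a path from one of them never
    reaches a kept slice that is not flat, because that slice would belong to the
    partner of a source of [M], and such a cell is not itself a source. *)
Let refined_acyclic : well_founded (gradient_step Q refined).
Proof.
pose acc := Acc (gradient_step Q refined).
have src_cases A : matched_up refined A ->
    (exists F c, [/\ matched_up M F, X F c & A = slice q c F]) \/
    (exists G e e', W G e e' /\ A = slice q e G).
  move=> [B [[F [G [c [c' [MFG X1 X' L [-> _]]]]]]|[G [e [e' [w -> _]]]]]].
    by left; exists F, c; split=> //; exists G.
  by right; exists G, e, e'.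
have slice_le1 F c G c' : is_cell P F -> is_cell P G -> attains q F c -> attains q G c' ->
    face_le (slice q c F) (slice q c' G) -> face_le F G /\ code_le c c'.
  by move=> cF cG aF aG /(slice_le cF cG aF aG).
(* walls of [G], provided that every flat kept slice of a facet other than the
   partner of [G], and every kept wall of [G], are accessible *)
have walls G : is_cell P G ->
    (forall F c, matched_up M F -> X F c -> flat P q F c -> face_le F G ->
       codim P F = (codim P G).+1 -> ~ M F G -> acc (slice q c F)) ->
    (matched_up M G -> forall c, X G c -> ~~ flat P q G c -> acc (slice q c G)) ->
    forall e e', W G e e' -> acc (slice q e G).
  move=> cG flatF dropG e; elim: (wall_acyclic D G e) => {}e _ IHe e' w.
  constructor => A [B [MB srcA leAB neA rA]].
  have [re re'] := wall_codim w; rewrite re in rA; have [ae ae'] := wall_attains D w.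
  have [_ qG e2 e2' _] := wall_spec D w.
  rewrite (refined_wall w MB) in leAB.
  case: (src_cases A srcA) => [[F [c [srcF Xc AE]]]|[G1 [e1 [e1' [w1 AE]]]]].
    subst A; have cF := kept_cell D Xc; have aF := kept_attains D Xc.
    have [FG ce] := slice_le1 _ _ _ _ cF cG aF ae' leAB.
    move: rA; rewrite (codim_kept Xc); case: (boolP (flat P q F c)) => fl.
      rewrite addn0 => rF; apply: (flatF F c srcF Xc fl FG rF) => MFG.
      by have [_ []] := wall_not_kept D w; apply: (kept_facet D MFG Xc).
    rewrite addn1 => -[rF]; have FE : F = G.
      by apply: (face_le_codim_eq cF cG FG); rewrite rF.
    by subst F; apply: dropG.
  subst A; have cG1 := wall_cell w1; have [ae1 _] := wall_attains D w1.
  have [FG ce] := slice_le1 _ _ _ _ cG1 cG ae1 ae' leAB.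
  move: rA; have [-> _] := wall_codim w1; case=> rG.
  have GE : G1 = G by apply: (face_le_codim_eq cG1 cG FG); rewrite rG.
  subst G1; apply: (IHe e1 _ e1' w1); exists e', e1'; split=> // E.
  by apply: neA; rewrite E.
have stepA F : matched_up M F ->
    (forall c, X F c -> flat P q F c -> acc (slice q c F)) /\
    (forall G e e', M F G -> W G e e' -> acc (slice q e G)).
  elim: (matching_acyclic Mm F) => {}F _ IHF [G MFG].
  have cF := matching_cellL Mm MFG; have cG := matching_cellR Mm MFG.
  have rFG := matching_codim Mm MFG.
  have flatF F' c : matched_up M F' -> X F' c -> flat P q F' c -> face_le F' G ->
      codim P F' = (codim P G).+1 -> F' <> F -> acc (slice q c F').
    move=> srcF' Xc fl F'G rF' nF.
    have [|H _] := IHF F' _ srcF'; last exact: H.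
    by exists G; split=> //; rewrite rF' rFG.
  have wG e e' : W G e e' -> acc (slice q e G).
    apply: (walls G cG) => [F' c srcF' Xc fl F'G rF' nM|[H MGH]].
      by apply: (flatF F' c srcF' Xc fl F'G rF') => FE; apply: nM; rewrite FE.
    by case: (matching_disjoint Mm MFG MGH).
  split=> [c Xc fl|G' e e' MFG']; last by rewrite (matching_funL Mm MFG' MFG); exact: wG.
  constructor => A [B [MB srcA leAB neA rA]].
  have [G' [c' [MFG' Xc' L BE]]] := refined_kept Xc MB.
  have GE := matching_funL Mm MFG' MFG; subst G' B.
  have aG := kept_attains D Xc'.
  move: rA; rewrite (codim_kept Xc) fl addn0 => rA.
  case: (src_cases A srcA) => [[F' [c2 [srcF' Xc2 AE]]]|[G1 [e1 [e1' [w1 AE]]]]].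
    subst A; have cF' := kept_cell D Xc2; have aF' := kept_attains D Xc2.
    have [F'G ce] := slice_le1 _ _ _ _ cF' cG aF' aG leAB.
    move: rA; rewrite (codim_kept Xc2); case: (boolP (flat P q F' c2)) => fl2.
      rewrite addn0 => rF'; rewrite rFG in rF'.
      apply: (flatF F' c2 srcF' Xc2 fl2 F'G rF') => FE; subst F'.
      apply: neA; rewrite (kept_down_uniq D MFG Xc' Xc2 Xc _ L) //.
      by split; rewrite ?fl2 //; case: L => _ <-.
    rewrite addn1 rFG => -[rF'].
    have FE : F' = G by apply: (face_le_codim_eq cF' cG F'G); rewrite rF'.
    by subst F'; case: srcF' => H /(matching_disjoint Mm MFG).
  subst A; have cG1 := wall_cell w1; have [ae1 _] := wall_attains D w1.
  have [G1G ce] := slice_le1 _ _ _ _ cG1 cG ae1 aG leAB.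
  move: rA; have [-> _] := wall_codim w1; rewrite rFG => -[rG1].
  have GE : G1 = G by apply: (face_le_codim_eq cG1 cG G1G); rewrite rG1.
  by subst G1; exact: wG w1.
have stepB G : is_cell P G ->
    (matched_up M G -> forall c, X G c -> ~~ flat P q G c -> acc (slice q c G)) ->
    forall e e', W G e e' -> acc (slice q e G).
  move=> cG dropG; apply: (walls G cG) dropG => F c srcF Xc fl _ _ _.
  by have [H _] := stepA F srcF; exact: H.
have stepC F : matched_up M F -> forall c, X F c -> ~~ flat P q F c -> acc (slice q c F).
  elim: (matching_acyclic Mm F) => {}F _ IHF [G MFG] c Xc fl.
  have cF := matching_cellL Mm MFG; have cG := matching_cellR Mm MFG.
  have rFG := matching_codim Mm MFG.
  have c2 : (2 %| c)%Z by move: fl; rewrite /flat negb_or negbK => /andP[].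
  constructor => A [B [MB srcA leAB neA rA]].
  have [G' [c' [MFG' Xc' L BE]]] := refined_kept Xc MB.
  have GE := matching_funL Mm MFG' MFG; subst G' B.
  have c'c : c' = c.
    have : ~~ flat P q G c' by case: L => _ <-.
    rewrite /flat negb_or negbK => /andP[/dvdzP [n c'n] _].
    by case: L; rewrite c'n => /code_le_even -> _.
  subst c'; have aG := kept_attains D Xc'.
  move: rA; rewrite (codim_kept Xc) fl addn1 => rA.
  case: (src_cases A srcA) => [[F' [e [srcF' Xe AE]]]|[G1 [e1 [e1' [w1 AE]]]]].
    subst A; have cF' := kept_cell D Xe; have aF' := kept_attains D Xe.
    have [F'G ec] := slice_le1 _ _ _ _ cF' cG aF' aG leAB.
    have E : e = c by case/dvdzP: c2 ec => n -> /code_le_even.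
    subst e; move: rA; rewrite (codim_kept Xe); case: (boolP (flat P q F' c)) => fl2.
      by have := kept_flat_odd D Xc fl Xe fl2; rewrite c2.
    rewrite addn1 => -[rF']; apply: IHF => //; exists G; split=> // FE.
    by apply: neA; rewrite FE.
  subst A; have cG1 := wall_cell w1; have [ae1 _] := wall_attains D w1.
  have [G1G ec] := slice_le1 _ _ _ _ cG1 cG ae1 aG leAB.
  have E : e1 = c by case/dvdzP: c2 ec => n -> /code_le_even.
  move: rA; have [-> _] := wall_codim w1 => -[rG1].
  apply: (stepB G1 cG1 _ e1 e1' w1) => srcG1 c3 Xc3 fl3; apply: IHF => //.
  exists G; split=> // FE; subst G1 e1; by case: (wall_not_kept D w1).
move=> A; have [srcA|nsrc] := pselect (matched_up refined A); last first.
  by constructor => A' [B [MB _ _ _ _]]; case: nsrc; exists B.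
case: (src_cases A srcA) => [[F [c [srcF Xc ->]]]|[G [e [e' [w ->]]]]].
  case: (boolP (flat P q F c)) => fl; last exact: stepC.
  by have [H _] := stepA F srcF; exact: H.
apply: (stepB G (wall_cell w) _ e e' w) => srcG c Xc fl; exact: stepC.
Qed.

Theorem refined_matching : cell_matching Q refined.
Proof.
split; last exact: refined_acyclic.
- move=> A B [[F [G [c [c' [MFG X1 X' L [-> _]]]]]]|[G [e [e' [w -> _]]]]].
    exact: cell_kept.
  by have [a1 a2] := wall_attains D w; apply: slice_cell (wall_cell w) _.
- move=> A B [[F [G [c [c' [MFG X1 X' L [_ ->]]]]]]|[G [e [e' [w _ ->]]]]].
    exact: cell_kept.
  by have [a1 a2] := wall_attains D w; apply: slice_cell (wall_cell w) _.
- move=> A B [[F [G [c [c' [MFG X1 X' L [-> ->]]]]]]|[G [e [e' [w -> ->]]]]].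
    apply/(slice_le (kept_cell D X1) (kept_cell D X') (kept_attains D X1)
      (kept_attains D X')).
    by split; [exact: (matching_le Mm MFG) | case: L].
  have [cG _ _ _ ee] := wall_spec D w; have [a1 a2] := wall_attains D w.
  apply/(slice_le cG cG a1 a2); split=> //; exact: face_le_refl.
- move=> A B [[F [G [c [c' [MFG X1 X' L [-> ->]]]]]]|[G [e [e' [w -> ->]]]]].
    by rewrite (codim_kept X1) (codim_kept X') (matching_codim Mm MFG); case: L => _ ->.
  by have [-> ->] := wall_codim w.
- move=> A B B' [[F [G [c [c' [MFG X1 X' L [-> ->]]]]]]|[G [e [e' [w -> ->]]]]].
    move=> /(refined_kept X1) [G2 [c2 [MFG2 X2 L2 ->]]].
    have GE := matching_funL Mm MFG2 MFG; subst G2.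
    by rewrite (kept_up_uniq D MFG X1 X' X2 L L2).
  by move=> /(refined_wall w) ->.
- move=> A A' B [[F [G [c [c' [MFG X1 X' L [-> ->]]]]]]|[G [e [e' [w -> ->]]]]].
    move=> /(refined_kept' X') [F2 [c2 [MFG2 X2 L2 ->]]].
    have FE := matching_funR Mm MFG2 MFG; subst F2.
    by rewrite (kept_down_uniq D MFG X' X1 X2 L L2).
  by move=> /(refined_wall' w) ->.
- move=> A B C [[F [G [c [c' [MFG X1 X' L [_ ->]]]]]]|[G [e [e' [w _ ->]]]]].
    move=> /(refined_kept X') [G2 [c2 [MGG2 _ _ _]]].
    exact: (matching_disjoint Mm MFG MGG2).
  move=> [[F [G1 [c [c1 [MFG X1 X' L [E _]]]]]]|[G1 [e1 [e1' [w1 E _]]]]].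
    have [FE cE] := wall_inj' w (kept_cell D X1) E; subst F c.
    by case: (wall_not_kept D w).
  have [FE cE] := wall_inj' w (wall_cell w1) E; subst G1 e1.
  by have [_ _ e2 _ _] := wall_spec D w1; have [_ _ _ /negP] := wall_spec D w.
- move=> A B v [[F [G [c [c' [MFG X1 X' L [-> ->]]]]]]|[G [e [e' [w -> ->]]]]].
    left; exists (translate v F), (translate v G), (c + zdot q.1 v * 2), (c' + zdot q.1 v * 2).
    split; [exact: (matching_translate Mm _ MFG)|exact: (kept_translate D _ X1)|
      exact: (kept_translate D _ X')| |].
      case: L => L1 L2; split.
        case: L1 => [->|[n [E1 E2]]]; [by left | right; exists (n + zdot q.1 v); lia].
      by rewrite (flat_translate _ _ _ (kept_cell D X1)) (flat_translate _ _ _ (kept_cell D X')).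
    by rewrite !translate_slice.
  right; exists (translate v G), (e + zdot q.1 v * 2), (e' + zdot q.1 v * 2).
  by rewrite !translate_slice; split=> //; exact: (wall_translate D _ w).
Qed.

Theorem refined_critical A : critical_cell Q refined A <->
  exists F c, [/\ critical_cell P M F, X F c & A = slice q c F].
Proof.
split=> [[/cell_slice [F [c [cF aF ->]]] nup ndown]|[F [c [[cF nup ndown] Xc ->]]]].
  exists F, c; have [Xc|nX] := pselect (X F c); last first.
    have qF : ~~ constant P q F by apply/negP => qF; apply: nX; exact: kept_constant.
    have [e [w|w]] := wall_total D cF qF aF nX.
      by case: nup; exists (slice q e F); right; exists F, c, e.
    by case: ndown; exists (slice q e F); right; exists F, e, c.
  split=> //; split=> // [[G MFG]|[E MEF]].
    have [c' [X' L]] := kept_up D MFG Xc.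
    by apply: nup; exists (slice q c' G); left; exists F, G, c, c'.
  have [c' [X' L]] := kept_down D MEF Xc.
  by apply: ndown; exists (slice q c' E); left; exists E, F, c', c.
split; first exact: cell_kept.
  by move=> [B /(refined_kept Xc) [G [c' [MFG _ _ _]]]]; apply: nup; exists G.
by move=> [B /(refined_kept' Xc) [G [c' [MFG _ _ _]]]]; apply: ndown; exists G.
Qed.

End Refinement.
End Matchings.

(** * Adding a dependent family of hyperplanes *)

Section Instances.
Context {R : realType} {d : nat}.
Local Notation V := 'rV[R]_d.
Local Notation "v %:V" := (map_mx intr v : V) (at level 2, format "v %:V").
Implicit Types (P : seq ('rV[int]_d * R)) (F G : set V) (M : set V -> set V -> Prop).

(** Counts the orbits of critical cells of codimension [c - a] under the lattice; the
    offset [a] expresses that there are none when [c < a]. *)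
Definition critical_count P M a c n := exists rep : 'I_n -> set V,
  [/\ forall i, critical_cell P M (rep i) /\ (codim P (rep i) + a = c)%N,
      forall i j v, rep i = translate v (rep j) -> i = j
    & forall F, critical_cell P M F -> (codim P F + a = c)%N ->
        exists i v, F = translate v (rep i)].

Lemma int_min (K : int -> Prop) lo : (exists c, K c) -> (forall c, K c -> lo <= c) ->
  exists c, K c /\ forall c', K c' -> c <= c'.
Proof.
move=> [c0 Kc0] Klo; have [n] := ubnP `|c0 - lo|%N.
elim: n => // n IHn in c0 Kc0 *; rewrite ltnS => cn.
have [[c' [Kc' c'c]]|nex] := pselect (exists c', K c' /\ c' < c0).
  by apply: (IHn c') => //; have := Klo _ Kc'; lia.
exists c0; split=> // c' Kc'; rewrite leNgt; apply/negP => c'c.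
by apply: nex; exists c'.
Qed.

Lemma cell_pairing_bounded P F p : is_cell P F -> p \in P ->
  exists B : R, forall y, F y -> `|pairing p.1 y| <= B.
Proof.
move=> [x ->] pP; have H (r : R) : exists B : R, forall s, code s = code r -> `|s| <= B.
  case: (codeP r) => n _.
    by exists `|n%:~R| => s /code_even ->.
  exists (`|n%:~R| + 1) => s /code_odd/andP[a b].
  by rewrite ler_norml; have := ler_norm (n%:~R : R);
    have := ler_norm (- n%:~R : R); rewrite normrN => ? ?; apply/andP; split; lra.
have [B HB] := H (pairing p.1 x - p.2); exists (B + `|p.2|) => y /(_ p pP) /HB yB.
by rewrite -(subrK p.2 (pairing p.1 y)) (le_trans (ler_normD _ _)) // lerD2r.
Qed.

Section Dependent.
Variables (P : seq ('rV[int]_d * R)) (q : 'rV[int]_d * R).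
Variables (M : set V -> set V -> Prop) (Mm : cell_matching P M).
Hypothesis dependent : (rat_row q.1 <= rat_span (map fst P))%MS.

(** A dependent form is a combination of the forms of [P], each of which stays in an
    interval of length 1 on a cell. *)
Lemma attains_bounded F : is_cell P F ->
  exists lo hi, forall c, attains q F c -> lo <= c <= hi.
Proof.
move=> cF; have [b /mapP[p pP ->]|B HB] := rat_span_bounded (F := F) _ dependent.
  exact: cell_pairing_bounded cF pP.
exists (code (- B - q.2)), (code (B - q.2)) => c [y [Fy <-]].
have := HB y Fy; rewrite ler_norml => /andP[a b].
by apply/andP; split; apply: code_mono; rewrite lerD2r.
Qed.

Definition lowest F c := attains q F c /\ forall c', attains q F c' -> c <= c'.

Lemma lowest_ex F : is_cell P F -> exists c, lowest F c.
Proof.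
move=> cF; have [lo [hi H]] := attains_bounded cF.
apply: (@int_min _ lo) (attains_ex q cF) _ => c /H /andP[].
by [].
Qed.

Lemma lowest_uniq F c c' : lowest F c -> lowest F c' -> c = c'.
Proof. by move=> [a H] [a' H']; apply/eqP; rewrite eq_le H // H'. Qed.

Lemma lowest_flat F c : is_cell P F -> lowest F c -> flat P q F c.
Proof.
move=> cF [a H]; rewrite /flat; case: (boolP (2 %| c)%Z) => //= /dvdzP [n cE].
apply/negPn/negP => qF; rewrite cE in a H.
by have [_ /H] := attains_neighbours cF qF a; lia.
Qed.

Lemma lowest_translate F c v : lowest F c ->
  lowest (translate v F) (c + zdot q.1 v * 2).
Proof.
move=> [a H]; split=> [|c' a']; first exact: attains_translate.
have := attains_translate (- v) a'; rewrite translateK => /H.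
by rewrite zdotN; lia.
Qed.

(** A target of the matching keeps the slab that contains the lowest slab of its
    source in its closure; every other cell keeps its lowest slab.  This choice is
    invariant under translations and respects the matching. *)
Definition selected F c :=
  (exists E e, [/\ M E F, lowest E e, code_le e c & attains q F c]) \/
  (~ matched_down M F /\ lowest F c).

Lemma selected_attains F c : selected F c -> attains q F c.
Proof. by case=> [[E [e []]]|[_ []]]. Qed.

Lemma selected_ex F : is_cell P F -> exists c, selected F c.
Proof.
move=> cF; have [[E MEF]|nF] := pselect (matched_down M F); last first.
  by have [c H] := lowest_ex cF; exists c; right.
have cE := matching_cellL Mm MEF; have [e H] := lowest_ex cE.
have [c [aF ec]] := attains_le cE cF (matching_le Mm MEF) H.1.
by exists c; left; exists E, e.
Qed.

Lemma selected_flat F c : is_cell P F -> selected F c -> flat P q F c.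
Proof.
move=> cF [[E [e [MEF H ec aF]]]|[_ H]]; last exact: lowest_flat.
rewrite /flat; case: (boolP (2 %| c)%Z) => //= /dvdzP [n cE]; subst c.
apply/negPn/negP => qF; have cE := matching_cellL Mm MEF.
have := lowest_flat cE H; rewrite (code_le_even ec) /flat dvdz_mull //= => qE.
apply: (facet_attains cE cF (matching_le Mm MEF) (matching_codim Mm MEF) qE qF) aF.
by rewrite -(code_le_even ec); case: H.
Qed.

(** When the source lies inside a hyperplane of [q], two slabs of the target touching
    it would lie on both sides of that hyperplane, which [facet_attains]
    excludes. *)
Lemma selected_uniq F c c' : is_cell P F -> selected F c -> selected F c' -> c = c'.
Proof.
move=> cF S S'; have := selected_flat cF S; have := selected_flat cF S'.
case: S S' => [[E [e [MEF H ec aF]]]|[nF H]]; last first.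
  case=> [[E [e' [MEF _ _ _]]]|[_ H']]; first by case: nF; exists E.
  by move=> _ _; exact: lowest_uniq H H'.
case=> [[E' [e' [MEF' H' ec' aF']]]|[nF _]]; last by case: nF; exists E.
have EE := matching_funR Mm MEF' MEF; subst E'.
have ee := lowest_uniq H' H; subst e'.
case: (boolP (constant P q F)) => qF.
  by move=> _ _; exact: constant_attains qF aF aF'.
rewrite /flat (negPf qF) !orbF => o o'; have cE := matching_cellL Mm MEF.
have [[n eE]|[n eE]] := int_parity e; last first.
  by rewrite eE in ec ec'; rewrite (code_le_odd ec) (code_le_odd ec').
have qE : constant P q E.
  by have := lowest_flat cE H; rewrite eE /flat dvdz_mull.
have aE : attains q E (n * 2) by rewrite -eE; case: H.
have nF := facet_attains cE cF (matching_le Mm MEF) (matching_codim Mm MEF) qE qF aE.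
have near r : ~~ (2 %| r)%Z -> code_le e r -> r = n * 2 + 1 \/ r = n * 2 - 1.
  by move=> ro [E1|[k [E1 E2]]]; [move: ro; rewrite -E1 eE dvdz_mull | lia].
have {o o'} [H1 H2] := (near _ o' ec, near _ o ec').
have [lt|gt|//] := ltgtP c c'.
  case: nF; apply: (attains_between cF aF aF').
  by lia.
case: nF; apply: (attains_between cF aF' aF).
by lia.
Qed.

Lemma matched_down_translate F v : matched_down M (translate v F) -> matched_down M F.
Proof.
move=> [E ME]; exists (translate (- v) E).
by have := matching_translate Mm (- v) ME; rewrite translateK.
Qed.

Lemma selected_translate F c v : selected F c ->
  selected (translate v F) (c + zdot q.1 v * 2).
Proof.
case=> [[E [e [MEF H ec aF]]]|[nF H]]; last first.
  by right; split; [move=> /matched_down_translate | exact: lowest_translate].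
left; exists (translate v E), (e + zdot q.1 v * 2); split.
- exact: (matching_translate Mm v MEF).
- exact: lowest_translate.
- case: ec => [->|[n [E1 E2]]]; [by left | right; exists (n + zdot q.1 v); lia].
exact: attains_translate.
Qed.

Definition selected_cell F c := is_cell P F /\ selected F c.

(** Every wall is matched with its neighbour on the side away from the kept slab. *)
Definition selected_wall G e e' := [/\ is_cell P G, ~~ constant P q G, (2 %| e)%Z,
  attains q G e & exists r, selected G r /\ (e < r /\ e' = e - 1 \/ r < e /\ e' = e + 1)].

Let selected_source F G c : M F G -> selected F c -> lowest F c.
Proof.
move=> MFG [[E [e [MEF _ _ _]]]|[]//].
by case: (matching_disjoint Mm MEF MFG).
Qed.

Let selected_link F G c c' : M F G -> selected F c -> selected G c' ->
  linked P q F c G c'.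
Proof.
move=> MFG S S'; have cF := matching_cellL Mm MFG; have cG := matching_cellR Mm MFG.
split; last by rewrite (selected_flat cF S) (selected_flat cG S').
case: S' => [[E [e [MEG H ec _]]]|[nG _]]; last by case: nG; exists F.
have EE := matching_funR Mm MEG MFG; subst E.
by rewrite (lowest_uniq (selected_source MFG S) H).
Qed.

Lemma selected_data : refinement_data P q M selected_cell selected_wall.
Proof.
split.
- by move=> F c [].
- by move=> F c [_ /selected_attains].
- move=> F c cF qF aF; split=> //; have [r S] := selected_ex cF.
  by rewrite (constant_attains cF qF aF (selected_attains S)).
- move=> F G c MFG [cF S]; have cG := matching_cellR Mm MFG.
  by have [c' S'] := selected_ex cG; exists c'; split=> //; exact: selected_link.
- move=> F G c' MFG [cG S']; have cF := matching_cellL Mm MFG.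
  by have [c S] := selected_ex cF; exists c; split=> //; exact: selected_link.
- by move=> F G c c1 c2 _ _ [cG S1] [_ S2] _ _; exact: selected_uniq S1 S2.
- by move=> F G c c1 c2 _ _ [cF S1] [_ S2] _ _; exact: selected_uniq S1 S2.
- move=> F G c e MFG [cF S] _ aG _ ce; split; first exact: (matching_cellR Mm MFG).
  by left; exists F, c; split=> //; exact: (selected_source MFG S).
- by move=> F c [cF S]; rewrite (selected_flat cF S).
- move=> F c v [cF S]; split; first exact: is_cell_translate.
  exact: selected_translate.
- move=> G e e' [cG qG e2 aG [r [_ H]]]; split=> //; first by lia.
  case: H => -[_ ->]; right.
    by exists ((e %/ 2)%Z - 1); lia.
  by exists (e %/ 2)%Z; lia.
- move=> G e e' [cG qG /dvdzP [n eE] aG [r [_ H]]]; subst e; split=> //.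
  have [up dn] := attains_neighbours cG qG aG.
  by case: H => -[_ ->].
- move=> G e e' [cG qG e2 aG [r [S H]]].
  by split=> -[_ S']; have := selected_uniq cG S S'; lia.
- move=> G e e1 e2 [cG _ _ _ [r [S H]]] [_ _ _ _ [r' [S' H']]].
  by have := selected_uniq cG S S'; lia.
- move=> G e e1 e2 [cG _ d1 _ [r [S H]]] [_ _ d2 _ [r' [S' H']]].
  by have rr := selected_uniq cG S S'; lia.
- move=> G c cG qG aG nX; have [r S] := selected_ex cG.
  have ro : ~~ (2 %| r)%Z by have := selected_flat cG S; rewrite /flat (negPf qG) orbF.
  have ar := selected_attains S.
  have cr : c != r by apply/eqP => cr; apply: nX; rewrite cr.
  case: (boolP (2 %| c)%Z) => c2.
    have [lt|gt|] := ltgtP c r; last by move=> E; rewrite E eqxx in cr.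
      by exists (c - 1); left; split=> //; exists r; split=> //; left.
    by exists (c + 1); left; split=> //; exists r; split=> //; right.
  have [lt|gt|] := ltgtP c r; last by move=> E; rewrite E eqxx in cr.
    exists (c + 1); right; split=> //; first by lia.
      by apply: (attains_between cG aG ar); lia.
    by exists r; split=> //; left; lia.
  exists (c - 1); right; split=> //; first by lia.
    by apply: (attains_between cG ar aG); lia.
  by exists r; split=> //; right; lia.
- move=> G e e' v [cG qG e2 aG [r [S H]]]; split.
  + exact: is_cell_translate.
  + by rewrite constant_translate.
  + by lia.
  + exact: attains_translate.
  by exists (r + zdot q.1 v * 2); split; [exact: selected_translate | lia].
move=> G; have [cG|nG] := pselect (is_cell P G); last first.
  by move=> e; constructor => e2 [e' [e2' [[]]]].
have [lo [hi H]] := attains_bounded cG; have [r S] := selected_ex cG.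
have stepE e2 e : wall_step selected_wall G e2 e ->
    [/\ lo <= e2 <= hi & e < r /\ e2 = e - 2 \/ r < e /\ e2 = e + 2].
  move=> [e' [e2' [[_ _ de _ [r1 [S1 H1]]] [_ _ de2 a2 _] ce ne]]].
  split; first exact: H.
  have rr := selected_uniq cG S1 S; subst r1.
  case: ce => [E|[n [E1 E2]]]; first by lia.
  by move/eqP: ne; lia.
have down n e : e < r -> e < lo + n%:Z -> Acc (wall_step selected_wall G) e.
  elim: n e => [|n IHn] e er en; constructor => e2 /stepE[b1 b2]; first by lia.
  by apply: IHn; lia.
have up n e : r < e -> hi - n%:Z < e -> Acc (wall_step selected_wall G) e.
  elim: n e => [|n IHn] e er en; constructor => e2 /stepE[b1 b2]; first by lia.
  by apply: IHn; lia.
move=> e; have [lt|gt|E] := ltgtP e r.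
- by apply: (down (absz (e - lo + 1)) e) => //; lia.
- by apply: (up (absz (hi - e + 1)) e) => //; lia.
by constructor => e2 /stepE[_]; lia.
Qed.

Lemma dependent_step c n : critical_count P M 0 c n ->
  critical_count (q :: P) (refined P q M selected_cell selected_wall) 0 c n.
Proof.
move=> [rep [repC repI repS]].
have [r rS] := choice (fun i => selected_ex (let: And3 c _ _ := (repC i).1 in c)).
have cR i : is_cell P (rep i) by case: (repC i) => -[].
have cod F e : is_cell P F -> selected F e -> codim (q :: P) (slice q e F) = codim P F.
  move=> cF S; rewrite codim_slice //; last exact: selected_attains.
  by rewrite selected_flat // addn0.
have sc i := (selected_attains (rS i)).
exists (fun i => slice q (r i) (rep i)); split.
- move=> i /=; have [Ci <-] := repC i; split; last by rewrite (cod _ _ (cR i) (rS i)).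
  have H := refined_critical selected_data (slice q (r i) (rep i)).
  by apply/H; exists (rep i), (r i); split.
- move=> i j v; rewrite translate_slice.
  move=> /(slice_inj (cR i) (is_cell_translate v (cR j)) (sc i)) [E _].
  exact: repI E.
- move=> A /(refined_critical selected_data) [F [e [CF [cF S] ->]]].
  rewrite (cod _ _ cF S) => cc; have [i [v FE]] := repS F CF cc.
  exists i, v; rewrite translate_slice -FE; congr (slice q _ _).
  apply: (selected_uniq cF S); rewrite FE; exact: selected_translate.
Qed.

End Dependent.
End Instances.

(** * Adding an independent family of hyperplanes *)

Section Independent.
Context {R : realType} {d : nat}.
Local Notation V := 'rV[R]_d.
Local Notation "v %:V" := (map_mx intr v : V) (at level 2, format "v %:V").
Implicit Types (F G : set V).

Variables (P : seq ('rV[int]_d * R)) (q : 'rV[int]_d * R).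
Variables (M : set V -> set V -> Prop) (Mm : cell_matching P M).
Hypothesis independent : ~~ (rat_row q.1 <= rat_span (map fst P))%MS.

Definition stabilizer v := forall p, p \in P -> zdot p.1 v = 0.

Lemma stabilizerP F v : is_cell P F -> translate v F = F <-> stabilizer v.
Proof.
move=> [x ->]; rewrite translate_cell; split=> [E p pP|sv].
  have : cell P x (x + v%:V) by rewrite -E; exact: cell_refl.
  by move=> /(_ p pP); rewrite pcode_shift => /eqP;
    rewrite addrC -subr_eq0 addrK mulf_eq0 => /orP[/eqP|].
by apply: cell_eq => p pP; rewrite pcode_shift sv // mul0r addr0.
Qed.

Lemma free_direction : exists2 v, stabilizer v & zdot q.1 v != 0.
Proof.
have [v [vP qv]] := rat_span_complement independent; exists v => // p pP.
by apply: vP; exact: map_f.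
Qed.

(** The stabilizer moves the codes by the elements of a nonzero ideal, generated by
    its least positive element. *)
Lemma period_ex : exists m : int, [/\ 0 < m, exists2 v, stabilizer v & zdot q.1 v = m &
  forall v, stabilizer v -> (m %| zdot q.1 v)%Z].
Proof.
pose K m := 0 < m /\ exists2 v, stabilizer v & zdot q.1 v = m.
have stabN v : stabilizer v -> stabilizer (- v).
  by move=> sv p pP; rewrite zdotN sv // oppr0.
have [||m [[m0 [v0 sv0 qv0]] mmin]] := @int_min K 0; last 1 first.
- exists m; split=> //; first by exists v0.
  move=> v sv; have qm := divz_eq (zdot q.1 v) m.
  pose w := v + (- (zdot q.1 v %/ m)%Z) *: v0.
  have sw : stabilizer w.
    by move=> p pP; rewrite zdotD zdotZ sv // sv0 // mulr0 addr0.
  have qw : zdot q.1 w = (zdot q.1 v %% m)%Z.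
    by rewrite zdotD zdotZ qv0 {1}qm mulNr; ring.
  have := modz_ge0 (zdot q.1 v) (lt0r_neq0 m0); rewrite le_eqVlt => /orP[/eqP E|lt0].
    by apply/dvdzP; exists (zdot q.1 v %/ m)%Z; rewrite {1}qm -E addr0.
  have := mmin (zdot q.1 v %% m)%Z (conj lt0 (ex_intro2 _ _ w sw qw)).
  by rewrite leNgt ltz_pmod.
- have [v sv qv] := free_direction; have [lt|gt|E] := ltgtP 0 (zdot q.1 v).
  + by exists (zdot q.1 v); split=> //; exists v.
  + exists (- zdot q.1 v); split; first by rewrite oppr_gt0.
    by exists (- v); [exact: stabN | rewrite zdotN].
  by move: qv; rewrite -E eqxx.
by move=> c [/ltW].
Qed.

Lemma not_constant F : is_cell P F -> constant P q F = false.
Proof.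
move=> cF; apply/negP; rewrite /constant /constant_on => H.
move/negP: independent; apply; apply: submx_trans H (sub_rat_span _).
by move=> a /even_atP [p [n [pP -> _]]]; exact: map_f.
Qed.

Lemma flatE F c : is_cell P F -> flat P q F c = ~~ (2 %| c)%Z.
Proof. by move=> cF; rewrite /flat not_constant // orbF. Qed.

Lemma attains_all F c : is_cell P F -> attains q F c.
Proof.
move=> [x ->]; have [v sv qv] := free_direction.
have k0 : ((zdot q.1 v)%:~R : R) != 0 by rewrite intr_eq0.
pose t : R := (c%:~R / 2 - (pairing q.1 x - q.2)) / (zdot q.1 v)%:~R.
exists (x + t *: v%:V); split.
  by move=> p pP; rewrite /pcode pairingD pairingZ pairing_int sv // mulr0 addr0.
rewrite /pcode pairingD pairingZ pairing_int divfK // -[RHS](@code_half R).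
by congr code; ring.
Qed.

(** A choice of an odd code for each cell that commutes with translations; it is
    determined modulo twice the period. *)
Definition orbit_height F r := exists v,
  F = translate v (xget set0 (face_orbit F)) /\ r = 1 + zdot q.1 v * 2.

Lemma orbit_height_ex F : exists r, orbit_height F r.
Proof.
have : face_orbit F (xget set0 (face_orbit F)).
  by apply: (@xgetI _ _ _ F); exists 0 => //; exact: translate0.
move=> [v _ vF]; exists (1 + zdot q.1 (- v) * 2), (- v); split=> //.
by rewrite -{1}vF translateK.
Qed.

Lemma orbit_height_translate F r v : orbit_height F r ->
  orbit_height (translate v F) (r + zdot q.1 v * 2).
Proof.
move=> [u [FE ->]]; exists (v + u); split; last by rewrite zdotD; ring.
have -> : face_orbit (translate v F) = face_orbit F.
  by apply/esym/face_orbitP; exists v.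
by rewrite translateD -FE.
Qed.

Definition period : int := xget 1 [set m : int | [/\ 0 < m,
  exists2 v, stabilizer v & zdot q.1 v = m &
  forall v, stabilizer v -> (m %| zdot q.1 v)%Z]].

Let periodP : [/\ 0 < period, exists2 v, stabilizer v & zdot q.1 v = period &
  forall v, stabilizer v -> (period %| zdot q.1 v)%Z].
Proof. by have [m Hm] := period_ex; exact: (@xgetPex _ 1 [set m : int | _] (ex_intro _ m Hm)). Qed.

Let period_gt0 : 0 < period. Proof. by case: periodP. Qed.

Lemma orbit_height_uniq F r r' : is_cell P F -> orbit_height F r -> orbit_height F r' ->
  exists k : int, r - r' = k * (period * 2).
Proof.
move=> cF [u [FE ->]] [u' [FE' ->]].
have su : stabilizer (u - u').
  apply/(stabilizerP _ cF); rewrite {1}FE' -translateD subrK -FE //.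
have [_ _ /(_ _ su) /dvdzP [k]] := periodP; rewrite zdotD zdotN => E.
by exists k; rewrite mulrA -E; ring.
Qed.

Definition height F r := (exists2 E, M E F & orbit_height E r) \/
  (~ matched_down M F /\ orbit_height F r).

Lemma height_ex F : exists r, height F r.
Proof.
have [[E MEF]|nF] := pselect (matched_down M F).
  by have [r H] := orbit_height_ex E; exists r; left; exists E.
by have [r H] := orbit_height_ex F; exists r; right.
Qed.

Lemma height_odd F r : height F r -> exists n : int, r = n * 2 + 1.
Proof.
by case=> [[E _ [v [_ ->]]]|[_ [v [_ ->]]]]; exists (zdot q.1 v); rewrite addrC.
Qed.

Lemma height_translate F r v : height F r ->
  height (translate v F) (r + zdot q.1 v * 2).
Proof.
case=> [[E MEF H]|[nF H]]; last first.
  right; split; last exact: orbit_height_translate.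
  by move=> /(matched_down_translate Mm).
left; exists (translate v E); last exact: orbit_height_translate.
exact: (matching_translate Mm v MEF).
Qed.

Lemma height_uniq F r r' : is_cell P F -> height F r -> height F r' ->
  exists k : int, r - r' = k * (period * 2).
Proof.
move=> cF [[E MEF H]|[nF H]] [[E' MEF' H']|[nF' H']].
- have EE := matching_funR Mm MEF' MEF; subst E'.
  exact: orbit_height_uniq (matching_cellL Mm MEF) H H'.
- by case: nF'; exists E.
- by case: nF; exists E'.
exact: orbit_height_uniq cF H H'.
Qed.

Lemma height_matched F G r : M F G -> height F r <-> height G r.
Proof.
move=> MFG; split=> [[[E MEF _]|[_ H]]|[[E MEG H]|[nG _]]].
- by case: (matching_disjoint Mm MEF MFG).
- by left; exists F.
- have EE := matching_funR Mm MEG MFG; subst E; right; split=> // -[E MEF].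
  exact: (matching_disjoint Mm MEF MFG).
by case: nG; exists F.
Qed.

(** Modulo the stabilizer, slabs and walls alternate around a circle.  The slab at
    height [r] and the wall just below it are kept. *)
Definition periodic_cell F c := is_cell P F /\ exists r, height F r /\
  exists k : int, c - r = k * (period * 2) \/ c - r + 1 = k * (period * 2).

(** Every other wall is matched with the slab just above it. *)
Definition periodic_wall G e e' :=
  [/\ is_cell P G, (2 %| e)%Z, ~ periodic_cell G e & e' = e + 1].

Lemma periodic_cellP F r c : is_cell P F -> height F r ->
  periodic_cell F c <->
  exists k : int, c - r = k * (period * 2) \/ c - r + 1 = k * (period * 2).
Proof.
move=> cF H; split=> [[_ [r' [H' [k kE]]]]|[k kE]]; last first.
  by split=> //; exists r; split=> //; exists k.
have [l lE] := height_uniq cF H' H; exists (k + l); rewrite mulrDl.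
by case: kE => E; [left|right]; rewrite -E -lE; ring.
Qed.

Lemma periodic_matched F G c : M F G -> periodic_cell F c <-> periodic_cell G c.
Proof.
move=> MFG; have cF := matching_cellL Mm MFG; have cG := matching_cellR Mm MFG.
have [r H] := height_ex F; have HG : height G r by apply/(height_matched _ MFG).
by rewrite (periodic_cellP _ cF H) (periodic_cellP _ cG HG).
Qed.

Lemma even_multiple (k : int) : exists l : int, k * (period * 2) = l * 2.
Proof. by exists (k * period); rewrite mulrA. Qed.

Lemma periodic_linked F G c c' : is_cell P F -> is_cell P G ->
  linked P q F c G c' -> c = c'.
Proof.
move=> cF cG [cc]; rewrite !flatE //.
have [[n E]|[n E]] := int_parity c'; first by subst c'; move: cc => /code_le_even.
case: cc => [//|[k [E1 E2]]]; by lia.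
Qed.

Lemma periodic_data : refinement_data P q M periodic_cell periodic_wall.
Proof.
have keep_le F G c : M F G -> periodic_cell F c ->
    exists c', periodic_cell G c' /\ linked P q F c G c'.
  move=> MFG Xc; exists c; split; first by apply/(periodic_matched _ MFG).
  split; first exact: code_le_refl.
  by rewrite !flatE //; [exact: (matching_cellR Mm MFG) | exact: (matching_cellL Mm MFG)].
split.
- by move=> F c [].
- by move=> F c [cF _]; exact: attains_all.
- by move=> F c cF; rewrite not_constant.
- exact: keep_le.
- move=> F G c MFG Xc; exists c; split; first by apply/(periodic_matched _ MFG).
  split; first exact: code_le_refl.
  by rewrite !flatE //; [exact: (matching_cellR Mm MFG) | exact: (matching_cellL Mm MFG)].
- move=> F G c c1 c2 MFG [cF _] [cG _] _ L1 L2.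
  by rewrite -(periodic_linked cF cG L1) -(periodic_linked cF cG L2).
- move=> F G c c1 c2 MFG [cG _] [cF _] _ L1 L2.
  by rewrite (periodic_linked cF cG L1) (periodic_linked cF cG L2).
- move=> F G c e MFG Xc; have [cF _] := Xc; rewrite flatE // => co _ _ ce.
  suff -> : e = c by apply/(periodic_matched _ MFG).
  by case: ce => [//|[k [E1 E2]]]; lia.
- by move=> F c _ _ F' c' [cF' _]; rewrite flatE.
- move=> F c v [cF [r [H [k kE]]]]; split; first exact: is_cell_translate.
  exists (r + zdot q.1 v * 2); split; first exact: height_translate.
  by exists k; case: kE => <-; [left|right]; ring.
- move=> G e e' [cG /dvdzP [n eE] _ ->]; split=> //.
  + by rewrite not_constant.
  + by rewrite eE dvdz_mull.
  + by lia.
  by right; exists n; lia.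
- by move=> G e e' [cG _ _ _]; split; exact: attains_all.
- move=> G e e' [cG e2 nX ->]; split=> //.
  have [r H] := height_ex G; have [n rE] := height_odd H.
  move=> /(periodic_cellP _ cG H) [k kE]; apply: nX; apply/(periodic_cellP _ cG H).
  exists k; have [l lE] := even_multiple k; rewrite lE in kE *.
  by right; lia.
- by move=> G e e1 e2 [_ _ _ ->] [_ _ _ ->].
- by move=> G e e1 e2 [_ _ _ ->] [_ _ _]; lia.
- move=> G c cG _ _ nX; case: (boolP (2 %| c)%Z) => c2.
    by exists (c + 1); left.
  exists (c - 1); right; split=> //; first by lia.
    have [r H] := height_ex G; have [n rE] := height_odd H.
    move=> /(periodic_cellP _ cG H) [k kE]; apply: nX; apply/(periodic_cellP _ cG H).
    exists k; have [l lE] := even_multiple k; rewrite lE in kE *.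
    by left; lia.
  by rewrite subrK.
- move=> G e e' v [cG e2 nX ->]; split.
  + exact: is_cell_translate.
  + by lia.
  + have [r H] := height_ex G.
    have H' := height_translate v H; have cG' := is_cell_translate v cG.
    move=> /(periodic_cellP _ cG' H') [k kE]; apply: nX; apply/(periodic_cellP _ cG H).
    by exists k; case: kE => <-; [left|right]; ring.
  by ring.
move=> G; have [cG|nG] := pselect (is_cell P G); last first.
  by move=> e; constructor => e2 [e' [e2' [[]]]].
have [r H] := height_ex G; have [n rE] := height_odd H.
have stepE e2 e : wall_step periodic_wall G e2 e ->
    [/\ (2 %| e)%Z, e2 = e + 2 & ~ periodic_cell G e].
  move=> [e' [e2' [[_ de nX ->] [_ de2 _ _] ce ne]]]; split=> //.
  by move/eqP: ne; case: ce => [E|[k [E1 E2]]]; lia.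
suff acc (s : nat) : forall (k : int) e, r - 1 - e = k * (period * 2) + s%:Z ->
    Acc (wall_step periodic_wall G) e.
  move=> e; set D := r - 1 - e; pose m := period * 2.
  have m0 : m != 0 by apply: lt0r_neq0; exact: mulr_gt0.
  apply: (acc (absz (D %% m)%Z) (D %/ m)%Z e).
  by rewrite (gez0_abs (modz_ge0 D m0)) -divz_eq.
elim/ltn_ind: s => s IHs k e sE; constructor => e2 /stepE [de -> nX].
have [l lE] := even_multiple k; rewrite lE in sE.
case: s sE IHs => [|[|s]] sE IHs.
- case: nX; apply/(periodic_cellP _ cG H); exists (- k); right.
  by rewrite mulNr lE; lia.
- by exfalso; move: de => /dvdzP [j jE]; lia.
by apply: (IHs s _ k) => //; rewrite lE; lia.
Qed.

Let codim_periodic F c : periodic_cell F c ->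
  codim (q :: P) (slice q c F) = (codim P F + (2 %| c)%Z)%N.
Proof.
move=> [cF _]; rewrite codim_slice //; last exact: attains_all.
by rewrite flatE // negbK.
Qed.

(** A critical cell of codimension [c] keeps one orbit of slabs, of codimension [c],
    and one of walls, of codimension [c + 1]. *)
Lemma independent_step c n n' :
  critical_count P M 0 c n -> critical_count P M 1 c n' ->
  critical_count (q :: P) (refined P q M periodic_cell periodic_wall) 0 c (n + n').
Proof.
move=> [rep [repC repI repS]] [rep' [repC' repI' repS']].
have [h hP] := choice (fun F => height_ex F).
have repcell i : is_cell P (rep i) by case: (repC i) => -[].
have repcell' i : is_cell P (rep' i) by case: (repC' i) => -[].
have X1 F : is_cell P F -> periodic_cell F (h F).
  by move=> cF; split=> //; exists (h F); split=> //; exists 0; left; rewrite mul0r subrr.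
have X2 F : is_cell P F -> periodic_cell F (h F - 1).
  by move=> cF; split=> //; exists (h F); split=> //; exists 0; right; rewrite mul0r; ring.
have h2 F : (2 %| h F)%Z = false by have [k ->] := height_odd (hP F); lia.
have h2' F : (2 %| h F - 1)%Z by have [k ->] := height_odd (hP F); lia.
have sE F F' v e e' : is_cell P F -> is_cell P F' ->
    slice q e F = translate v (slice q e' F') -> F = translate v F'.
  move=> cF cF'; rewrite translate_slice.
  by move=> /(slice_inj cF (is_cell_translate v cF') (attains_all e cF)) [].
(* two kept codes of the same parity differ by the action of the stabilizer *)
have move_code F F' v e e' : is_cell P F' -> F = translate v F' -> periodic_cell F e ->
    periodic_cell F' e' -> (2 %| e)%Z = (2 %| e')%Z ->
    exists u, slice q e F = translate u (slice q e' F').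
  move=> cF' FE Xe Xe' par; have [r H] := height_ex F'.
  have cF : is_cell P F by rewrite FE; exact: is_cell_translate.
  have H' : height F (r + zdot q.1 v * 2) by rewrite FE; exact: height_translate.
  have [k1 E1] := (periodic_cellP _ cF H').1 Xe.
  have [k2 E2] := (periodic_cellP _ cF' H).1 Xe'.
  have [w sw wE] : exists2 w, stabilizer w & zdot q.1 w = period by case: periodP.
  exists (v + (k1 - k2) *: w); rewrite translate_slice; congr slice.
    rewrite zdotD zdotZ wE mulrDl.
    have -> : (k1 - k2) * period * 2 = k1 * (period * 2) - k2 * (period * 2) by ring.
    have [l1 L1] := even_multiple k1; have [l2 L2] := even_multiple k2.
    by rewrite L1 L2 in E1 E2 *; lia.
  rewrite FE translateD; congr translate; apply/esym/(stabilizerP _ cF') => p pP.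
  by rewrite zdotZ sw // mulr0.
pose R0 (i : 'I_(n + n')) : set V := match fintype.split i with
  | inl i => slice q (h (rep i)) (rep i)
  | inr j => slice q (h (rep' j) - 1) (rep' j) end.
exists R0; split.
- move=> i; rewrite /R0; case: (fintype.split i) => j.
    have [Cj cj] := repC j; split.
      by apply/(refined_critical periodic_data); exists (rep j), (h (rep j)); split=> //; exact: X1.
    by rewrite codim_periodic ?h2; [rewrite addn0 | exact: X1].
  have [Cj cj] := repC' j; split.
    by apply/(refined_critical periodic_data); exists (rep' j), (h (rep' j) - 1); split=> //; exact: X2.
  by rewrite codim_periodic ?h2'; [rewrite addn0 | exact: X2].
- move=> i j v; rewrite /R0 -{2}(splitK i) -{2}(splitK j).
  case: (fintype.split i) => i'; case: (fintype.split j) => j' /= E.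
  + by rewrite (repI _ _ _ (sE _ _ _ _ _ (repcell _) (repcell _) E)).
  + have E' := sE _ _ _ _ _ (repcell _) (repcell' _) E.
    have [_ c1] := repC i'; have [_ c2] := repC' j'.
    by move: c1; rewrite E' codim_translate // -c2 addn0 addn1 => /eqP; rewrite eqn_leq ltnn andbF.
  + have E' := sE _ _ _ _ _ (repcell' _) (repcell _) E.
    have [_ c1] := repC' i'; have [_ c2] := repC j'.
    by move: c1; rewrite E' codim_translate // -c2 addn0 addn1 => /eqP; rewrite eqn_leq ltnn.
  by rewrite (repI' _ _ _ (sE _ _ _ _ _ (repcell' _) (repcell' _) E)).
- move=> A /(refined_critical periodic_data) [F [e [CF Xe ->]]].
  rewrite (codim_periodic Xe) addn0; case: (boolP (2 %| e)%Z) => e2 cc.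
    have [i [v FE]] := repS' F CF cc.
    have [u uE] := move_code F (rep' i) v e (h (rep' i) - 1) (repcell' i) FE Xe (X2 _ (repcell' i))
      (etrans e2 (esym (h2' _))).
    exists (rshift n i), u; rewrite /R0 -[rshift _ _]/(unsplit (inr i)) unsplitK //.
  have [i [v FE]] := repS F CF cc.
  have [u uE] := move_code F (rep i) v e (h (rep i)) (repcell i) FE Xe (X1 _ (repcell i))
    (etrans (negbTE e2) (esym (h2 _))).
  by exists (lshift n' i), u; rewrite /R0 -[lshift _ _]/(unsplit (inl i)) unsplitK.
Qed.

End Independent.

Section Main.
Context {R : realType} {d : nat}.
Local Notation V := 'rV[R]_d.

(** Adding a dependent family changes neither the rank nor the number of critical
    cells, while an independent family raises the rank and acts on the numbers of
    critical cells by Pascal's rule. *)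
Theorem perfect_cell_matching (P : seq ('rV[int]_d * R)) :
  exists M : set V -> set V -> Prop, cell_matching P M /\
    forall c, critical_count P M 0 c 'C(\rank (rat_span (map fst P)), c).
Proof.
elim: P => [|q P [M [Mm Mc]]].
  exists (fun _ _ => False); split.
    split=> [F G []|F G []|F G []|F G []|F G G' []|F F' G []|F G H []|F G v []|F].
    by constructor => F' [G []].
  have all_cell F : is_cell [::] F -> F = setT :> set V.
    by move=> [x ->]; apply/seteqP; split=> // y _ p.
  have cT : is_cell [::] (setT : set V) by exists 0; apply/seteqP; split=> // y _ p.
  have codT : codim [::] (setT : set V) = 0%N.
    by rewrite (@codimE _ _ _ _ 0) // /crk /rat_span big_nil mxrank0.
  move=> c; rewrite /rat_span big_nil mxrank0 bin0n; case: c => [|c].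
    exists (fun=> setT); split.
    - by move=> i; split; [split=> // -[] | rewrite codT].
    - by move=> i j _ _; rewrite !ord1.
    by move=> F [/all_cell -> _ _] _; exists ord0, 0; rewrite translate0.
  exists (fun=> setT); split=> [[]//|[]//|F [/all_cell -> _ _]].
  by rewrite codT.
rewrite /= rank_rat_span_cons.
case: (boolP (rat_row q.1 <= rat_span (map fst P))%MS) => dep /=.
  exists (refined P q M (selected_cell P q M) (selected_wall P q M)); split.
    exact: (refined_matching Mm (selected_data Mm dep)).
  by move=> c; exact: dependent_step.
exists (refined P q M (periodic_cell P q M) (periodic_wall P q M)); split.
  exact: (refined_matching Mm (periodic_data Mm dep)).
case=> [|c].
  have H0 : critical_count P M 1 0 0.
    by exists (fun=> setT); split=> [[]//|[]//|F _]; rewrite addn1.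
  have := independent_step Mm dep (Mc 0%N) H0; rewrite !bin0; exact.
rewrite binS; apply: (independent_step Mm dep (Mc c.+1)).
have [rep [repC repI repS]] := Mc c; exists rep; split=> //.
  by move=> i; have [Ci <-] := repC i; split=> //; rewrite addn0 addn1.
by move=> F CF /eqP; rewrite addn1 eqSS => /eqP cF; apply: repS; rewrite ?addn0.
Qed.

End Main.

(** * Faces of the lifted arrangement are cells *)

Section FaceDimension.
Context {R : realType} {d : nat}.
Local Notation V := 'rV[R]_d.
Implicit Types (P : seq ('rV[int]_d * R)) (x y z : V).

(** Differences of points of a cell are annihilated by its equations, and small
    multiples of a basis of the common kernel can be added to [x]. *)
Lemma face_dim_cell P x : face_dim (cell P x) = (d - crk P x)%N.
Proof.
rewrite /crk; set S := rat_span (even_at P x).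
apply/eqP; rewrite eqn_leq; apply/andP; split.
  apply/bigmax_leqP => k /asboolP [y [M [yF MF /eqP Mfree]]].
  have kerM : (M <= kermx (map_mx (ratr : rat -> R) S)^T)%MS.
    rewrite sub_kermx; apply/eqP/matrixP => i j; rewrite [RHS]mxE mxE.
    have kill b : b \in even_at P x -> pairing b (row i M) = 0.
      move=> bx; have := MF i; rewrite -(even_at_cell yF) in bx.
      rewrite -(cell_eq yF) => yM.
      have := @cell_le_kill _ _ P y (y + row i M).
      rewrite [y + _]addrC addrK [_ + y]addrC; apply.
        by move=> p pP; rewrite (yM p pP); exact: code_le_refl.
      by rewrite (even_at_cell yM).
    rewrite -[RHS](rat_span_kill_row kill (row_sub j S)); apply: eq_bigr => l _.
    by rewrite !mxE mulrC.
  by rewrite -Mfree (leq_trans (mxrankS kerM)) // mxrank_ker mxrank_tr mxrank_map.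
have -> : (d - \rank S)%N = \rank (kermx S^T) by rewrite mxrank_ker mxrank_tr.
set N := row_base (kermx S^T).
have NS : S *m N^T = 0.
  apply: (can_inj trmxK); rewrite trmx_mul trmxK trmx0; apply/eqP.
  by rewrite -sub_kermx eq_row_base.
pose M := map_mx (ratr : rat -> R) N.
have kill i a : a \in even_at P x -> pairing a (row i M) = 0.
  move=> /mem_rat_span /submxP [D aE].
  have /matrixP/(_ 0 i) : rat_row a *m N^T = 0 by rewrite aE -mulmxA NS mulmx0.
  rewrite mxE [RHS]mxE => /(congr1 (ratr : rat -> R)); rewrite rmorph0 rmorph_sum /= => <-.
  by apply: eq_bigr => j _; rewrite !mxE rmorphM /= ratr_int.
have near0 : \forall t \near (0 : R), forall i, cell P x (x + t *: row i M).
  apply: (@filter_forall R _ (fun i t => cell P x (x + t *: row i M)) (nbhs (0 : R))) => i.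
  have [e e0 He] := cell_line (kill i).
  apply/nbhs_ballP; exists e => // t; rewrite -ball_normE /= sub0r normrN; exact: He.
have [e /= e0 He] := (nbhs_ballP _ _).1 near0.
have e2 : 0 < e / 2 by rewrite divr_gt0.
have Ht : ball 0 e (e / 2).
  by rewrite -ball_normE /= sub0r normrN gtr0_norm // ltr_pdivrMr // ltr_pMr // ltr1n.
have kd : (\rank (kermx S^T) < d.+1)%N by rewrite ltnS rank_leq_row.
apply: (@leq_bigmax_cond _ _ (fun k : 'I_d.+1 => k : nat) (Ordinal kd)).
apply/asboolP; exists x, ((e / 2) *: M); split; first exact: cell_refl.
  by move=> i; rewrite linearZ; exact: He.
by rewrite /row_free (mxrank_scale_nz _ (lt0r_neq0 e2)) mxrank_map; exact: row_base_free.
Qed.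

End FaceDimension.

Section Faces.
Context {R : realType} {d : nat}.
Local Notation V := 'rV[R]_d.
Implicit Types (P : seq ('rV[int]_d * R)) (x y z : V) (F G : set V).

Lemma closure_cellP P x y : closure (cell P y) x <-> cell_le P x y.
Proof.
split=> [cx|xy]; last by have /face_le_cellP := xy; apply; exact: cell_refl.
have [z [yz xz]] := cx _ (cell_le_near P x).
by move=> p pP; rewrite -(yz p pP); exact: xz.
Qed.

(** Nonvanishing is an open condition, and a small multiple of [a] itself makes the
    pairing with [a] nonzero. *)
Lemma generic_direction (s : seq 'rV[int]_d) : (forall a, a \in s -> a != 0) ->
  exists u : V, forall a, a \in s -> pairing a u != 0.
Proof.
elim: s => [|a s IHs] s0; first by exists 0.
have [b bs|u us] := IHs; first by apply: s0; rewrite inE bs orbT.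
have near_s : \forall z \near u, forall b, b \in s -> pairing b z != 0.
  elim: s us {IHs s0} => [_|b s IHs us].
    by apply: filterS (filterT) => z _.
  have /IHs H : forall c, c \in s -> pairing c u != 0.
    by move=> c cs; apply: us; rewrite inE cs orbT.
  have := us b (mem_head _ _) => bu.
  have e0 : 0 < `|pairing b u| by rewrite normr_gt0.
  have /(@cvgrPdist_lt R R^o)/(_ _ e0) := @pairing_continuous R d b u.
  apply: filterS2 H => z zs bz c; rewrite inE => /orP[/eqP ->|/zs //].
  by apply/eqP => E; move: bz; rewrite E subr0 ltxx.
have [au|] := boolP (pairing a u != 0).
  by exists u => b; rewrite inE => /orP[/eqP ->|/us].
rewrite negbK => /eqP au; pose w : V := map_mx intr a.
have [e e0 He] := line_near w near_s.
exists (u + (e / 2) *: w) => b; rewrite inE => /orP[/eqP ->|bs]; last first.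
  apply: He => //; rewrite gtr0_norm ?divr_gt0 //.
  by rewrite ltr_pdivrMr // ltr_pMr // ltr1n.
rewrite pairingD au add0r pairingZ; apply: mulf_neq0; first by rewrite lt0r_neq0 ?divr_gt0.
rewrite pairing_int intr_eq0; have := s0 a (mem_head _ _).
apply: contra => /eqP a0; apply/eqP/rowP => j; rewrite mxE.
have /(psumr_eq0P (fun i _ => sqr_ge0 (a 0 i))) : \sum_i a 0 i ^+ 2 = 0 by exact: a0.
by move=> /(_ j isT) /eqP; rewrite sqrf_eq0 => /eqP.
Qed.

Definition open_cell P y := forall p, p \in P -> ~~ (2 %| pcode p y)%Z.

Lemma open_cell_above P x : (forall p, p \in P -> p.1 != 0) ->
  exists2 y, open_cell P y & cell_le P x y.
Proof.
move=> P0; have [a /mapP[p pP ->]|u Hu] := @generic_direction (map fst P).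
  exact: P0.
have [e e0 He] := line_near u (cell_le_near P x).
have e2 : 0 < e / 2 by rewrite divr_gt0.
exists (x + (e / 2) *: u); last first.
  by apply: He; rewrite gtr0_norm // ltr_pdivrMr // ltr_pMr // ltr1n.
move=> p pP; have : code_le (pcode p x) (pcode p (x + (e / 2) *: u)).
  by apply: He pP; rewrite gtr0_norm // ltr_pdivrMr // ltr_pMr // ltr1n.
case=> [E|[n [-> _]]]; last by lia.
have [[n xn]|[n xn]] := int_parity (pcode p x); last by rewrite -E xn; lia.
have := pcode_even xn; rewrite E in xn; have := pcode_even xn.
rewrite pairingD pairingZ => /eqP + x1; rewrite -x1 -subr_eq0 addrAC subrr add0r mulf_eq0.
by rewrite gt_eqF //= (negPf (Hu _ (map_f fst pP))).
Qed.

Lemma affine_hull_pairing (Q : set V) a (r : R) : (forall z, Q z -> pairing a z = r) ->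
  forall y, affine_hull Q y -> pairing a y = r.
Proof.
move=> Qr y [n [p [c [Qp c1 ->]]]].
have -> : pairing a (\sum_i c i *: p i) = \sum_i c i * pairing a (p i).
  apply: (big_ind2 (fun (z : V) s => pairing a z = s)).
  - by rewrite /pairing big1 // => j _; rewrite mxE mulr0.
  - by move=> z1 s1 z2 s2 <- <-; rewrite pairingD.
  by move=> i _; rewrite pairingZ.
by under eq_bigr do rewrite Qr //; rewrite -mulr_suml c1 mul1r.
Qed.

Section ConvexPieces.
Variables (P : seq ('rV[int]_d * R)) (y : V) (X : set V).
Hypothesis y_open : open_cell P y.
Hypothesis X_flat : forall x z, X x -> cell P x z -> X z.
Let Q := closure (cell P y) `&` X.

(** A relative interior point can be pushed away from any other point of [Q] without
    leaving [Q]; if it lay on a hyperplane of the arrangement not containing [Q],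
    this would cross the hyperplane, although [Q] is on one side of it. *)
Lemma relative_interior_const x z p (n : int) : relative_interior Q x -> Q z -> p \in P ->
  pcode p x = n * 2 -> pairing p.1 z = n%:~R + p.2.
Proof.
move=> [Qx nQ] Qz pP pn; have xn := pcode_even pn.
have [e e0 He] := line_near (x - z) nQ.
pose t := e / 2; have t0 : 0 < t by rewrite divr_gt0.
have Qu : Q (x + t *: (x - z)).
  apply: He; first by rewrite gtr0_norm // ltr_pdivrMr // ltr_pMr // ltr1n.
  exists 2%N, (fun i => if i == ord0 then x else z), (fun i => if i == ord0 then 1 + t else - t).
  split=> [i||].
  - by case: (i == ord0).
  - by rewrite big_ord_recl big_ord1 /= addrK.
  rewrite big_ord_recl big_ord1 /= scalerDl scale1r scalerBr scaleNr addrA //.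
have le r : Q r -> code_le (pcode p r) (pcode p y) by case=> /closure_cellP/(_ p pP).
have [[k yk]|[k yk]] := int_parity (pcode p y).
  by have := y_open pP; rewrite yk dvdz_mull.
have bd r : Q r -> k%:~R + p.2 <= pairing p.1 r <= k%:~R + 1 + p.2.
  move=> /le; rewrite yk; case=> [/code_odd/andP[a b]|[j [E1 [E2|E2]]]].
  - by apply/andP; split; lra.
  - have -> : k = j by lia.
    by rewrite (pcode_even E2) lexx /= lerD2r lerDl ler01.
  have -> : k = j by lia.
  have E3 : pcode p r = (j + 1) * 2 by lia.
  by rewrite (pcode_even E3) intrD lexx andbT lerD2r lerDl ler01.
have := bd _ Qu; rewrite pairingD pairingZ pairingB => /andP[u1 u2].
have /andP[z1 z2] := bd _ Qz.
have nk : n = k \/ n = k + 1 by have := le _ Qx; rewrite pn yk => -[|[j [? ?]]]; lia.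
rewrite xn in u1 u2; case: nk => nk; subst n.
  have : t * (k%:~R + p.2 - pairing p.1 z) >= 0 by lra.
  by rewrite pmulr_rge0 // => ?; lra.
rewrite intrD in u1 u2 *; have : t * (k%:~R + 1 + p.2 - pairing p.1 z) <= 0 by lra.
by rewrite pmulr_rle0 // => ?; lra.
Qed.

Lemma cell_sub_piece x : Q x -> cell P x `<=` Q.
Proof.
move=> [/closure_cellP xy Xx] z xz; split; last exact: X_flat xz.
by apply/closure_cellP => p pP; rewrite (xz p pP); exact: xy.
Qed.

Lemma relative_interior_cell x : Q x ->
  (forall p (n : int) z, p \in P -> pcode p x = n * 2 -> Q z -> pairing p.1 z = n%:~R + p.2) ->
  cell P x `<=` relative_interior Q.
Proof.
move=> Qx Qconst z xz; split; first exact: cell_sub_piece Qx z xz.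
apply: filterS (cell_le_near P z) => v zv Av; apply: (cell_sub_piece Qx) => p pP.
have [[n xn]|[n xn]] := int_parity (pcode p x); last first.
  by have := zv p pP; rewrite xz // xn => /code_le_odd.
have vE := affine_hull_pairing (fun r => Qconst p n r pP xn) Av.
by rewrite xn /pcode vE addrK code_int.
Qed.

Lemma relative_interiorE x : relative_interior Q x -> relative_interior Q = cell P x.
Proof.
move=> rx; have [Qx _] := rx; apply/seteqP; split; last first.
  by apply: relative_interior_cell => // p n z pP xn Qz; exact: relative_interior_const rx Qz pP xn.
move=> z rz p pP; have [Qz _] := rz.
have [[n xn]|[n xn]] := int_parity (pcode p x).
  by rewrite xn /pcode (relative_interior_const rx Qz pP xn) addrK code_int.
have [[m zm]|[m zm]] := int_parity (pcode p z).
  by rewrite zm /pcode (relative_interior_const rz Qx pP zm) addrK code_int.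
have [/closure_cellP/(_ p pP) H1 _] := Qx; have [/closure_cellP/(_ p pP) H2 _] := Qz.
by move: H1 H2; rewrite xn zm => /code_le_odd -> /code_le_odd.
Qed.

End ConvexPieces.

Variable A : toric_arrangement R d.
Hypotheses (Ac : complexified A) (Ap : primitive A).

Definition angle (z : R[i]) : R := xget 0 [set t | exp2ipi t = z].

Definition lift_seq : seq ('rV[int]_d * R) :=
  [seq (p.1, angle p.2) | p <- enum_fset (toric_fset A)].

Lemma angleP p : p \in toric_fset A -> exp2ipi (angle p.2) = p.2.
Proof. by move=> /Ac /exp2ipi_surj; exact: (@xgetPex _ 0 [set t | exp2ipi t = p.2]). Qed.

Lemma lift_seq_neq0 p : p \in lift_seq -> p.1 != 0.
Proof.
move=> /mapP [r rA ->] /=; apply/eqP => r0.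
have /(_ 2%:Z 0) := Ap rA; rewrite scaler0 r0 => /(_ erefl) [].
  by [].
by [].
Qed.

Lemma lift_arrangementP H : lift_arrangement A H <->
  exists p n, p \in lift_seq /\ H = [set x | pcode p x = n * 2].
Proof.
have hE p n : [set x | pcode p x = n * 2] = hyperplane p.1 (n%:~R + p.2) :> set V.
  apply/seteqP; split=> x /=; first exact: pcode_even.
  by rewrite /hyperplane /= /pcode => ->; rewrite addrK code_int.
split=> [[a [t [At ->]]]|[p [n [/mapP [r rA ->] ->]]]].
  exists (a, angle (exp2ipi t)).
  have [n E] : exists n : int, t - angle (exp2ipi t) = n%:~R.
    by apply: exp2ipi_eq_int; rewrite (angleP At).
  exists n; split; last by rewrite hE /= -E subrK.
  by apply/mapP; exists (a, exp2ipi t).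
rewrite hE /=; exists r.1, (n%:~R + angle r.2); split=> //.
rewrite addrC exp2ipi_int (angleP rA); by case: r rA.
Qed.

Let P := lift_seq.

Lemma complementP x : (~` \bigcup_(H in lift_arrangement A) H) x <-> open_cell P x.
Proof.
split=> [nx p pP|ox [H /lift_arrangementP [p [n [pP ->]]] /= xn]].
  apply/negP => /dvdzP [n xn]; apply: nx.
  by exists [set y | pcode p y = n * 2] => //; apply/lift_arrangementP; exists p, n.
by have := ox p pP; rewrite xn dvdz_mull.
Qed.

Lemma chamber_cell y : open_cell P y ->
  connected_component (~` \bigcup_(H in lift_arrangement A) H) y = cell P y.
Proof.
move=> oy; set U := ~` _.
have Uy : U y by exact/complementP.
apply/seteqP; split=> z.
  move=> Kz p pP; have [[n yn]|[n yn]] := int_parity (pcode p y).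
    by have := oy p pP; rewrite yn dvdz_mull.
  have itv : is_interval (pairing p.1 @` connected_component U y).
    apply/connected_intervalP; apply: connected_continuous_connected.
      exact: component_connected.
    exact/continuous_subspaceT/pairing_continuous.
  have avoid (k : int) : ~ (pairing p.1 @` connected_component U y) (k%:~R + p.2).
    move=> [v /connected_component_sub Uv vk].
    have /(_ p pP) : open_cell P v by exact/complementP.
    by rewrite /pcode vk addrK code_int dvdz_mull.
  have Ky : connected_component U y y by exact: connected_component_refl.
  have /andP[y1 y2] := code_odd yn.
  rewrite yn; apply: code_itv; apply/andP; split; rewrite ltNge; apply/negP => zn.
    by apply: (avoid n); apply: (itv _ _ (imageP _ Kz) (imageP _ Ky)); apply/andP; split; lra.
  apply: (avoid (n + 1)); rewrite intrD.
  by apply: (itv _ _ (imageP _ Ky) (imageP _ Kz)); apply/andP; split; lra.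
move=> yz; pose path (t : R) := y + t *: (z - y).
have pc : continuous path.
  move=> t; apply: mx_continuous_at => i j.
  have -> : (fun t => path t i j) = (fun t => y i j + t * (z - y) i j).
    by apply/funext => s; rewrite !mxE.
  apply: contD; first exact: cst_continuous.
  by apply: contM; [move=> ?; apply | exact: cst_continuous].
exists (path @` `[0, 1]%classic); last by exists 1; rewrite /= ?in_itv /= ?ler01 ?lexx // /path scale1r addrC subrK.
split.
- by exists 0; rewrite /= ?in_itv /= ?ler01 ?lexx // /path scale0r addr0.
- move=> _ [t + <-]; rewrite /= in_itv /= => t01; apply/complementP.
  have : cell P y (path t) by apply: cell_convex (cell_is_cell P y) _ yz t01; exact: cell_refl.
  by move=> yt p pP; rewrite yt //; exact: oy.
apply: connected_continuous_connected; first exact: segment_connected.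
exact: continuous_subspaceT.
Qed.

Lemma flat_cell X x z : flats A X -> X x -> cell P x z -> X z.
Proof.
move=> [S SA <-] Xx xz H SH; have := Xx H SH.
have /lift_arrangementP [p [n [pP ->]]] := SA _ SH.
by rewrite /= xz.
Qed.

(** The relative interior of a face of a closed chamber is a single cell, and every
    cell arises from the open cell found by a generic perturbation, intersected with
    all hyperplanes through the cell. *)
Lemma facesP F : faces A F <-> is_cell P F.
Proof.
split=> [[[x Fx] [K [X [[y /complementP oy <-] AX FE]]]]|[x ->]].
  rewrite chamber_cell // in FE; exists x; rewrite FE.
  apply: relative_interiorE => //; last by rewrite -FE.
  by move=> v w; exact: flat_cell.
split; first by exists x.
have [y oy xy] := @open_cell_above P x lift_seq_neq0.
pose S := [set H | lift_arrangement A H /\ H x].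
have SA : S `<=` lift_arrangement A by move=> H [].
have AX : flats A (\bigcap_(H in S) H) by exists S.
exists (cell P y), (\bigcap_(H in S) H); split=> //.
  by exists y; [exact/complementP | exact: chamber_cell].
have Xc v w : (\bigcap_(H in S) H) v -> cell P v w -> (\bigcap_(H in S) H) w.
  exact: flat_cell.
apply/esym; apply: (relative_interiorE oy Xc).
suff sub : cell P x `<=` relative_interior (closure (cell P y) `&` \bigcap_(H in S) H).
  exact: sub (cell_refl x).
apply: (relative_interior_cell Xc).
  by split; [exact/closure_cellP | move=> H []].
move=> p n z pP xn [_ zX]; apply: pcode_even; apply: (zX [set v | pcode p v = n * 2]).
by split=> //; apply/lift_arrangementP; exists p, n.
Qed.

End Faces.

(** * The matching of the face category *)

Local Open Scope card_scope.
Lemma uniq4 (T : eqType) (a b c e : T) : a <> b -> a <> c -> a <> e -> b <> c ->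
  b <> e -> c <> e -> uniq [:: a; b; c; e].
Proof.
move=> /eqP ab /eqP ac /eqP ae /eqP bc /eqP be /eqP ce.
by rewrite /= !inE !negb_or ab ac ae bc be ce.
Qed.

Section PerfectMatching.
Context {R : realType} {d : nat}.
Local Notation V := 'rV[R]_d.
Variable A : toric_arrangement R d.
Hypotheses (Ac : complexified A) (Ap : primitive A) (Ae : essential A).
Local Notation P := (lift_seq A).
Local Notation C := (face_category Ac Ae).

Variables (M : set V -> set V -> Prop) (Mm : cell_matching P M).

Definition face_matching : set (mor C) :=
  [set m : face_mor A | exists F G, M F G /\ \val m = pair_orbit F G].

Let faceP F : faces A F <-> is_cell P F := facesP Ac Ap F.

Lemma orbit_sourceL F G F' G' : M F G -> M F' G' -> face_orbit F = face_orbit F' ->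
  pair_orbit F G = pair_orbit F' G'.
Proof.
move=> MFG MF' /face_orbitP [v F'E]; apply/pair_orbitP; exists v; split=> //.
by apply: (matching_funL Mm MF'); rewrite F'E; exact: (matching_translate Mm v MFG).
Qed.

Lemma orbit_targetR F G F' G' : M F G -> M F' G' -> face_orbit G = face_orbit G' ->
  pair_orbit F G = pair_orbit F' G'.
Proof.
move=> MFG MF' /face_orbitP [v G'E]; apply/pair_orbitP; exists v; split=> //.
by apply: (matching_funR Mm MF'); rewrite G'E; exact: (matching_translate Mm v MFG).
Qed.

Lemma orbit_source_target F G F' G' : M F G -> M F' G' -> face_orbit F <> face_orbit G'.
Proof.
move=> MFG MF' /face_orbitP [v G'E]; move: MF'; rewrite G'E => MF'.
exact: (matching_disjoint Mm MF' (matching_translate Mm v MFG)).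
Qed.

Lemma identity_orbit (m : mor C) F : \val (m : face_mor A) = pair_orbit F F ->
  is_identity m.
Proof.
move=> mE; exists (face_src (m : face_mor A)); apply: val_inj.
by rewrite mE; apply/esym/face_id_orbit; exact: face_src_orbit mE.
Qed.

(** The codimension drops by exactly one along a matched pair and by at least one
    along each nonidentity morphism. *)
Lemma face_matching_indecomposable m : face_matching m -> indecomposable m.
Proof.
move=> [F [G [MFG mE]]].
have cF := matching_cellL Mm MFG; have cG := matching_cellR Mm MFG.
have rFG := matching_codim Mm MFG.
split=> [[x mx]|[f [g [nf ng [F' [G' [H [[AF AG AH] [FG GH fE gE]]]]]]]]].
  have [F0 _ xE] := set_mem (valP (x : face_ob A)).
  have := face_id_orbit (esym xE); rewrite -[face_id _]/(idm x : face_mor A) -mx mE.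
  move=> /pair_orbitP [v [E1 E2]].
  have : codim P (translate v F) = codim P (translate v G) by rewrite -E1 -E2.
  rewrite !codim_translate // rFG => /eqP.
  by rewrite eqn_leq ltnn.
rewrite mE => /pair_orbitP [v [F'E HE]].
have cF' := (faceP _).1 AF; have cG' := (faceP _).1 AG; have cH := (faceP _).1 AH.
have FG' : F' <> G' by move=> E; apply: nf; apply: (@identity_orbit f G'); rewrite fE E.
have GH' : G' <> H by move=> E; apply: ng; apply: (@identity_orbit g H); rewrite gE E.
have lt1 : (codim P G' < codim P F')%N.
  by rewrite ltnNge; apply/negP => /(face_le_codim_eq cF' cG' FG).
have lt2 : (codim P H < codim P G')%N.
  by rewrite ltnNge; apply/negP => /(face_le_codim_eq cG' cH GH).
move: lt1 lt2; rewrite F'E HE !codim_translate // rFG ltnS => lt1 lt2.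
by move: (leq_trans lt2 lt1); rewrite ltnn.
Qed.

Lemma face_matching_matching : matching face_matching.
Proof.
split; first exact: face_matching_indecomposable.
move=> m m' [F [G [MFG mE]]] [F' [G' [MF' mE']]] mm'.
have val_neq : pair_orbit F G <> pair_orbit F' G'.
  by move=> E; apply: mm'; apply: val_inj; rewrite mE mE'.
have neq (x y : face_ob A) (K K' : set V) : \val x = face_orbit K -> \val y = face_orbit K' ->
    face_orbit K <> face_orbit K' -> x <> y.
  by move=> xE yE KK xy; apply: KK; rewrite -xE -yE xy.
have s := face_src_orbit mE; have t := face_tgt_orbit mE.
have s' := face_src_orbit mE'; have t' := face_tgt_orbit mE'.
have st := neq _ _ _ _ s t (orbit_source_target MFG MFG).
have st' := neq _ _ _ _ s t' (orbit_source_target MFG MF').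
have ts' := neq _ _ _ _ s' t (orbit_source_target MF' MFG).
have s't' := neq _ _ _ _ s' t' (orbit_source_target MF' MF').
have ss' : face_src (m : face_mor A) <> face_src (m' : face_mor A).
  by apply: (neq _ _ _ _ s s') => E; apply: val_neq; exact: (orbit_sourceL MFG MF' E).
have tt' : face_tgt (m : face_mor A) <> face_tgt (m' : face_mor A).
  by apply: (neq _ _ _ _ t t') => E; apply: val_neq; exact: (orbit_targetR MFG MF' E).
by apply: uniq4 => // /esym.
Qed.

(** The codimension cannot decrease along a cycle, so it is constant on the sources;
    lifting the cycle step by step then gives an infinite gradient path in the
    universal cover. *)
Lemma face_matching_acyclic n (a b : 'I_n -> mor C) : ~ matching_cycle face_matching a b.
Proof.
case: n a b => [|n] a b [] // _ aM bM tgt_ab src_ab.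
have bFG i : exists FG : set V * set V,
    M FG.1 FG.2 /\ \val (b i : face_mor A) = pair_orbit FG.1 FG.2.
  by have [F [G H]] := bM i; exists (F, G).
have [FG HFG] := choice bFG.
pose cod i := codim P (FG i).1.
have cell1 i : is_cell P (FG i).1 by have [H _] := HFG i; exact: matching_cellL H.
(* on a cycle every source has the maximal codimension *)
have [i0 _ max_i0] := arg_maxnP (P := predT) cod (isT : predT (ord0 : 'I_n.+1)).
suff noF F : forall i v, F = translate v (FG i).1 -> cod i = cod i0 -> False.
  exact: (noF _ i0 0 (esym (translate0 _)) erefl).
elim: (matching_acyclic Mm F) => {}F _ IHF i v FE ci.
have [Mi bi] := HFG i; set G := translate v (FG i).2.
have MFG : M F G by rewrite FE; exact: (matching_translate Mm v Mi).
have [Fa [Ga [AFa AGa FGa aE]]] := face_morW (a i : face_mor A).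
have : face_orbit G = face_orbit Ga.
  rewrite -(face_tgt_orbit aE) -[face_tgt _]/(tgt (a i)) tgt_ab.
  rewrite -[tgt _]/(face_tgt (b i : face_mor A)) (face_tgt_orbit bi).
  by apply/esym/face_orbitP; exists v.
move=> /esym/face_orbitP [u GE].
pose F' := translate u Fa; have F'G : face_le F' G by rewrite GE; exact: face_le_translate.
have aE' : \val (a i : face_mor A) = pair_orbit F' G.
  by rewrite aE; apply/pair_orbitP; exists u.
pose j := ord_pred i; have ij : ordS j = i by exact: ord_predK.
have [Mj bj] := HFG j.
have [w F'w] : exists w, F' = translate w (FG j).1.
  apply/face_orbitP; rewrite -(face_src_orbit bj) -(face_src_orbit aE').
  by rewrite -[face_src (a i : face_mor A)]/(src (a i)) -ij src_ab.
have MF' : M F' (translate w (FG j).2) by rewrite F'w; exact: (matching_translate Mm w Mj).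
have cF' := matching_cellL Mm MF'; have cG := matching_cellR Mm MFG.
have rF : codim P F = cod i by rewrite FE codim_translate.
have rF' : codim P F' = cod j by rewrite F'w codim_translate.
have rFG := matching_codim Mm MFG.
have F'F : F' <> F.
  by move=> E; apply: (aM i); exists F, G; rewrite aE' E.
have rle : (codim P F <= codim P F')%N.
  rewrite rFG ltnNge; apply/negP => /(face_le_codim_eq cF' cG F'G) E.
  by rewrite E in MF'; exact: (matching_disjoint Mm MFG MF').
have cj : cod j = cod i0.
  apply/eqP; rewrite eqn_leq; apply/andP; split; first exact: (max_i0 j isT).
  by rewrite -ci -rF -rF'.
apply: (IHF F' _ j w F'w cj); exists G; split=> //.
  by exists (translate w (FG j).2).
by rewrite rF rF' ci cj.
Qed.

Lemma critical_orbit (x : face_ob A) F : \val x = face_orbit F -> is_cell P F ->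
  @critical C face_matching x <-> critical_cell P M F.
Proof.
move=> xE cF; split=> [cx|[_ nup ndown] m [F1 [G1 [MFG mE]]]].
  have mk F1 G1 : M F1 G1 -> exists2 m : face_mor A,
      face_matching m & \val m = pair_orbit F1 G1.
    move=> MFG; have mP : pair_orbit F1 G1 \in face_mor A.
      apply/mem_set; exists F1, G1; split=> //.
      + by apply/faceP; exact: (matching_cellL Mm MFG).
      + by apply/faceP; exact: (matching_cellR Mm MFG).
      exact: (matching_le Mm MFG).
    by exists (SigSub mP) => //; exists F1, G1.
  split=> // [[G MFG]|[E MEF]].
    have [m mM mE] := mk _ _ MFG; have [sx _] := cx m mM; apply: sx; apply: val_inj.
    by rewrite xE; exact: face_src_orbit mE.
  have [m mM mE] := mk _ _ MEF; have [_ tx] := cx m mM; apply: tx; apply: val_inj.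
  by rewrite xE; exact: face_tgt_orbit mE.
split=> E.
  have := face_src_orbit mE; rewrite -[face_src _]/(src (m : mor C)) E xE.
  move=> /esym/face_orbitP [v FE]; apply: nup; exists (translate v G1).
  by rewrite FE; exact: (matching_translate Mm v MFG).
have := face_tgt_orbit mE; rewrite -[face_tgt _]/(tgt (m : mor C)) E xE.
move=> /esym/face_orbitP [v FE]; apply: ndown; exists (translate v F1).
by rewrite FE; exact: (matching_translate Mm v MFG).
Qed.

Lemma face_rank_orbit (x : face_ob A) F : \val x = face_orbit F -> is_cell P F ->
  face_rank A x = (d - codim P F)%N.
Proof.
move=> xE cF; rewrite /face_rank xE.
have : face_orbit F (xget set0 (face_orbit F)).
  by apply: (@xgetPex _ set0 (face_orbit F)); exists F, 0 => //; exact: translate0.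
move=> [v _ <-]; rewrite -(codim_translate v cF).
have [y yE] := is_cell_translate v cF.
by rewrite yE face_dim_cell (codimE (cell_is_cell P y) (cell_refl y)).
Qed.

Lemma rank_lift_seq : \rank (rat_span (map fst P)) = d.
Proof.
rewrite -[RHS]Ae /rat_span big_map /lift_seq big_map.
by congr (\rank _).
Qed.

Lemma critical_card k :
  (forall c, critical_count P M 0 c 'C(\rank (rat_span (map fst P)), c)) ->
  [set x : ob C | critical face_matching x /\ face_rank A x = k] #= `I_'C(d, k).
Proof.
rewrite rank_lift_seq => count.
have codim_le F : is_cell P F -> (codim P F <= d)%N.
  move=> cF; have [x Fx] := is_cell_ex cF; rewrite (codimE cF Fx) /crk.
  exact: rank_leq_row.
set B := [set x | _].
have B_cell (x : ob C) : B x -> exists F, [/\ \val (x : face_ob A) = face_orbit F,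
    critical_cell P M F & (d - codim P F)%N = k].
  move=> [cx rx]; have [F AF /esym xE] := set_mem (valP (x : face_ob A)).
  have cF := (faceP F).1 AF; exists F; split=> //; first exact: (critical_orbit xE cF).1.
  by rewrite -(face_rank_orbit xE cF).
have [kd|dk] := leqP k d; last first.
  rewrite bin_small // II0 card_eq0; apply/eqP/seteqP; split=> // x /B_cell [F [_ _ E]].
  by move: dk; rewrite -E ltnNge leq_subr.
have [rep [repC repI repS]] := count (d - k)%N.
rewrite bin_sub // in rep repC repI repS.
have cell_rep i : is_cell P (rep i) by case: (repC i) => -[].
have cod_rep i : codim P (rep i) = (d - k)%N by case: (repC i) => _; rewrite addn0.
have X_ex i : exists x : face_ob A, \val x = face_orbit (rep i).
  have xP : face_orbit (rep i) \in face_ob A.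
    by apply/mem_set; exists (rep i) => //; exact/faceP.
  by exists (SigSub xP).
have [X XE] := choice X_ex.
have BX i : B (X i).
  split; first by apply/(critical_orbit (XE i) (cell_rep i)); case: (repC i).
  by rewrite (face_rank_orbit (XE i) (cell_rep i)) cod_rep subKn.
have X_surj x : B x -> exists i, x = X i.
  move=> /B_cell [F [xE CF rF]]; have cF : is_cell P F by case: CF.
  have [|i [v FE]] := repS F CF; first by rewrite addn0 -rF subKn // codim_le.
  exists i; apply: val_inj; rewrite xE XE FE; apply/esym/face_orbitP; by exists v.
have X_inj i j : X i = X j -> i = j.
  move=> /(congr1 (fun x : face_ob A => \val x)); rewrite !XE.
  by move=> /esym/face_orbitP [v E]; exact: repI E.
move: rep repC repI repS cell_rep cod_rep X_ex X XE BX X_surj X_inj.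
case: 'C(d, k) => [|n] rep _ _ _ _ _ _ X _ BX X_surj X_inj.
  by rewrite II0 card_eq0; apply/eqP/seteqP; split=> // x /X_surj [[]].
have -> : B = (fun m : nat => X (inord m)) @` `I_n.+1.
  apply/seteqP; split=> [x /X_surj [i ->]|_ [m _ <-]]; last exact: BX.
  by exists (i : nat); [exact: ltn_ord | rewrite inord_val].
apply: inj_card_eq => i j /set_mem /= iN /set_mem /= jN /X_inj.
by move=> /(congr1 val); rewrite /= !inordK.
Qed.

End PerfectMatching.

Theorem proposition91 (R : realType) (d : nat) (A : toric_arrangement R d)
    (A_complexified : complexified A) (A_primitive : primitive A)
    (A_essential : essential A) :
  exists M : set (mor (face_category A_complexified A_essential)),
    perfect_acyclic_matching R
      (C := face_category A_complexified A_essential)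
      (face_rank A) (set_type (compact_torus R d)) M.
Proof.
have [M [Mm count]] := perfect_cell_matching (lift_seq A).
exists (face_matching M); split.
  split; first exact: face_matching_matching.
  by move=> n a b; exact: face_matching_acyclic.
move=> k; exists 'C(d, k); first exact: torus_betti_number.
exact: critical_card.
Qed.
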